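(* Let $m,\ell$ be nonzero integers with $m\neq \ell$, and suppose $g\in BS(m,\ell)$ has alternating $t$-shape. Then there is a finite-dimensional, rational linear programming problem whose solution yields the stable commutator length of $g$: it is constructed algorithmically from $m$, $\ell$ and a word representing $g$, and if $\theta$ denotes its optimal value (a maximum) then $\operatorname{scl}(g)=\frac{|g|_t}{4}-\frac{\theta}{2}$. In particular, $\operatorname{scl}(g)$ is computable (there is an algorithm that, given $m\ne\ell$ and a word representing an element $g$ of alternating $t$-shape, outputs $\operatorname{scl}(g)$) and $\operatorname{scl}(g)$ is a rational number.
   Context: $BS(m,\ell)=\langle a,t\mid t a^m t^{-1}=a^{\ell}\rangle$. For a word $w$ in $a^{\pm1},t^{\pm1}$, $|w|_t$ is the number of occurrences of $t$ and $t^{-1}$ in $w$; for $g\in BS(m,\ell)$, $|g|_t$ is the minimum of $|w|_t$ over all words $w$ representing a conjugate of $g$. A cyclically reduced word representing the conjugacy class of $g$ is a word $w=t^{\epsilon_1}a^{k_1}t^{\epsilon_2}\cdots t^{\epsilon_n}a^{k_n}$ representing a conjugate of $g$ such that $\epsilon_i\in\{1,-1\}$; $m\nmid k_i$ if $\epsilon_i=1,\epsilon_{i+1}=-1$; $\ell\nmid k_i$ if $\epsilon_i=-1,\epsilon_{i+1}=1$ (subscripts modulo $n$); and $|g|_t=|w|_t=n$. The element $g$ has alternating $t$-shape if it has a conjugate represented by such a word with $n$ even, $n\geq 2$, and $\epsilon_i=(-1)^{i-1}$ for all $i$. A rational linear programming problem is the problem of maximizing a linear functional with rational coefficients over a polyhedron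 in a finite-dimensional real vector space cut out by finitely many linear equations and inequalities with rational coefficients. Stable commutator length in a group $G$: for $g\in[G,G]$, $\operatorname{scl}(g)=\lim_{n\to\infty}\operatorname{cl}(g^n)/n$, where $\operatorname{cl}$ is the least number of commutators whose product is the given element; if $g^k\in[G,G]$ for some $k\geq1$, $\operatorname{scl}(g)=\operatorname{scl}(g^k)/k$; otherwise $\operatorname{scl}(g)=\infty$. *)

(* Defs.v *)
From HB Require Import structures.
From mathcomp Require Import all_boot all_order all_algebra.
From mathcomp Require Import all_classical all_reals all_analysis.

Set Implicit Arguments.
Unset Strict Implicit.
Unset Printing Implicit Defensive.

Import Order.TTheory GRing.Theory Num.Theory.
Import numFieldNormedType.Exports.

Local Open Scope classical_set_scope.
Local Open Scope ring_scope.

(* The least natural number satisfying P, and 0 if there is none. *)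
Definition least (P : nat -> Prop) : nat :=
  xget 0%N [set n : nat | P n /\ forall k, P k -> (n <= k)%N].

(** Stable commutator length *)

Section Scl.
Variable G : groupType.
Implicit Type g : G.

(* Inverses of commutators are commutators, so this set is all of [G, G]. *)
Definition is_comm_prod g (s : seq (G * G)) : Prop :=
  g = (\prod_(c <- s) [~ c.1, c.2])%g.

Definition in_derived g : Prop := exists s : seq (G * G), is_comm_prod g s.

Definition cl g : nat :=
  least (fun n => exists2 s : seq (G * G), is_comm_prod g s & size s = n).

(* scl on [G, G]. *)
Definition scl_derived (R : realType) g : R :=
  lim (((cl (g ^+ n)%g)%:R / n%:R : R) @[n --> \oo]).

(* The exponent k is the least positive one with g ^ k in [G, G]; in particular
   k = 1 when g itself lies in [G, G], and k = 0 when no such exponent exists. *)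
Definition scl (R : realType) g : \bar R :=
  let k := least (fun k => (0 < k)%N /\ in_derived (g ^+ k)%g) in
  if k == 0%N then +oo%E else (scl_derived R (g ^+ k)%g / k%:R)%:E.

Definition conjugate (g h : G) : Prop := exists x : G, h = (g ^ x)%g.

End Scl.

(** Groups given by generators and relations *)

(* A letter (x, e) is the generator x if e = false, and its inverse if
   e = true. *)
Definition word (X : Type) := seq (X * bool).

Section Presentation.
Variables (X : choiceType) (rels : word X -> word X -> Prop).

Inductive pres_eq : word X -> word X -> Prop :=
| pres_refl u : pres_eq u u
| pres_sym u v : pres_eq u v -> pres_eq v u
| pres_trans u v w : pres_eq u v -> pres_eq v w -> pres_eq u w
| pres_cat u u' v v' :
    pres_eq u u' -> pres_eq v v' -> pres_eq (u ++ v) (u' ++ v')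
| pres_cancel x e : pres_eq [:: (x, e); (x, ~~ e)] [::]
| pres_rel u v : rels u v -> pres_eq u v.

Definition pres_eqb : rel (word X) := fun u v => `[< pres_eq u v >].

Lemma pres_eqb_refl : reflexive pres_eqb.
Proof. by move=> u; apply/asboolP; exact: pres_refl. Qed.

Lemma pres_eqb_sym : symmetric pres_eqb.
Proof. by move=> u v; apply/asboolP/asboolP; exact: pres_sym. Qed.

Lemma pres_eqb_trans : transitive pres_eqb.
Proof.
move=> v u w /asboolP uv /asboolP vw; apply/asboolP; exact: pres_trans uv vw.
Qed.

Canonical pres_equiv :=
  EquivRel pres_eqb pres_eqb_refl pres_eqb_sym pres_eqb_trans.

Definition presented_group := {eq_quot pres_equiv}%qT.
HB.instance Definition _ := Choice.on presented_group.
HB.instance Definition _ := Quotient.on presented_group.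

Definition word_eval (w : word X) : presented_group := \pi_presented_group%qT w.

Definition word_inv (w : word X) : word X := rev [seq (x.1, ~~ x.2) | x <- w].

Lemma word_evalP u v : word_eval u = word_eval v <-> pres_eq u v.
Proof.
by split=> [/eqquotP/asboolP//|uv]; apply/eqquotP/asboolP.
Qed.

Lemma repr_word_eval u : pres_eq (repr (word_eval u)) u.
Proof. by apply/word_evalP; rewrite /word_eval reprK. Qed.

Lemma pres_invr w : pres_eq (w ++ word_inv w) [::].
Proof.
elim: w => [|[x e] w IHw]; first exact: pres_refl.
have -> : ((x, e) :: w) ++ word_inv ((x, e) :: w)
    = [:: (x, e)] ++ ((w ++ word_inv w) ++ [:: (x, ~~ e)]).
  by rewrite /word_inv /= rev_cons -cats1 catA.
apply: pres_trans (pres_cancel x e).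
apply: (@pres_cat [:: _] [:: _] _ [:: _]); first exact: pres_refl.
exact: (@pres_cat _ [::] _ [:: _]) IHw (pres_refl _).
Qed.

Lemma word_invK : involutive word_inv.
Proof.
move=> w; rewrite /word_inv map_rev revK -map_comp.
by rewrite -[RHS]map_id; apply: eq_map => -[x e] /=; rewrite negbK.
Qed.

Lemma pres_invl w : pres_eq (word_inv w ++ w) [::].
Proof. by rewrite -{2}[w]word_invK; exact: pres_invr. Qed.

Definition pres_mul (g h : presented_group) := word_eval (repr g ++ repr h).
Definition pres_inv (g : presented_group) := word_eval (word_inv (repr g)).

Lemma word_eval_repr (g : presented_group) : word_eval (repr g) = g.
Proof. exact: reprK. Qed.

Lemma pres_mulA : associative pres_mul.
Proof.
move=> f g h; apply/word_evalP; apply: (@pres_trans _ (repr f ++ repr g ++ repr h)).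
  by apply: pres_cat; [exact: pres_refl | exact: repr_word_eval].
rewrite catA; apply: pres_sym.
by apply: pres_cat; [exact: repr_word_eval | exact: pres_refl].
Qed.

Lemma pres_mul1 : left_id (word_eval [::]) pres_mul.
Proof.
move=> g; rewrite -[RHS]word_eval_repr; apply/word_evalP.
exact: (@pres_cat _ [::]) (repr_word_eval _) (pres_refl _).
Qed.

Lemma pres_mulr1 : right_id (word_eval [::]) pres_mul.
Proof.
move=> g; rewrite -[RHS]word_eval_repr; apply/word_evalP.
rewrite -[X in pres_eq _ X]cats0.
exact: pres_cat (pres_refl _) (repr_word_eval _).
Qed.

Lemma pres_mulV : left_inverse (word_eval [::]) pres_inv pres_mul.
Proof.
move=> g; apply/word_evalP; apply: pres_trans (pres_invl (repr g)).
exact: pres_cat (repr_word_eval _) (pres_refl _).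
Qed.

Lemma pres_mulrV : right_inverse (word_eval [::]) pres_inv pres_mul.
Proof.
move=> g; apply/word_evalP; apply: pres_trans (pres_invr (repr g)).
exact: pres_cat (pres_refl _) (repr_word_eval _).
Qed.

HB.instance Definition _ := isGroup.Build presented_group
  pres_mulA pres_mul1 pres_mulr1 pres_mulV pres_mulrV.

End Presentation.

(** Baumslag-Solitar groups *)

(* The generator false is a, the generator true is t. *)
Definition bs_word := word bool.
Definition let_t (inverted : bool) : bool * bool := (true, inverted).
Definition a_pow (k : int) : bs_word := nseq `|k|%N (false, k < 0).

Inductive bs_rel (m l : int) : bs_word -> bs_word -> Prop :=
| BSRel : bs_rel m l (let_t false :: a_pow m ++ [:: let_t true]) (a_pow l).

Definition BS (m l : int) : groupType := presented_group (bs_rel m l).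
Definition bs_eval (m l : int) (w : bs_word) : BS m l :=
  word_eval (bs_rel m l) w.

Definition t_count (w : bs_word) : nat := count (fun x => x.1) w.

Section TLength.
Variables m l : int.
Implicit Types (g : BS m l) (s : seq (bool * int)).

Definition t_length g : nat :=
  least (fun n => exists2 w, conjugate g (bs_eval m l w) & t_count w = n).

(* A pair (e, k) stands for t^eps a^k, where eps = -1 if e and eps = 1
   otherwise. *)
Definition syllable_word s : bs_word :=
  flatten [seq let_t x.1 :: a_pow x.2 | x <- s].

Definition syl_neg s (i : nat) : bool := (nth (false, 0) s (i %% size s)).1.
Definition syl_exp s (i : nat) : int := (nth (false, 0) s (i %% size s)).2.

Definition cyclically_reduced_for g s : Prop :=
  [/\ conjugate g (bs_eval m l (syllable_word s)),
      forall i, (i < size s)%N ->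
        syl_neg s i = false -> syl_neg s i.+1 = true ->
        ~~ (m %| syl_exp s i)%Z,
      forall i, (i < size s)%N ->
        syl_neg s i = true -> syl_neg s i.+1 = false ->
        ~~ (l %| syl_exp s i)%Z,
      t_length g = t_count (syllable_word s)
    & t_count (syllable_word s) = size s].

(* Indices start at 0 here, so the exponent of t at i is (-1)^i. *)
Definition alternating_t_shape g : Prop :=
  exists s, [/\ cyclically_reduced_for g s, ~~ odd (size s), (2 <= size s)%N
              & forall i, (i < size s)%N -> syl_neg s i = odd i].

End TLength.

(** Rational linear programming *)

Record ratLP := RatLP {
  lp_dim : nat;
  lp_obj : 'rV[rat]_lp_dim;
  lp_eqs : seq ('rV[rat]_lp_dim * rat);
  lp_ineqs : seq ('rV[rat]_lp_dim * rat)
}.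

Definition lp_form (R : realType) n (c : 'rV[rat]_n) (x : 'rV[R]_n) : R :=
  \sum_(i < n) ratr (c ord0 i) * x ord0 i.

Definition lp_feasible (R : realType) (P : ratLP) (x : 'rV[R]_(lp_dim P)) :
    Prop :=
  (forall c, c \in lp_eqs P -> lp_form c.1 x = ratr c.2) /\
  (forall c, c \in lp_ineqs P -> lp_form c.1 x <= ratr c.2).

Definition lp_maximum (R : realType) (P : ratLP) (theta : R) : Prop :=
  (exists2 x : 'rV[R]_(lp_dim P), lp_feasible x & lp_form (lp_obj P) x = theta)
  /\ forall y : 'rV[R]_(lp_dim P), lp_feasible y ->
       lp_form (lp_obj P) y <= theta.

(** Algorithms *)

(* The model of computation is Jones's WHILE language, in a variable-free form:
   programs transform finite binary trees.  It is Turing complete. *)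

Inductive tree := Leaf | Node of tree & tree.

Inductive prog :=
| PId
| PLeaf
| PNode of prog & prog
| PLeft
| PRight
| PSeq of prog & prog
| PIf of prog & prog & prog
| PWhile of prog & prog.

(* runs p x y: the program p, started on input x, halts with output y.  A test
   succeeds when its result is not a leaf. *)
Inductive runs : prog -> tree -> tree -> Prop :=
| RunId x : runs PId x x
| RunLeaf x : runs PLeaf x Leaf
| RunNode p q x y z : runs p x y -> runs q x z -> runs (PNode p q) x (Node y z)
| RunLeft x y : runs PLeft (Node x y) x
| RunLeft0 : runs PLeft Leaf Leaf
| RunRight x y : runs PRight (Node x y) y
| RunRight0 : runs PRight Leaf Leaf
| RunSeq p q x y z : runs p x y -> runs q y z -> runs (PSeq p q) x z
| RunIfT b p q x u v y :
    runs b x (Node u v) -> runs p x y -> runs (PIf b p q) x y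
| RunIfF b p q x y : runs b x Leaf -> runs q x y -> runs (PIf b p q) x y
| RunWhileT b p x u v y z :
    runs b x (Node u v) -> runs p x y -> runs (PWhile b p) y z ->
    runs (PWhile b p) x z
| RunWhileF b p x : runs b x Leaf -> runs (PWhile b p) x x.

Definition enc_bool (b : bool) : tree := if b then Node Leaf Leaf else Leaf.
Definition enc_nat (n : nat) : tree := iter n (Node Leaf) Leaf.
Definition enc_int (k : int) : tree := Node (enc_bool (k < 0)) (enc_nat `|k|%N).
Definition enc_rat (q : rat) : tree := Node (enc_int (numq q)) (enc_int (denq q)).

Definition enc_pair (S T : Type) (encS : S -> tree) (encT : T -> tree)
  (x : S * T) : tree := Node (encS x.1) (encT x.2).
Definition enc_seq (T : Type) (encT : T -> tree) (s : seq T) : tree :=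
  foldr (fun x => Node (encT x)) Leaf s.
Definition enc_row n (c : 'rV[rat]_n) : tree :=
  enc_seq enc_rat [seq c ord0 i | i <- enum 'I_n].

Definition enc_bs_word : bs_word -> tree := enc_seq (enc_pair enc_bool enc_bool).

Definition enc_ratLP (P : ratLP) : tree :=
  Node (Node (enc_nat (lp_dim P)) (enc_row (lp_obj P)))
       (Node (enc_seq (enc_pair (@enc_row _) enc_rat) (lp_eqs P))
             (enc_seq (enc_pair (@enc_row _) enc_rat) (lp_ineqs P))).

Definition bs_input := (int * int * bs_word)%type.
Definition enc_bs_input : bs_input -> tree :=
  enc_pair (enc_pair enc_int enc_int) enc_bs_word.

Definition computable_on (S T : Type) (encS : S -> tree) (encT : T -> tree)
    (D : S -> Prop) (f : S -> T) : Prop :=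
  exists p : prog, forall x, D x -> runs p (encS x) (encT (f x)).

Definition alternating_input (x : bs_input) : Prop :=
  let: (m, l, w) := x in
  [/\ m != 0, l != 0, m != l & alternating_t_shape (bs_eval m l w)].

(* Main.v *)
Require Import Defs.
From HB Require Import structures.
From mathcomp Require Import all_classical all_reals all_analysis.
From mathcomp Require Import all_boot all_order all_algebra all_fingroup.
From mathcomp Require Import zify ring lra.

Set Implicit Arguments.
Unset Strict Implicit.
Unset Printing Implicit Defensive.

Import Order.TTheory GRing.Theory Num.Theory.
Import numFieldNormedType.Exports.

Local Open Scope ring_scope.

(** Why the theorem holds.

   Put b = t a t^-1, so that b^m = a^l =: zeta.  An element of alternating
   shape with |g|_t = 2N is conjugate to the product over k < N of
   b^(x_k) a^(y_k), where m divides no x_k and l divides no y_k.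

   Let a surface be bounded by a power g^n, and cut it along the preimage of
   the edge t of the presentation complex.  The cut consists of nN strips, and
   the regions left over are polygons of two colours: an X-polygon reads a
   product of powers b^(x_k), a Y-polygon a product of powers a^(y_k), so that
   each of them is a closed walk on the indices k < N.  The side of an X-polygon
   between the corners k and j is glued to the side of a Y-polygon between the
   corners j - 1 and k.  A region that is not a disc has Euler characteristic
   at most 0, and it can be a disc only if its exponents add up to a multiple
   of m (of l for the colour Y), since the strips contribute powers of zeta.
   The Euler characteristic is therefore at most D - nN, where D counts the
   polygons whose exponent sum is such a multiple.  If theta is the largest
   value of D / n, this means scl(g) = (N - theta) / 2.  Maximizing D / n is a
   linear program in the multiplicities of the closed walks, and walks of
   bounded length suffice, so that theta is rational.

   Both inequalities are proved without topology.

   Lower bound.  A [diagram] is the combinatorial pattern of strips and regions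
   of such a surface, and [sbounds e ws] says that the cyclic words ws carry a
   diagram with at least e more discs than strips, up to stabilization.  This
   relation survives rewriting the words by the relations of the group
   ([eqv_pres]), hence a product of k commutators carries a diagram with
   e = 1 - 2 k ([sbounds_ncomm]).  A dual solution of the linear program prices
   the regions so that the prices of the sides cancel; summing them bounds the
   number of discs ([dual_bound]).

   Upper bound.  In any group (x y)^M differs from x^M y^M by M / 2 commutators
   ([near_expM]), so that joining two boundary curves, or cutting one, costs one
   unit of Euler characteristic per sheet.  Starting from the polygons of a
   primal solution, nN such steps lead to powers of g ([glue], [upper_bound]);
   the discs are free because zeta commutes with a and b, and because
   a^((l - m) i) is a single commutator ([null_a]).

   The two bounds meet by linear programming duality ([farkas_cone],
   [strong_duality], [optimum]), which gives scl(g) by [scl_alternating].  That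
   |g|_t = 2N for every such factorization, whatever conjugate it comes from,
   follows from the diagram of an annulus between two of them ([size_annulus]).

   Computability.  A derivation that conjugates the given word to a reduced
   product of the above form, together with a primal and a dual solution with
   the same value, is a certificate that determines scl(g), and certificates
   exist for all elements of alternating shape.  Checking a certificate is
   computable ([cmp_certified]), and a program may search through all of them
   ([computable_search]).  Once the program on closed walks has been solved in
   this way, the optimal value theta is also the maximum of x subject to
   x = theta, and this problem is the one that is written out ([point_LP]). *)

(** * Commutator length up to bounded error *)

Section CommutatorCost.
Local Open Scope group_scope.
Variable G : groupType.
Implicit Types (g h u v x y : G) (gs : seq G).

Definition ncomm n g := exists2 s : seq (G * G), is_comm_prod g s & size s = n.

Lemma ncomm0 : ncomm 0 1.
Proof. by exists [::]; rewrite /is_comm_prod ?big_nil. Qed.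

Lemma ncomm1 x y : ncomm 1 [~ x, y].
Proof. by exists [:: (x, y)]; rewrite /is_comm_prod ?big_seq1. Qed.

Lemma ncommM n n' g h : ncomm n g -> ncomm n' h -> ncomm (n + n') (g * h).
Proof.
move=> [s -> <-] [s' -> <-]; exists (s ++ s'); last by rewrite size_cat.
by rewrite /is_comm_prod big_cat.
Qed.

Lemma ncommJ n g x : ncomm n g -> ncomm n (g ^ x).
Proof.
move=> [s -> <-]; exists [seq (c.1 ^ x, c.2 ^ x) | c <- s]; last by rewrite size_map.
rewrite /is_comm_prod big_map conjg_prod; apply: eq_bigr => c _.
by rewrite conjRg.
Qed.

Lemma ncommV n g : ncomm n g -> ncomm n g^-1.
Proof.
move=> [s -> <-]; elim: s => [|c s IHs].
  by rewrite big_nil invg1; exact: ncomm0.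
rewrite big_cons invgM /= -addn1 invgR; apply: ncommM => //; exact: ncomm1.
Qed.

(** The elements g and h differ by a product of n commutators; this is a
   length metric for which left and right multiplications are isometries. *)
Definition near n g h := exists2 c, ncomm n c & g = h * c.

Lemma near_refl g : near 0 g g.
Proof. by exists 1; rewrite ?mulg1 //; exact: ncomm0. Qed.

Lemma near_sym n g h : near n g h -> near n h g.
Proof. by case=> c /ncommV cn ->; exists c^-1; rewrite ?mulgK. Qed.

Lemma near_trans n n' g h k : near n g h -> near n' h k -> near (n + n') g k.
Proof.
move=> [c cn ->] [d dn ->]; exists (d * c); rewrite ?mulgA // addnC.
exact: ncommM.
Qed.

Lemma near_mul n n' g h g' h' :
  near n g h -> near n' g' h' -> near (n + n') (g * g') (h * h').
Proof.
move=> [c cn ->] [d dn ->]; exists (c ^ h' * d).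
  by apply: ncommM => //; exact: ncommJ.
by rewrite -!(mulgA h) (mulgA c) (conjgC c) -!mulgA.
Qed.

Lemma near_mull n g h k : near n g h -> near n (k * g) (k * h).
Proof. by move=> gh; rewrite -[n]add0n; apply: near_mul gh; exact: near_refl. Qed.

Lemma near_mulr n g h k : near n g h -> near n (g * k) (h * k).
Proof. by move=> gh; rewrite -[n]addn0; apply: near_mul gh _; exact: near_refl. Qed.

Lemma near_conj g x : near 1 (g ^ x) g.
Proof. by exists [~ g, x]; [exact: ncomm1|rewrite commgEl mulVKg]. Qed.

Lemma near_comm x y : near 1 (x * y) (y * x).
Proof. by exists [~ x, y]; [exact: ncomm1|exact: commgC]. Qed.

Lemma near1 n g : near n g 1 -> ncomm n g.
Proof. by case=> c cn ->; rewrite mul1g. Qed.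

Lemma near_ncomm n g : ncomm n g -> near n g 1.
Proof. by exists g; rewrite ?mul1g. Qed.

Lemma near_ncommM n n' g h : near n g h -> ncomm n' h -> ncomm (n + n') g.
Proof. by move=> gh /near_ncomm h1; apply: near1; exact: near_trans gh h1. Qed.

(** Reversing a product of three blocks is a change of genus one: this is the
   Wicks form of length six. *)
Lemma near_rev3 x y z : near 1 (x * y * z) (z * y * x).
Proof.
exists [~ y * x, y * z]; first exact: ncomm1.
by rewrite commgEl conjgE !invgM !mulgA !(mulgK, mulgVK, mulgV, mul1g).
Qed.

Lemma near_expM_aux x y p q k :
  near (uphalf k) (x ^+ p * (y * x) ^+ k * y ^+ q) (x ^+ (p + k) * y ^+ (q + k)).
Proof.
elim/ltn_ind: k p q => -[|[|k]] IHk p q.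
- by rewrite mulg1 !addn0; exact: near_refl.
- rewrite expg1 !addn1 expgSr expgS -!mulgA; apply: near_mull.
  rewrite !mulgA; apply: near_mulr; exact: near_comm.
have -> : uphalf k.+2 = (1 + uphalf k)%N by [].
apply: (@near_trans _ _ _ (x ^+ p.+2 * (y * x) ^+ k * y ^+ q.+2)); last first.
  by rewrite -!addSnnS; apply: IHk; lia.
have -> : x ^+ p.+2 * (y * x) ^+ k * y ^+ q.+2 =
  x ^+ p * (x * (x * (y * x) ^+ k * y) * y) * y ^+ q.
  by rewrite (expgS y q.+1) (expgS y q) !expgSr !mulgA.
apply: near_mulr; apply: near_mull.
have -> : (y * x) ^+ k.+2 = y * (x * (y * x) ^+ k * y) * x.
  by rewrite expgS expgSr !mulgA.
exact: near_rev3.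
Qed.

(** Powers distribute over a product at the cost of one commutator for every
   two factors; the factor one half is what makes gluing two boundary
   curves of a surface cost exactly one unit of Euler characteristic. *)
Lemma near_expM x y n : near n./2 ((x * y) ^+ n) (x ^+ n * y ^+ n).
Proof.
case: n => [|n]; first by rewrite !expg0 mulg1; exact: near_refl.
have -> : (x * y) ^+ n.+1 = x ^+ 1 * (y * x) ^+ n * y ^+ 1.
  rewrite !expg1; elim: n => [|n IHn]; first by rewrite mulg1.
  by rewrite expgSr IHn expgSr !mulgA.
by have := near_expM_aux x y 1 1 n; rewrite !add1n.
Qed.

Lemma ncommX n g k : ncomm n g -> ncomm (k * n) (g ^+ k).
Proof.
move=> gn; elim: k => [|k IHk]; first exact: ncomm0.
by rewrite expgS mulSn; exact: ncommM.
Qed.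

Variable K : nat.

(** A stable filling estimate: the chain gs is filled by surfaces whose Euler
   characteristic is at least - q, per sheet of a cover; only exponents that
   are multiples of K are considered, so that torsion in the abelianization
   does not matter. *)
Definition fills q gs := exists C, forall M, exists n,
  (n.*2 <= q * (K * M) + C)%N /\ ncomm n (\prod_(g <- gs) g ^+ (K * M)).

Lemma fills_near q r C gs gs' :
  (forall M, exists n, (n.*2 <= r * (K * M) + C)%N /\
    near n (\prod_(g <- gs') g ^+ (K * M)) (\prod_(g <- gs) g ^+ (K * M))) ->
  fills q gs -> fills (q + r) gs'.
Proof.
move=> near_gs [C' gsC]; exists (C' + C)%N => M.
have [n [len nn]] := near_gs M; have [n' [len' nn']] := gsC M.
exists (n + n')%N; split; first by lia.
exact: near_ncommM nn nn'.
Qed.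

Lemma fills_near0 q C gs gs' :
  (forall M, near C (\prod_(g <- gs') g ^+ (K * M)) (\prod_(g <- gs) g ^+ (K * M))) ->
  fills q gs -> fills q gs'.
Proof.
move=> near_gs fl; rewrite -[q]addn0.
apply: (fills_near (C := C.*2) _ fl) => M; exists C; split; first by lia.
exact: near_gs.
Qed.

Lemma perm_near s s' (F : G -> G) : perm_eq s s' ->
  near (size s) (\prod_(g <- s) F g) (\prod_(g <- s') F g).
Proof.
elim: s s' => [|x s IHs] s'; first by rewrite perm_sym => /perm_nilP ->; exact: near_refl.
rewrite perm_sym => ss'; have xs' : x \in s' by rewrite (perm_mem ss') mem_head.
case/splitPr: xs' ss' => s1 s2; rewrite perm_catC cat_cons perm_cons => ss'.
rewrite big_cons big_cat big_cons /= -[(size s).+1]addn1.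
apply: (@near_trans _ _ _ (F x * (\prod_(g <- s1) F g * \prod_(g <- s2) F g))).
  by apply: near_mull; rewrite -big_cat; apply: IHs; rewrite perm_sym perm_catC.
by rewrite !mulgA; apply: near_mulr; exact: near_comm.
Qed.

Lemma fills_perm q gs gs' : perm_eq gs gs' -> fills q gs -> fills q gs'.
Proof.
move=> pgs; apply: (fills_near0 (C := size gs')) => M.
by apply: perm_near; rewrite perm_sym.
Qed.

Lemma fills_merge q u v gs : fills q [:: u, v & gs] -> fills q.+1 (u * v :: gs).
Proof.
rewrite -[q.+1]addn1; apply: (fills_near (C := 0%N)) => M; exists (K * M)./2.
split; first by lia.
by rewrite !big_cons !mulgA; apply: near_mulr; exact: near_expM.
Qed.

Lemma fills_split q u v gs : fills q (u * v :: gs) -> fills q.+1 [:: u, v & gs].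
Proof.
rewrite -[q.+1]addn1; apply: (fills_near (C := 0%N)) => M; exists (K * M)./2.
split; first by lia.
rewrite !big_cons !mulgA; apply: near_mulr.
by apply: near_sym; exact: near_expM.
Qed.

Lemma fills_conj q g x gs : fills q (g :: gs) -> fills q (g ^ x :: gs).
Proof.
apply: (fills_near0 (C := 1)) => M; rewrite !big_cons; apply: near_mulr.
by rewrite -conjXg; exact: near_conj.
Qed.

(** Such elements have stable commutator length 0, so that curves may be changed
   by them at no cost per sheet. *)
Definition null g := forall M, ncomm 1 (g ^+ (K * M)).

Lemma fills_null gs : (forall g, g \in gs -> null g) -> fills 0 gs.
Proof.
move=> gs0; exists (size gs).*2 => M; exists (size gs); split; first by lia.
elim: gs gs0 => [|g gs IHgs] gs0; first by rewrite big_nil; exact: ncomm0.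
rewrite big_cons -[size _]add1n; apply: ncommM; first by apply: gs0; rewrite mem_head.
by apply: IHgs => h hgs; apply: gs0; rewrite in_cons hgs orbT.
Qed.

Variables (Z H : G -> Prop).
Hypothesis ZM : forall x y, Z x -> Z y -> Z (x * y).
Hypothesis Znull : forall z, Z z -> null z.
Hypothesis ZH : forall z h, Z z -> H h -> commute z h.

(** The curves gs bound surfaces in which the marked curves bound discs, and e
   is a lower bound for the Euler characteristic per sheet.  As Z commutes with
   H and is stably trivial, the boundary of a disc only has to lie in Z. *)
Definition surf (e : int) gs := exists (ts : seq (bool * G)) q,
  [/\ map snd ts = gs, forall t, t \in ts -> t.1 -> Z t.2,
      fills q [seq t.2 | t <- ts & ~~ t.1]
    & (e + Posz q <= Posz (count fst ts))%R].

Lemma surf_null (ts : seq (bool * G)) :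
  (forall t, t \in ts -> t.1 -> Z t.2) ->
  (forall t, t \in ts -> null t.2) ->
  surf (Posz (count fst ts)) (map snd ts).
Proof.
move=> tsZ ts0; exists ts, 0%N; split=> //; last by rewrite addr0.
by apply: fills_null => g /mapP[t]; rewrite mem_filter => /andP[_ tts] ->; exact: ts0.
Qed.

Lemma perm_map_ex (T S : eqType) (f : T -> S) (s : seq T) (s' : seq S) :
  perm_eq (map f s) s' -> exists2 t, perm_eq s t & map f t = s'.
Proof.
case: s => [|x0 s].
  by rewrite perm_sym => /perm_nilP ->; exists [::].
move=> ps; have := ps; rewrite perm_sym => /(perm_iotaP (f x0))[Is pIs ->].
exists (map (nth x0 (x0 :: s)) Is).
  rewrite perm_sym -[X in perm_eq _ X](mkseq_nth x0) perm_map //.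
  by rewrite size_map in pIs.
rewrite -map_comp; apply/eq_in_map => i; rewrite (perm_mem pIs) mem_iota /= add0n => lti.
by rewrite -[f x0 :: _]/(map f (x0 :: s)) (nth_map x0) //; rewrite size_map in lti.
Qed.

Lemma surf_perm e gs gs' : perm_eq gs gs' -> surf e gs -> surf e gs'.
Proof.
move=> pgs [ts [q [tsgs tsZ fl le_q]]].
have [ts' pts <-] : exists2 t, perm_eq ts t & map snd t = gs'.
  by apply: perm_map_ex; rewrite tsgs.
exists ts', q; split=> //.
- by move=> t; rewrite -(perm_mem pts); exact: tsZ.
- apply: fills_perm fl; apply: perm_map; exact: perm_filter.
- by rewrite -(seq.permP pts).
Qed.

Lemma null_near z M g : null z -> near 1 (z ^+ (K * M) * g) g.
Proof.
move=> /(_ M) zn; rewrite -[X in near _ _ X]mul1g; apply: near_mulr.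
exact: near_ncomm.
Qed.

(** A disc whose boundary is joined to another curve disappears, which costs one
   unit; two curves that bound no discs are joined by a handle, which costs one
   unit as well, by [fills_merge]. *)
Lemma surf_merge e u v gs : H u -> H v ->
  surf e [:: u, v & gs] -> surf (e - 1) (u * v :: gs).
Proof.
move=> Hu Hv [] [|[b1 _] [|[b2 _] ts]] [q []] //= [-> -> <-].
move=> tsZ; have Z1 : b1 -> Z u by move=> b; apply: (tsZ (b1, u)); rewrite ?mem_head.
have Z2 : b2 -> Z v by move=> b; apply: (tsZ (b2, v)); rewrite // !in_cons eqxx orbT.
have {}tsZ t : t \in ts -> t.1 -> Z t.2.
  by move=> tts; apply: tsZ; rewrite !in_cons tts !orbT.
case: b1 b2 Z1 Z2 => -[] Z1 Z2 /= fl le_q.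
- exists ((true, u * v) :: ts), q; split=> //=; last by lia.
  by move=> t; rewrite in_cons => /orP[/eqP-> _|]; [apply: ZM; auto|exact: tsZ].
- exists ((false, u * v) :: ts), q; split=> //=; last by lia.
    by move=> t; rewrite in_cons => /orP[/eqP-> //|]; exact: tsZ.
  apply: (fills_near0 (C := 1)) fl => M; rewrite !big_cons; apply: near_mulr.
  rewrite expgMn; last by apply: ZH => //; auto.
  by apply: null_near; apply: Znull; auto.
- exists ((false, u * v) :: ts), q; split=> //=; last by lia.
    by move=> t; rewrite in_cons => /orP[/eqP-> //|]; exact: tsZ.
  apply: (fills_near0 (C := 1)) fl => M; rewrite !big_cons; apply: near_mulr.
  have cvu : commute v u by apply: ZH => //; auto.
  rewrite -cvu expgMn //.
  by apply: null_near; apply: Znull; auto.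
- exists ((false, u * v) :: ts), q.+1; split=> //=; last by lia.
    by move=> t; rewrite in_cons => /orP[/eqP-> //|]; exact: tsZ.
  exact: fills_merge.
Qed.

Lemma surf_split e u v gs : H u ->
  surf e (u * v :: gs) -> surf (e - 1) [:: u, v & gs].
Proof.
move=> Hu [] [|[b1 _] ts] [q []] //= [-> <-] tsZ.
have Z1 : b1 -> Z (u * v) by move=> b; apply: (tsZ (b1, u * v)); rewrite ?mem_head.
have {}tsZ t : t \in ts -> t.1 -> Z t.2.
  by move=> tts; apply: tsZ; rewrite !in_cons tts !orbT.
case: b1 Z1 => Z1 /= fl le_q.
- exists [:: (false, u), (false, v) & ts], q; split=> //=; last by lia.
    by move=> t; rewrite !in_cons => /or3P[/eqP->//|/eqP->//|]; exact: tsZ.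
  apply: (fills_near0 (C := 1)) fl => M; rewrite !big_cons mulgA -[X in near _ _ X]mul1g.
  apply: near_mulr.
  have cuv : commute u (u * v) by apply: commute_sym; apply: ZH => //; auto.
  have {1}-> : v = u^-1 * (u * v) by rewrite mulKg.
  rewrite expgMn; last by apply: commute_sym; apply: commuteV; apply: commute_sym.
  by rewrite expVgn mulVKg; apply: near_ncomm; apply: Znull; auto.
- exists [:: (false, u), (false, v) & ts], q.+1; split=> //=; last by lia.
    by move=> t; rewrite !in_cons => /or3P[/eqP->//|/eqP->//|]; exact: tsZ.
  exact: fills_split.
Qed.

Lemma surf_rot e u v gs : H u -> surf e (u * v :: gs) -> surf e (v * u :: gs).
Proof.
move=> Hu [] [|[b1 _] ts] [q []] //= [-> <-] tsZ.
have Z1 : b1 -> Z (u * v) by move=> b; apply: (tsZ (b1, u * v)); rewrite ?mem_head.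
have {}tsZ t : t \in ts -> t.1 -> Z t.2.
  by move=> tts; apply: tsZ; rewrite !in_cons tts !orbT.
case: b1 Z1 => Z1 /= fl le_q.
- have -> : v * u = u * v.
    by apply: (mulgI u); rewrite mulgA; exact: ZH (Z1 isT) Hu.
  exists ((true, u * v) :: ts), q; split=> //.
  by move=> t; rewrite in_cons => /orP[/eqP->|]; [|exact: tsZ].
- exists ((false, v * u) :: ts), q; split=> //=.
    by move=> t; rewrite in_cons => /orP[/eqP-> //|]; exact: tsZ.
  have -> : v * u = (u * v) ^ u by rewrite conjgE !mulgA mulVg mul1g.
  exact: fills_conj.
Qed.

End CommutatorCost.

(** * Permutations with integer weights on their points *)

Section ZeroOrbits.
Variable T : finType.
Implicit Types (c s p : {perm T}) (v : T -> int) (x y z : T) (O : {set T}).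

Definition orb_sum c v x : int := \sum_(z in porbit c x) v z.

Definition zero_orbits c v : {set {set T}} :=
  [set O in porbits c | \sum_(z in O) v z == 0].

(** The orbits that composing with the transposition of x and y leaves alone. *)
Definition avoiding x y c v : {set {set T}} :=
  [set O in zero_orbits c v | (x \notin O) && (y \notin O)].

Lemma porbit_avoid c c' x y z :
  (forall u, c u != x -> c u != y -> c' u = c u) ->
  x \notin porbit c z -> y \notin porbit c z -> porbit c' z = porbit c z.
Proof.
move=> cc' xz yz; have iterE i : iter i c' z = iter i c z.
  elim: i => //= i ->; rewrite cc' //; apply/eqP => e.
    by case/negP: xz; rewrite -e -iterS -permX mem_porbit.
  by case/negP: yz; rewrite -e -iterS -permX mem_porbit.
apply/setP => u; apply/porbitP/porbitP => -[i ->]; exists i.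
  by rewrite !permX iterE.
by rewrite !permX iterE.
Qed.

Lemma avoiding_sub c c' v v' x y :
  (forall u, c u != x -> c u != y -> c' u = c u) ->
  (forall u, u != x -> u != y -> v' u = v u) ->
  avoiding x y c v \subset avoiding x y c' v'.
Proof.
move=> cc' vv'; apply/subsetP => O; rewrite !inE => /andP[/andP[/imsetP[z _ ->]]].
move=> s0 /andP[xO yO]; rewrite xO yO !andbT -{1}(porbit_avoid cc' xO yO) imset_f //=.
apply/eqP; rewrite -[RHS](eqP s0); apply: eq_bigr => u uO; apply: vv'.
  by apply: contraNneq xO => <-.
by apply: contraNneq yO => <-.
Qed.

Lemma tperm_avoid c x y u : c u != x -> c u != y -> (c * tperm x y)%g u = c u.
Proof. by move=> ux uy; rewrite permM tpermD // eq_sym. Qed.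

Lemma mul_tpermK c x y : (c * tperm x y * tperm x y)%g = c.
Proof. by apply/permP => u; rewrite !permM tpermK. Qed.

Lemma card_avoiding c v v' x y :
  (forall u, u != x -> u != y -> v' u = v u) ->
  #|avoiding x y (c * tperm x y)%g v'| = #|avoiding x y c v|.
Proof.
move=> vv'; apply/eqP; rewrite eqn_leq !subset_leq_card //.
  by apply: avoiding_sub => // u; exact: tperm_avoid.
apply: avoiding_sub => u ux uy; last by rewrite vv'.
by rewrite -{1}(mul_tpermK c x y) tperm_avoid.
Qed.

Lemma card_zero_orbits c v x y :
  #|zero_orbits c v| = (#|avoiding x y c v| + (orb_sum c v x == 0)
    + ((y \notin porbit c x) && (orb_sum c v y == 0)))%N.
Proof.
pose A := [set O in zero_orbits c v | x \in O].
pose B := [set O in zero_orbits c v | (x \notin O) && (y \in O)].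
have -> : #|zero_orbits c v| = (#|A| + (#|B| + #|avoiding x y c v|))%N.
  rewrite -(cardsID [set O : {set T} | x \in O] (zero_orbits c v)); congr addn.
    by apply: eq_card => O; rewrite !inE.
  rewrite -(cardsID [set O : {set T} | y \in O]); congr addn; apply: eq_card => O.
    by rewrite !inE; case: (x \in O); case: (y \in O); rewrite ?andbT ?andbF.
  by rewrite !inE; case: (x \in O); case: (y \in O); rewrite ?andbT ?andbF.
have orbE O z : O \in porbits c -> z \in O -> O = porbit c z.
  by move=> /imsetP[u _ ->] zu; apply/esym/eqP; rewrite eq_porbit_mem.
have -> : #|A| = (orb_sum c v x == 0).
  case: eqP => e.
    apply/eqP/cards1P; exists (porbit c x); apply/setP => O; rewrite !inE.
    apply/idP/eqP => [/andP[/andP[/orbE Oc _] /Oc]//|->].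
    by rewrite imset_f //= porbit_id andbT; apply/eqP.
  apply/eqP; rewrite cards_eq0; apply/eqP/setP => O; rewrite !inE.
  by apply/negP => /andP[/andP[/orbE Oc /eqP s0] /Oc OE]; apply: e; rewrite /orb_sum -OE.
have -> : #|B| = ((y \notin porbit c x) && (orb_sum c v y == 0)).
  case: andP => [[yx /eqP e]|e].
    apply/eqP/cards1P; exists (porbit c y); apply/setP => O; rewrite !inE.
    apply/idP/eqP => [/andP[/andP[/orbE Oc _] /andP[_ /Oc]]//|->].
    by rewrite imset_f //= porbit_id andbT porbit_sym yx andbT; apply/eqP.
  apply/eqP; rewrite cards_eq0; apply/eqP/setP => O; rewrite !inE.
  apply/negP => /andP[/andP[/orbE Oc /eqP s0] /andP[xO /Oc OE]]; apply: e.
  by split; [rewrite porbit_sym -OE|rewrite /orb_sum -OE s0].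
lia.
Qed.

Lemma orbit_union c x y :
  porbit (c * tperm x y)%g x :|: porbit (c * tperm x y)%g y =
  porbit c x :|: porbit c y.
Proof.
have sub c' : (forall u, c' u != x -> c' u != y -> (c' * tperm x y)%g u = c' u) ->
    porbit (c' * tperm x y)%g x :|: porbit (c' * tperm x y)%g y \subset
    porbit c' x :|: porbit c' y.
  move=> cc'; apply/subsetP => z; apply: contraLR.
  rewrite !inE !negb_or => /andP[zx zy].
  have zE := porbit_avoid cc' (z := z).
  rewrite porbit_sym in zx; rewrite porbit_sym in zy.
  by rewrite ![z \in _]porbit_sym zE // zx zy.
apply/eqP; rewrite eqEsubset sub; last by move=> u; exact: tperm_avoid.
by rewrite -{1 2}(mul_tpermK c x y) sub // => u; exact: tperm_avoid.
Qed.

Lemma tperm_join c x y : x != y -> y \notin porbit c x ->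
  y \in porbit (c * tperm x y)%g x.
Proof.
move=> xy yx; have := porbits_mul_tperm c ((c^-1)%g x) ((c^-1)%g y).
have cE : (tperm (c^-1 x) (c^-1 y) * c = c * tperm x y)%g.
  apply/permP => u; rewrite !permM.
  case: (tpermP (c^-1 x)%g (c^-1 y)%g u) => [->|->|ux uy].
  - by rewrite !permKV tpermL.
  - by rewrite !permKV tpermR.
  rewrite tpermD //; apply/eqP => e; [apply: ux|apply: uy]; by rewrite e permK.
have orbV z : porbit c ((c^-1)%g z) = porbit c z.
  by rewrite -{2}(permKV c z) -(porbit_perm c 1 ((c^-1)%g z)) expg1.
rewrite /= cE (inj_eq (@perm_inj _ (c^-1)%g)) xy porbit_sym.
rewrite -eq_porbit_mem !orbV eq_porbit_mem yx.
have zoE c' : #|porbits c'| = #|zero_orbits c' (fun=> 0)|.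
  by apply: eq_card => O; rewrite !inE big1 // eqxx andbT.
rewrite !zoE !(card_zero_orbits _ _ x y) (@card_avoiding c (fun=> 0)) //.
rewrite /orb_sum !big1 // eqxx !andbT yx.
case: (_ \in _) => //=; lia.
Qed.

(** Composing with a transposition either splits one orbit or merges two; in
   both cases at most one orbit of sum zero is lost. *)
Lemma zero_orbits_tperm c v v' x y : x != y ->
  (forall u, u != x -> u != y -> v' u = v u) ->
  (v' x + v' y = v x + v y) \/ (orb_sum c v x != 0) ->
  (#|zero_orbits c v| <= #|zero_orbits (c * tperm x y)%g v'|.+1)%N.
Proof.
move=> xy vv' vxy; rewrite !(card_zero_orbits _ _ x y) (card_avoiding _ vv').
have [yx|yx] := boolP (y \in porbit c x); first by case: (_ == 0); lia.
rewrite (tperm_join xy yx) /= addn0.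
case: eqP => [sx|]; last by case: (orb_sum c v y == 0); lia.
case: eqP => [sy|]; last by lia.
case: vxy => [vxy|]; last by rewrite sx eqxx.
suff -> : orb_sum (c * tperm x y)%g v' x == 0 by lia.
have dis : [disjoint porbit c x & porbit c y].
  apply/pred0P => z /=; apply/negP => /andP[zx zy]; case/negP: yx.
  by move: zx zy; rewrite -!eq_porbit_mem => /eqP <- /eqP ->.
have -> : orb_sum (c * tperm x y)%g v' x = \sum_(z in porbit c x :|: porbit c y) v' z.
  have e : porbit (c * tperm x y)%g y = porbit (c * tperm x y)%g x.
    by apply/eqP; rewrite eq_porbit_mem tperm_join.
  by rewrite -orbit_union e setUid.
rewrite (eq_bigl _ _ (fun z => in_setU z _ _)) bigU //=.
rewrite (bigD1 x) ?porbit_id //= [X in _ + X](bigD1 y) ?porbit_id //=.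
rewrite /orb_sum (bigD1 x) ?porbit_id //= in sx.
rewrite /orb_sum (bigD1 y) ?porbit_id //= in sy.
rewrite (eq_bigr v); last first.
  by move=> z /andP[zx zx']; apply: vv' => //; apply: contraNneq yx => <-.
rewrite [X in _ + (_ + X)](eq_bigr v); last first.
  move=> z /andP[zy zy']; apply: vv' => //; apply: contraNneq yx => xz.
  by rewrite porbit_sym -xz.
by apply/eqP; lia.
Qed.

(** Splitting off a point of weight zero gains exactly one orbit of sum zero. *)
Lemma zero_orbits_fix c v x : c x != x -> v x = 0 ->
  #|zero_orbits (c * tperm x (c x))%g v| = #|zero_orbits c v|.+1.
Proof.
move=> cx vx; have yx : c x \in porbit c x by rewrite -{1}[c]expg1 mem_porbit.
rewrite !(card_zero_orbits _ _ x (c x)) (@card_avoiding c v) // yx /= addn0.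
set c' := (c * tperm x (c x))%g.
have c'x : c' x = x by rewrite permM tpermR.
have ox : porbit c' x = [set x].
  apply/setP => z; rewrite inE; apply/porbitP/eqP => [[i ->]|->]; last first.
    by exists 0%N; rewrite perm1.
  by elim: i => [|i IHi]; rewrite ?perm1 // expgSr permM IHi.
have yx' : c x \notin porbit c' x by rewrite ox inE.
have -> : orb_sum c' v x = 0 by rewrite /orb_sum ox big_set1.
rewrite eqxx yx' /=; suff -> : orb_sum c' v (c x) = orb_sum c v x by lia.
have -> : orb_sum c' v (c x) = \sum_(z in porbit c x :\ x) v z.
  apply: eq_bigl => z; rewrite !inE.
  have := orbit_union c x (c x); rewrite -/c' ox.
  move/setP => /(_ z); rewrite !inE.
  have /eqP -> : porbit c (c x) == porbit c x by rewrite eq_porbit_mem.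
  rewrite orbb => <-; case: eqP => [->|] //=.
  by apply/negbTE; rewrite porbit_sym.
by rewrite /orb_sum [RHS](big_setD1 x) ?porbit_id //= vx add0r.
Qed.

Lemma eq_zero_orbits c v v' : (forall x, orb_sum c v x = orb_sum c v' x) ->
  zero_orbits c v = zero_orbits c v'.
Proof.
move=> vv'; apply/setP => O; rewrite !inE.
case: imsetP => //= -[x _ ->]; congr (_ == _); exact: vv'.
Qed.

Lemma orb_sum_delta c x y a : 
  \sum_(z in porbit c x) (if z == y then a else 0) = if y \in porbit c x then a else 0 :> int.
Proof.
rewrite -big_mkcondr /=; case: ifP => yx.
  by rewrite (big_pred1 y) // => z; rewrite -[RHS]/(z == y) andbC; case: eqP => //= ->.
by apply: big_pred0 => z; case: (eqVneq z y) => [->|]; rewrite ?yx ?andbF.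
Qed.

(** Weight may be moved along an orbit. *)
Lemma zero_orbits_shift c v v' x k :
  (forall z, v' z = v z + (if z == x then - k else 0) + (if z == c x then k else 0)) ->
  zero_orbits c v = zero_orbits c v'.
Proof.
move=> vE; apply: eq_zero_orbits => y; rewrite [RHS](eq_bigr _ (fun z _ => vE z)).
rewrite !big_split /= !orb_sum_delta -addrA.
have -> : (c x \in porbit c y) = (x \in porbit c y).
  by rewrite -!eq_porbit_mem -(porbit_perm c 1 x) expg1.
by case: ifP; rewrite ?addNr ?addr0.
Qed.
End ZeroOrbits.

(** * Combinatorial surfaces over a Baumslag-Solitar group *)

(** A letter (Some e, k) stands for t a^k, or for t^-1 a^k if e is true; a letter
   (None, k) stands for a^k. *)
Notation letter := (option bool * int)%type.

Section Diagrams.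
Variables m l : int.

Definition side (e : bool) : int := if e then l else m.

(** The exponent of a that a letter contributes to the region behind it: its own
   one, and the power of a that the strip starting there carries, because the
   generator of the edge group of t is a^m on one side and a^l on the other. *)
Definition wt (a : letter) (P : int) : int :=
  a.2 + if a.1 is Some e then side e * P else 0.

(** A surface mapped to the presentation complex, cut along the preimage of the
   edge t.  Each strip joins a letter t to a letter t^-1, which gives the
   pairing; the twist is the power of the edge generator carried by the strip,
   with opposite signs at its two ends.  The letters without t are fixed by the
   pairing, so that it is defined everywhere. *)
Record diagram (T : finType) := Diagram {
  pairing : {perm T};
  lab : T -> letter;
  twist : T -> int;
  pairingK : forall z, pairing (pairing z) = z;
  pairing_kind : forall z, (lab (pairing z)).1 = omap negb (lab z).1;
  pairing_None : forall z, (lab z).1 = None -> pairing z = z;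
  twistN : forall z, twist (pairing z) = - twist z
}.

Definition weight T (d : diagram T) z := wt (lab d z) (twist d z).
Definition strips T (d : diagram T) : nat := #|[pred z | (lab d z).1 == Some false]|.
(** If s is the successor along the boundary, then the boundary of a region is
   followed by applying s and crossing over to the other end of the strip met
   there. *)
Definition discs T (s : {perm T}) (d : diagram T) : nat :=
  #|zero_orbits (s * pairing d)%g (weight d)|.

Definition carried T (s : {perm T}) (d : diagram T) (ws : seq (seq letter))
    (xs : seq (seq T)) :=
  [/\ map (map (lab d)) xs = ws, uniq (flatten xs), forall z, z \in flatten xs
    & all (fun x => (x != [::]) && fcycle s x) xs].

(** Regions other than discs have Euler characteristic at most 0 and a strip
   contributes - 1, so that discs minus strips is the largest Euler
   characteristic of a surface with the given pattern. *)
Definition bounds (e : int) (ws : seq (seq letter)) :=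
  exists (T : finType) (s : {perm T}) (d : diagram T) xs,
    carried s d ws xs /\ e + (strips d)%:Z <= (discs s d)%:Z.

Lemma bounds_perm e ws ws' : perm_eq ws ws' -> bounds e ws -> bounds e ws'.
Proof.
move=> pws [T [s [d [xs [[xsE uxs xsT sxs] le_e]]]]].
have [ys pys <-] : exists2 ys, perm_eq xs ys & map (map (lab d)) ys = ws'.
  by apply: perm_map_ex; rewrite xsE.
have pf : perm_eq (flatten xs) (flatten ys) by exact: perm_flatten.
exists T, s, d, ys; split=> //; split=> //.
- by rewrite -(perm_uniq pf).
- by move=> z; rewrite -(perm_mem pf).
- by rewrite -(perm_all _ pys).
Qed.

Lemma map_cat_ex (T S : Type) (f : T -> S) x u w :
  map f x = u ++ w -> exists y z, [/\ x = y ++ z, map f y = u & map f z = w].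
Proof.
move=> e; exists (take (size u) x), (drop (size u) x); split; rewrite ?cat_take_drop //.
  by rewrite map_take e take_size_cat.
by rewrite map_drop e drop_size_cat.
Qed.

Lemma bounds_rot e u w ws : bounds e ((u ++ w) :: ws) -> bounds e ((w ++ u) :: ws).
Proof.
move=> [T [s [d [[|x xs] [[] //= [/map_cat_ex[y [z [-> <- <-]]] <-] uxs xsT]]]]].
move=> /andP[/andP[x0 sx] sxs] le_e; exists T, s, d, ((z ++ y) :: xs); split=> //.
have pf : perm_eq ((y ++ z) ++ flatten xs) ((z ++ y) ++ flatten xs).
  by rewrite perm_cat2r perm_catC.
split=> /=.
- by rewrite map_cat.
- by rewrite -(perm_uniq pf).
- by move=> t; rewrite -(perm_mem pf).
- rewrite sxs andbT -(rot_size_cat y z) rot_cycle sx andbT.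
  by rewrite -size_eq0 size_rot size_eq0.
Qed.

Lemma fcycle_cat (T : eqType) (f : T -> T) x p y q :
  fcycle f ((x :: p) ++ y :: q) =
  [&& fpath f x p, f (last x p) == y, fpath f y q & f (last y q) == x].
Proof. by rewrite /= rcons_cat /= cat_path /= rcons_path. Qed.

Lemma fpath_swap (T : finType) (s : {perm T}) x y z p :
  uniq (z :: p) -> x \notin p -> y \notin p ->
  fpath (s * tperm x y)%g z p = fpath s z p.
Proof.
elim: p z => //= w p IHp z /andP[_ up]; rewrite !inE !negb_or.
move=> /andP[xw xp] /andP[yw yp]; rewrite IHp //.
case: (s z =P w) => [szw|nszw].
  by rewrite permM szw tpermD //= ?eqxx // eq_sym.
suff -> : ((s * tperm x y)%g z == w) = false by [].
by apply/eqP => e; apply: nszw; rewrite -(mul_tpermK s x y) permM e tpermD // eq_sym.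
Qed.

Lemma fpath_away (T : finType) (s : {perm T}) x y z p :
  all (fun t => (t != x) && (t != y)) p ->
  fpath s z p -> fpath (s * tperm x y)%g z p.
Proof.
elim: p z => //= v r IHr z /andP[/andP[vx vy] vr] /andP[/eqP sv pr].
by rewrite IHr // permM sv tpermD ?eqxx // eq_sym.
Qed.

Lemma discs_tperm T (s : {perm T}) (d : diagram T) x y : x != y ->
  (discs s d <= (discs (s * tperm x y)%g d).+1)%N.
Proof.
move=> xy; rewrite /discs.
have -> : (s * tperm x y * pairing d = s * pairing d * tperm (pairing d x) (pairing d y))%g.
  apply/permP => u; rewrite !permM.
  case: (tpermP x y (s u)) => [->|->|ux uy]; rewrite ?tpermL ?tpermR //.
  by rewrite tpermD // (inj_eq perm_inj) eq_sym; apply/eqP.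
by apply: zero_orbits_tperm => //; [rewrite (inj_eq perm_inj)|left].
Qed.

Lemma uniq_two (T : eqType) (x y : T) p q r : uniq (((x :: p) ++ y :: q) ++ r) ->
  [/\ x != y, (x \notin p) /\ (y \notin p), (x \notin q) /\ (y \notin q)
    & uniq (x :: p) /\ uniq (y :: q)].
Proof.
rewrite cat_uniq => /andP[]; rewrite cat_uniq => /and3P[ux /hasPn h uy] _.
have := h y (mem_head _ _); rewrite inE negb_or eq_sym => /andP[xy yp].
have xq : x \notin q.
  apply/negP => xq; have := h x; rewrite inE xq orbT => /(_ isT).
  by rewrite mem_head.
by have [[xp _] [yq _]] := (andP ux, andP uy).
Qed.

(** Exchanging the successors of two points of a cycle of s cuts it in two; both
   s and the permutation that follows the regions are then multiplied by a
   transposition. *)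
Lemma bounds_split_gen (k e : int) u w ws : u != [::] -> w != [::] ->
  (forall T (s : {perm T}) (d : diagram T) x y, x != y ->
     lab d x = head (None, 0) u -> (size u = 1%N -> s x = y) ->
     (discs s d)%:Z + k <= (discs (s * tperm x y)%g d)%:Z) ->
  bounds e ((u ++ w) :: ws) -> bounds (e + k) [:: u, w & ws].
Proof.
move=> u0 w0 gain [T [s [d [[|x xs] [[] //= [/map_cat_ex[y [z [-> yu zw]]] <-] uxs xsT]]]]].
move: u0 w0 gain; rewrite -yu -zw => {yu zw u w x}.
case: y uxs xsT => // x p uxs xsT _; case: z uxs xsT => // y q uxs xsT _ gain.
move=> /andP[/andP[_ sx] sxs] le_e; have [xy [xNp yNp] [xNq yNq] [ux uy]] := uniq_two uxs.
move: sx; rewrite fcycle_cat => /and4P[xp /eqP sp yq /eqP sq].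
exists T, (s * tperm x y)%g, d, [:: x :: p, y :: q & xs]; split; last first.
  rewrite addrAC; apply: le_trans (gain T s d x y xy _ _) => //; first by rewrite lerD2r.
  by rewrite size_map; case: (p) sp.
split=> /=.
- by [].
- by move: uxs; rewrite /= -!catA.
- by move=> t; have := xsT t; rewrite /= -!catA.
- have e1 : (s * tperm x y)%g (last x p) = x by rewrite permM sp tpermR.
  have e2 : (s * tperm x y)%g (last y q) = y by rewrite permM sq tpermL.
  rewrite !rcons_path /= !fpath_swap // xp yq e1 e2 !eqxx /=.
  apply/allP => z zs; have /andP[-> /=] := allP sxs z zs.
  have {zs} zs t : t \in z -> (t != x) && (t != y).
    move=> tz; have tf : t \in flatten xs by apply/flattenP; exists z.
    move: uxs; rewrite cat_uniq => /and3P[_ /hasPn/(_ t tf) tn _].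
    by apply/andP; split; apply: contraNneq tn => ->; rewrite mem_cat !inE eqxx ?orbT.
  case: z zs => // t z zs; rewrite /=.
  have : all (fun t => (t != x) && (t != y)) (rcons z t).
    by apply/allP => v vz; apply: zs; rewrite mem_rcons in vz.
  exact: fpath_away.
Qed.

Lemma bounds_split e u w ws : u != [::] -> w != [::] ->
  bounds e ((u ++ w) :: ws) -> bounds (e - 1) [:: u, w & ws].
Proof.
move=> u0 w0; apply: bounds_split_gen => // T s d x y xy _ _.
by have := discs_tperm s d xy; lia.
Qed.

(** A blank letter is its own partner, so that it leaves its region as a new
   region of weight zero. *)
Lemma bounds_drop e w ws : w != [::] ->
  bounds e (((None, 0) :: w) :: ws) -> bounds (e + 1) [:: [:: (None, 0)], w & ws].
Proof.
move=> w0; apply: (@bounds_split_gen 1 e [:: (None, 0)]) => // T s d x y xy /= lx /(_ erefl) sx.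
have px : pairing d x = x by rewrite pairing_None // lx.
have cx : (s * pairing d)%g x = pairing d y by rewrite permM sx.
rewrite /discs.
have -> : (s * tperm x y * pairing d = s * pairing d * tperm x (pairing d y))%g.
  apply/permP => u; rewrite !permM.
  case: (tpermP x y (s u)) => [->|->|ux uy]; rewrite ?px ?tpermL ?tpermR //.
  rewrite tpermD //; apply/eqP => e1; [apply: ux|apply: uy]; apply: (@perm_inj _ (pairing d)).
    by rewrite -e1 px.
  by rewrite -e1.
rewrite -cx zero_orbits_fix ?cx; first by lia.
  by rewrite -[X in _ != X]px (inj_eq perm_inj) eq_sym.
by rewrite /weight /wt lx.
Qed.

Lemma bounds_merge e u w ws : u != [::] -> w != [::] ->
  bounds e [:: u, w & ws] -> bounds (e - 1) ((u ++ w) :: ws).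
Proof.
move=> u0 w0 [T [s [d [[|[|x p] [|[|y q] xs]] [[]]]]]] //=; try by case=> *; subst.
case=> yu zw <-; move: u0 w0; rewrite -yu -zw => {yu zw u w} _ _.
move=> uxs xsT /and3P[sp sq sxs] le_e; have := @uniq_two _ x y p q (flatten xs).
rewrite -[X in uniq X]catA => /(_ uxs)[xy [xNp yNp] [xNq yNq] [ux uy]].
exists T, (s * tperm x y)%g, d, [:: (x :: p) ++ y :: q & xs]; split; last first.
  by have := discs_tperm s d xy; lia.
move: sp sq; rewrite !rcons_path /= => /andP[xp /eqP sp] /andP[yq /eqP sq].
split=> /=.
- by rewrite !map_cat.
- by move: uxs; rewrite /= -!catA.
- by move=> t; have := xsT t; rewrite /= -!catA.
- have e1 : (s * tperm x y)%g (last x p) = y by rewrite permM sp tpermL.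
  have e2 : (s * tperm x y)%g (last y q) = x by rewrite permM sq tpermR.
  rewrite rcons_cat /= cat_path /= !rcons_path /= !fpath_swap // xp yq e1 e2 !eqxx /=.
  apply/allP => z zs; have /andP[-> /=] := allP sxs z zs.
  have {zs} zs t : t \in z -> (t != x) && (t != y).
    move=> tz; have tf : t \in flatten xs by apply/flattenP; exists z.
    have : uniq (((x :: p) ++ y :: q) ++ flatten xs) by rewrite -catA.
    rewrite cat_uniq => /and3P[_ /hasPn/(_ t tf) tn _].
    by apply/andP; split; apply: contraNneq tn => ->; rewrite mem_cat !inE eqxx ?orbT.
  case: z zs => // t z zs; rewrite /=.
  have : all (fun t => (t != x) && (t != y)) (rcons z t).
    by apply/allP => v vz; apply: zs; rewrite mem_rcons in vz.
  exact: fpath_away.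
Qed.

Lemma bounds_update e (a b a' b' : letter) w ws :
  (forall T (s : {perm T}) (d : diagram T) x y, s x = y -> x != y ->
     lab d x = a -> lab d y = b ->
     exists d' : diagram T,
       (forall z, lab d' z = if z == x then a' else if z == y then b' else lab d z)
       /\ (discs s d + strips d' <= discs s d' + strips d)%N) ->
  bounds e ([:: a, b & w] :: ws) -> bounds e ([:: a', b' & w] :: ws).
Proof.
move=> upd [T [s [d [[|[|x [|y x']] xs] [[] //= [xa yb <- <-] uxs xsT sxs le_e]]]]].
have [/eqP sxy _] := andP (proj1 (andP sxs)).
have [xNy xx yx] : [/\ x != y, x \notin x' ++ flatten xs & y \notin x' ++ flatten xs].
  by move: uxs => /= /and3P[]; rewrite inE negb_or => /andP[-> ->] ->.
have [d' [d'E le_d]] := upd T s d x y sxy xNy xa yb.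
exists T, s, d', ([:: x, y & x'] :: xs); split; last by lia.
split=> //=; rewrite !d'E !eqxx [y == x]eq_sym (negbTE xNy); congr ([:: _, _ & _] :: _).
  apply/eq_in_map => z zx; rewrite d'E; case: eqP => [zE|_].
    by move: xx; rewrite mem_cat -zE zx.
  by case: eqP => [zE|//]; move: yx; rewrite mem_cat -zE zx.
apply/eq_in_map => z zxs; apply/eq_in_map => t tz; rewrite d'E.
have tf : t \in flatten xs by apply/flattenP; exists z.
case: eqP => [tE|_]; first by move: xx; rewrite mem_cat -tE tf orbT.
by case: eqP => [tE|//]; move: yx; rewrite mem_cat -tE tf orbT.
Qed.
End Diagrams.

Section Moves.
Variables m l : int.
Local Notation bounds := (bounds m l).
Local Notation side := (side m l).
Local Notation weight := (weight m l).
Local Notation discs := (discs m l).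

Lemma relabel_ex (T : finType) (d : diagram T) (lab' : T -> letter) (tw : T -> int) :
  (forall z, (lab' z).1 = (lab d z).1) ->
  (forall z, tw (pairing d z) = - tw z) ->
  exists d' : diagram T,
    [/\ pairing d' = pairing d, lab d' = lab', twist d' = tw & strips d' = strips d].
Proof.
move=> kE tE.
have H1 z : (lab' (pairing d z)).1 = omap negb (lab' z).1 by rewrite !kE pairing_kind.
have H2 z : (lab' z).1 = None -> pairing d z = z by rewrite kE; exact: pairing_None.
exists (Diagram (pairingK d) H1 H2 tE); split=> //.
by apply: eq_card => z; rewrite !inE /= kE.
Qed.

Lemma twist_None (T : finType) (d : diagram T) x : (lab d x).1 = None -> twist d x = 0.
Proof. by move=> /pairing_None e; have := twistN d x; rewrite e; lia. Qed.

Lemma bounds_shift e kd k k' j w ws :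
  bounds e ([:: (kd, k), (None, k') & w] :: ws) ->
  bounds e ([:: (kd, k + j), (None, k' - j) & w] :: ws).
Proof.
apply: bounds_update => T s d x y sxy xy lx ly.
pose lab' z := if z == x then (kd, k + j) else if z == y then (None, k' - j) else lab d z.
have [z|z|d' [pE lE tE sE]] := @relabel_ex T d lab' (twist d).
- rewrite /lab'; case: eqP => [->|_]; first by rewrite lx.
  by case: eqP => // ->; rewrite ly.
- exact: twistN.
exists d'; split; first by rewrite lE.
rewrite sE leq_add2r /discs pE.
rewrite (@zero_orbits_shift _ _ (weight d) (weight d') x (- j)) // => z.
have -> : (s * pairing d)%g x = y by rewrite permM sxy pairing_None // ly.
rewrite /weight /wt lE tE /lab'.
case: (z =P x) => [->|_]; first by rewrite lx /= (negbTE xy); lia.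
by case: eqP => [->|_]; rewrite ?ly /=; lia.
Qed.

(** Sliding a power of the edge generator across a strip: the change of the twist
   compensates the change of the exponents. *)
Lemma bounds_commute e kd k ep k' j w ws :
  bounds e ([:: (kd, k), (Some ep, k') & w] :: ws) ->
  bounds e ([:: (kd, k - side (~~ ep) * j), (Some ep, k' + side ep * j) & w] :: ws).
Proof.
apply: bounds_update => T s d x y sxy xy lx ly.
pose lab' z := if z == x then (kd, k - side (~~ ep) * j)
  else if z == y then (Some ep, k' + side ep * j) else lab d z.
pose tw z := twist d z - (if z == y then j else 0) + (if z == pairing d y then j else 0).
have yp : pairing d y != y.
  by apply/eqP => e'; have := pairing_kind d y; rewrite e' ly; case: (ep).
have [z|z|d' [pE lE tE sE]] := @relabel_ex T d lab' tw.
- rewrite /lab'; case: eqP => [->|_]; first by rewrite lx.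
  by case: eqP => // ->; rewrite ly.
- rewrite /tw twistN (inj_eq perm_inj) (can2_eq (@pairingK _ d) (@pairingK _ d)).
  by case: eqP; case: eqP; lia.
exists d'; split; first by rewrite lE.
rewrite sE leq_add2r /discs pE.
rewrite (@zero_orbits_shift _ _ (weight d) (weight d') x (side (~~ ep) * j)) // => z.
have -> : (s * pairing d)%g x = pairing d y by rewrite permM sxy.
rewrite /weight /wt lE tE /lab' /tw.
have [zE|zy] := eqVneq z y.
  subst z; rewrite [y == x]eq_sym (negbTE xy) [y == pairing d y]eq_sym (negbTE yp) ly /=.
  ring.
have [zE|zp] := eqVneq z (pairing d y).
  subst z; have kp := pairing_kind d y; rewrite ly /= in kp.
  case: (eqVneq _ x) => [e'|_].
    rewrite e' lx /= in kp *; rewrite kp /side; case: (ep) => /=; ring.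
  by rewrite kp /side; case: (ep) => /=; ring.
case: eqP => [->|_]; first by rewrite lx /=; case: (kd) => [e'|]; ring.
by case: (lab d z).1 => [e'|]; ring.
Qed.

(** Two blank letters become the ends of a new strip: one strip more, and one
   region more, which is a disc. *)
Lemma bounds_insert e ep k w ws :
  bounds e ([:: (None, 0), (None, k) & w] :: ws) ->
  bounds e ([:: (Some ep, 0), (Some (~~ ep), k) & w] :: ws).
Proof.
apply: bounds_update => T s d x y sxy xy lx ly.
pose lab' z : letter := if z == x then (Some ep, 0)
  else if z == y then (Some (~~ ep), k) else lab d z.
have px : pairing d x = x by rewrite pairing_None // lx.
have py : pairing d y = y by rewrite pairing_None // ly.
have tx : twist d x = 0 by rewrite twist_None // lx.
have ty : twist d y = 0 by rewrite twist_None // ly.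
pose p := (pairing d * tperm x y)%g.
have yx : (y == x) = false by rewrite eq_sym (negbTE xy).
have pE z : p z = if z == x then y else if z == y then x else pairing d z.
  rewrite permM; case: eqP => [->|/eqP zx]; first by rewrite px tpermL.
  case: eqP => [->|/eqP zy]; first by rewrite py tpermR.
  rewrite tpermD //; first by rewrite -{1}px (inj_eq perm_inj) eq_sym.
  by rewrite -{1}py (inj_eq perm_inj) eq_sym.
have pNx z : z != x -> (pairing d z == x) = false.
  by move=> zx; rewrite -{1}px (inj_eq perm_inj) (negbTE zx).
have pNy z : z != y -> (pairing d z == y) = false.
  by move=> zy; rewrite -{1}py (inj_eq perm_inj) (negbTE zy).
have H0 z : p (p z) = z.
  rewrite (pE z); case: eqP => [->|/eqP zx]; first by rewrite pE yx eqxx.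
  case: eqP => [->|/eqP zy]; first by rewrite pE eqxx.
  by rewrite pE pNx // pNy // pairingK.
have H1 z : (lab' (p z)).1 = omap negb (lab' z).1.
  rewrite pE /lab'; case: (z =P x) => [_|/eqP zx]; first by rewrite yx eqxx.
  case: (z =P y) => [_|/eqP zy]; first by rewrite eqxx /= negbK.
  by rewrite pNx // pNy // pairing_kind.
have H2 z : (lab' z).1 = None -> p z = z.
  by rewrite pE /lab'; case: eqP => //; case: eqP => // *; exact: pairing_None.
have H3 z : twist d (p z) = - twist d z.
  rewrite pE; case: eqP => [->|_]; first by rewrite tx ty.
  by case: eqP => [->|_]; rewrite ?tx ?ty // twistN.
exists (Diagram H0 H1 H2 H3); split=> //.
have cx : (s * pairing d)%g x = y by rewrite permM sxy py.
rewrite /discs /=; have -> : (s * p = s * pairing d * tperm x y)%g by rewrite mulgA.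
have wE : zero_orbits (s * pairing d * tperm x y)%g (weight (Diagram H0 H1 H2 H3))
   = zero_orbits (s * pairing d * tperm x y)%g (weight d).
  apply: eq_zero_orbits => z; apply: eq_bigr => u _; rewrite /weight /wt /= /lab'.
  case: eqP => [->|_]; first by rewrite tx lx /= mulr0.
  by case: eqP => [->|_] //; rewrite ty ly /= mulr0.
have := @zero_orbits_fix _ (s * pairing d)%g (weight d) x.
rewrite cx wE => ->; [|by rewrite eq_sym|by rewrite /weight /wt lx].
rewrite addSn -addnS leq_add2l /strips.
pose t := if ep then y else x.
rewrite (cardD1 t) [in X in (_ + X <= _)%N](@eq_card _ _ [pred z | (lab d z).1 == Some false]).
  by rewrite -add1n leq_add2r leq_b1.
move=> z; rewrite !inE /= /lab' /t; case: (ep).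
  by case: (z =P y) => [->|_]; rewrite ?ly //=; case: (z =P x) => [->|]; rewrite ?lx.
by case: (z =P x) => [->|_]; rewrite ?lx //=; case: (z =P y) => [->|]; rewrite ?ly.
Qed.
Hypotheses (m0 : m != 0) (l0 : l != 0).

Lemma side_neq0 ep : side ep != 0. Proof. by case: ep. Qed.

Lemma strips_delete (T : finType) (d d' : diagram T) x y ep k (a b : int) : x != y ->
  lab d x = (Some ep, a) -> lab d y = (Some (~~ ep), k) ->
  (forall z, (lab d' z).1 = if (z == x) || (z == y) then None else (lab d z).1) ->
  strips d = (strips d').+1.
Proof.
move=> xy lx ly lE; rewrite /strips; pose t := if ep then y else x.
rewrite (cardD1 t) [X in (_ + X)%N](@eq_card _ _ [pred z | (lab d' z).1 == Some false]).
  by rewrite inE /t; case: (ep) lx ly => lx ly; rewrite ?lx ?ly.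
move=> z; rewrite !inE /= lE /t; case: (ep) lx ly => lx ly.
  by case: (z =P y) => [->|_]; rewrite ?orbT ?orbF //=; case: (z =P x) => [->|]; rewrite ?lx.
by case: (z =P x) => [->|_]; rewrite ?orbT ?orbF //=; case: (z =P y) => [->|]; rewrite ?ly.
Qed.

(** The converse of the insertion is harder, since the two letters need not be
   the two ends of one strip. *)
Lemma bounds_delete e ep k w ws :
  bounds e ([:: (Some ep, 0), (Some (~~ ep), k) & w] :: ws) ->
  bounds e ([:: (None, 0), (None, k) & w] :: ws).
Proof.
apply: bounds_update => T s d x y sxy xy lx ly.
pose lab' z : letter := if z == x then (None, 0)
  else if z == y then (None, k) else lab d z.
have yx : (y == x) = false by rewrite eq_sym (negbTE xy).
pose px := pairing d x; pose py := pairing d y.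
have ppx : pairing d px = x by rewrite pairingK.
have ppy : pairing d py = y by rewrite pairingK.
have kx : (lab d px).1 = Some (~~ ep) by rewrite pairing_kind lx.
have ky : (lab d py).1 = Some ep by rewrite pairing_kind ly /= negbK.
have pxx : (px == x) = false by apply/eqP => e'; move: kx; rewrite e' lx; case: (ep).
have pyy : (py == y) = false by apply/eqP => e'; move: ky; rewrite e' ly; case: (ep).
have pE1 z : (pairing d z == x) = (z == px) by rewrite -{1}ppx (inj_eq perm_inj).
have pE2 z : (pairing d z == y) = (z == py) by rewrite -{1}ppy (inj_eq perm_inj).
have lE z : (lab' z).1 = if (z == x) || (z == y) then None else (lab d z).1.
  by rewrite /lab'; case: eqP => // _; case: eqP.
have cx : (s * pairing d)%g x = py by rewrite permM sxy.
case: (px =P y) => [pxy|/eqP pxy].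
(* The two letters are glued to each other: the orbit of the first one is a
   disc exactly if its twist vanishes. *)
  have pyx : py = x by rewrite /py -pxy.
  pose p := (pairing d * tperm x y)%g.
  pose tw z := if (z == x) || (z == y) then 0 else twist d z.
  have pE z : p z = if (z == x) || (z == y) then z else pairing d z.
    rewrite permM; case: (z =P x) => [->|/eqP zx]; first by rewrite -/px pxy tpermR.
    case: (z =P y) => [->|/eqP zy] /=; first by rewrite -/py pyx tpermL.
    by rewrite tpermD // eq_sym ?pE1 ?pE2 ?pxy ?pyx.
  have pD z : (z == x) || (z == y) = false ->
      (pairing d z == x) || (pairing d z == y) = false.
    by rewrite pE1 pE2 pxy pyx orbC.
  have H0 z : p (p z) = z.
    rewrite (pE z); case zxy: ((z == x) || (z == y)); first by rewrite pE zxy.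
    by rewrite pE (pD _ zxy) pairingK.
  have H1 z : (lab' (p z)).1 = omap negb (lab' z).1.
    rewrite pE !lE; case zxy: ((z == x) || (z == y)); first by rewrite zxy.
    by rewrite (pD _ zxy) pairing_kind.
  have H2 z : (lab' z).1 = None -> p z = z.
    by rewrite lE pE; case: ifP => // _; exact: pairing_None.
  have H3 z : tw (p z) = - tw z.
    rewrite pE /tw; case zxy: ((z == x) || (z == y)); first by rewrite zxy oppr0.
    by rewrite (pD _ zxy) twistN.
  exists (Diagram H0 H1 H2 H3); split=> //.
  rewrite (@strips_delete T d (Diagram H0 H1 H2 H3) x y ep k 0) // addnS -addSn leq_add2r.
  rewrite /discs /=; have -> : (s * p = s * pairing d * tperm x y)%g by rewrite mulgA.
  apply: zero_orbits_tperm => //.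
    by move=> u ux uy; rewrite /weight /wt /= /lab' /tw (negbTE ux) (negbTE uy).
  case: (twist d x =P 0) => [t0|/eqP t0].
    left; rewrite /weight /wt /= /lab' yx !eqxx lx ly /=.
    by have := twistN d x; rewrite -/px pxy t0 => ->; rewrite oppr0 !mulr0.
  right; rewrite /orb_sum (big_pred1 x); first by rewrite /weight /wt lx /= add0r mulf_neq0 ?side_neq0.
  move=> z; rewrite -[RHS]/(z == x); apply/porbitP/eqP => [[i ->]|->]; last first.
    by exists 0%N; rewrite perm1.
  by elim: i => [|i IHi]; rewrite ?perm1 // expgSr permM IHi cx pyx.
(* Otherwise the two strips are joined end to end, and their twists add up. *)
have pyx : py != x by apply: contraNneq pxy => e'; rewrite /px -e' ppy.
have pxpy : (px == py) = false by rewrite (inj_eq perm_inj) (negbTE xy).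
pose p := (pairing d * tperm y px * tperm x py * tperm x y)%g.
pose tw z := if (z == x) || (z == y) then 0 else
  if z == px then twist d px + twist d y else
  if z == py then twist d py + twist d x else twist d z.
have pE z : p z = if (z == x) || (z == y) then z else
    if z == px then py else if z == py then px else pairing d z.
  rewrite !permM.
  case: (z =P x) => [->|/eqP zx] /=.
    by rewrite -/px (tpermR y px) (@tpermD _ x py) ?(tpermR x y) // pyy.
  case: (z =P y) => [->|/eqP zy] /=.
    rewrite -/py (@tpermD _ y px) ?pxpy //; last by rewrite eq_sym pyy.
    by rewrite (tpermR x py) tpermL.
  case: (z =P px) => [->|/eqP zpx].
    rewrite ppx (@tpermD _ y px) ?yx ?pxx // tpermL tpermD //; first by rewrite eq_sym.
    by rewrite eq_sym pyy.
  case: (z =P py) => [->|/eqP zpy].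
    rewrite ppy tpermL (@tpermD _ x py); [|by rewrite eq_sym pxx|by rewrite eq_sym pxpy].
    by rewrite tpermD // eq_sym // pxx.
  have q1 : pairing d z != x by rewrite pE1.
  have q2 : pairing d z != y by rewrite pE2.
  have q3 : pairing d z != px by rewrite (inj_eq perm_inj).
  have q4 : pairing d z != py by rewrite (inj_eq perm_inj).
  by rewrite !tpermD // eq_sym.
have pD z : (z == x) || (z == y) = false -> z != px -> z != py ->
    [/\ (pairing d z == x) || (pairing d z == y) = false,
        (pairing d z == px) = false & (pairing d z == py) = false].
  move=> /norP[zx zy] zpx zpy; rewrite pE1 pE2 !(inj_eq perm_inj).
  by rewrite !(negbTE zx, negbTE zy, negbTE zpx, negbTE zpy).
have pxN : (px == x) || (px == y) = false by rewrite pxx (negbTE pxy).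
have pyN : (py == x) || (py == y) = false by rewrite pyy (negbTE pyx).
have H0 z : p (p z) = z.
  rewrite (pE z); case zxy: ((z == x) || (z == y)); first by rewrite pE zxy.
  case: (z =P px) => [->|/eqP zpx]; first by rewrite pE pyN eq_sym pxpy eqxx.
  case: (z =P py) => [->|/eqP zpy]; first by rewrite pE pxN eqxx.
  by have [q1 q2 q3] := pD z zxy zpx zpy; rewrite pE q1 q2 q3 pairingK.
have H1 z : (lab' (p z)).1 = omap negb (lab' z).1.
  rewrite pE !lE; case zxy: ((z == x) || (z == y)); first by rewrite zxy.
  case: (z =P px) => [->|/eqP zpx]; first by rewrite pyN kx ky /= negbK.
  case: (z =P py) => [->|/eqP zpy]; first by rewrite pxN kx ky.
  by have [q1 q2 q3] := pD z zxy zpx zpy; rewrite q1 pairing_kind.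
have H2 z : (lab' z).1 = None -> p z = z.
  rewrite lE pE; case zxy: ((z == x) || (z == y)) => //; case: (z =P px) => [->|/eqP zpx]; first by rewrite kx.
  case: (z =P py) => [->|/eqP zpy]; first by rewrite ky.
  exact: pairing_None.
have tpx : twist d px = - twist d x by rewrite twistN.
have tpy : twist d py = - twist d y by rewrite twistN.
have H3 z : tw (p z) = - tw z.
  rewrite pE /tw; case zxy: ((z == x) || (z == y)); first by rewrite zxy oppr0.
  case: (z =P px) => [_|/eqP zpx].
    by rewrite pyN eq_sym pxpy eqxx tpx tpy; lia.
  case: (z =P py) => [_|/eqP zpy]; first by rewrite pxN eqxx tpx tpy; lia.
  by have [q1 q2 q3] := pD z zxy zpx zpy; rewrite q1 q2 q3 twistN.
exists (Diagram H0 H1 H2 H3); split=> //.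
rewrite (@strips_delete T d (Diagram H0 H1 H2 H3) x y ep k 0) // addnS -addSn leq_add2r.
rewrite /discs /=; set c := (s * pairing d)%g; set v' := weight (Diagram _ _ _ _).
have -> : (s * p = c * tperm y px * tperm x py * tperm x y)%g by rewrite /p !mulgA.
have v'x : v' x = 0 by rewrite /v' /weight /wt /= /lab' eqxx.
have v'y : v' y = k by rewrite /v' /weight /wt /= /lab' yx eqxx /= addr0.
have v'px : v' px = weight d px + side (~~ ep) * twist d y.
  rewrite /v' /weight /wt /= /lab' /tw pxx (negbTE pxy) /= eqxx kx; ring.
have v'py : v' py = weight d py + weight d x.
  rewrite /v' /weight /wt /= /lab' /tw pyy (negbTE pyx) /= eqxx [py == px]eq_sym pxpy ky lx /=.
  ring.
have v'E z : z != x -> z != y -> z != px -> z != py -> v' z = weight d z.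
  move=> zx zy zpx zpy; rewrite /v' /weight /wt /= /lab' /tw.
  by rewrite (negbTE zx) (negbTE zy) (negbTE zpx) (negbTE zpy).
pose v1 z := weight d z + (if z == x then - weight d x else 0)
  + (if z == c x then weight d x else 0).
rewrite (@zero_orbits_shift _ c _ v1 x (weight d x)) //.
have cmx : (c * tperm y px)%g x = py by rewrite permM cx tpermD // eq_sym ?pyy // eq_sym pxpy.
apply: (@leq_trans #|zero_orbits (c * tperm y px)%g v'|.+1).
  apply: zero_orbits_tperm; first by rewrite eq_sym.
    move=> u uy upx; rewrite /v1 cx; case: (u =P x) => [->|/eqP ux].
      by rewrite v'x eq_sym (negbTE pyx); lia.
    case: (u =P py) => [->|/eqP upy]; first by rewrite v'py; lia.
    by rewrite v'E //; lia.
  left; rewrite /v1 cx yx [y == py]eq_sym pyy pxx pxpy v'y v'px.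
  rewrite /weight /wt ly kx /=; ring.
have := @zero_orbits_fix _ (c * tperm y px)%g v' x; rewrite cmx => <- //.
by apply: zero_orbits_tperm => //; left.
Qed.
End Moves.

Definition blank : letter := (None, 0).

Lemma blank_diagram_exists r : exists d : diagram 'I_r,
  [/\ pairing d = 1%g, lab d = fun=> blank & twist d = fun=> 0].
Proof.
have H0 (z : 'I_r) : (1 : {perm 'I_r})%g ((1 : {perm 'I_r})%g z) = z by rewrite !perm1.
have H1 (z : 'I_r) : ((fun=> blank) ((1 : {perm 'I_r})%g z)).1 = omap negb ((fun=> blank) z).1.
  by [].
have H2 (z : 'I_r) : ((fun=> blank) z).1 = None -> (1 : {perm 'I_r})%g z = z by rewrite perm1.
have H3 (z : 'I_r) : (fun=> 0 : int) ((1 : {perm 'I_r})%g z) = - (fun=> 0) z by rewrite oppr0.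
by exists (Diagram H0 H1 H2 H3).
Qed.

Section StableBounds.
Variables m l : int.
Hypotheses (m0 : m != 0) (l0 : l != 0).
Local Notation bounds := (bounds m l).
Local Notation side := (side m l).

(** The number of points of a diagram is fixed by the moves; a reserve of blank
   cyclic words, each bounding a disc of its own, makes it possible to insert
   and remove blank letters. *)
Definition sbounds (e : int) (ws : seq (seq letter)) :=
  exists r0, forall r : nat, (r0 <= r)%N -> bounds (e + r%:Z) (ws ++ nseq r [:: blank]).

Lemma bounds_blank r : bounds r%:Z (nseq r [:: blank]).
Proof.
have [d [pE lE tE]] := blank_diagram_exists r.
exists ('I_r : finType), 1%g, d, [seq [:: i] | i <- enum 'I_r].
have fE : flatten [seq [:: i] | i <- enum 'I_r] = enum 'I_r.
  by elim: (enum _) => //= a s ->.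
split.
  split; rewrite ?fE.
  - rewrite -map_comp -[X in nseq X](size_enum_ord r).
    by elim: (enum _) => //= a s ->; rewrite lE.
  - exact: enum_uniq.
  - by move=> z; rewrite mem_enum.
  - by apply/allP => x /mapP[i _ ->] /=; rewrite perm1 eqxx.
rewrite /strips eq_card0 ?addr0 => [|z]; last by rewrite inE /= lE.
rewrite /discs pE mulg1 lez_nat -{1}(card_ord r).
have pinj : injective (porbit (1 : {perm 'I_r})%g).
  move=> x y /eqP; rewrite eq_porbit_mem => /porbitP[i ->].
  by rewrite expg1n perm1.
rewrite -(card_imset _ pinj) subset_leq_card //; apply/subsetP => O /imsetP[x _ ->].
rewrite inE imset_f //=; apply/eqP; rewrite big1 // => z _.
by rewrite /weight /wt lE tE.
Qed.

Lemma sbounds0 : sbounds 0 [::].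
Proof. by exists 0%N => r _; rewrite add0r; exact: bounds_blank. Qed.

Lemma sbounds_perm e ws ws' : perm_eq ws ws' -> sbounds e ws -> sbounds e ws'.
Proof.
move=> pws [r0 H]; exists r0 => r /H; apply: bounds_perm.
by rewrite perm_cat2r.
Qed.

Lemma sbounds_swap e u v : sbounds e [:: u; v] -> sbounds e [:: v; u].
Proof. by apply: sbounds_perm; rewrite -[[:: u; v]]/([:: u] ++ [:: v]) perm_catC. Qed.

Lemma sbounds_add e ws : sbounds e ws -> sbounds (e + 1) ([:: blank] :: ws).
Proof.
move=> [r0 H]; exists r0 => r ler.
have := H r.+1 (leqW ler); rewrite intS addrA; apply: bounds_perm.
by rewrite /= -[_ :: nseq _ _]cat1s perm_catCA.
Qed.

Lemma sbounds_del e ws : sbounds (e + 1) ([:: blank] :: ws) -> sbounds e ws.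
Proof.
move=> [r0 H]; exists r0.+1 => -[|r] // ler.
have := H r ler; rewrite -addrA -intS; apply: bounds_perm.
by rewrite /= -[_ :: nseq _ _]cat1s perm_sym perm_catCA.
Qed.

Lemma sbounds_lift e k w us ws :
  (forall e ws, bounds e (w :: ws) -> bounds (e + k) (us ++ ws)) ->
  sbounds e (w :: ws) -> sbounds (e + k) (us ++ ws).
Proof.
by move=> H [r0 Hr]; exists r0 => r /Hr; rewrite addrAC -catA; exact: H.
Qed.

Lemma sbounds_lift0 e w w' ws :
  (forall e ws, bounds e (w :: ws) -> bounds e (w' :: ws)) ->
  sbounds e (w :: ws) -> sbounds e (w' :: ws).
Proof.
move=> H; rewrite -{2}[e]addr0; apply: (@sbounds_lift _ 0 _ [:: w']) => e' ws' /=.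
by rewrite addr0; exact: H.
Qed.

Lemma sbounds_rot e u w ws : sbounds e ((u ++ w) :: ws) -> sbounds e ((w ++ u) :: ws).
Proof. by apply: sbounds_lift0 => e' ws'; exact: bounds_rot. Qed.

Lemma sbounds_split e u w ws : u != [::] -> w != [::] ->
  sbounds e ((u ++ w) :: ws) -> sbounds (e - 1) [:: u, w & ws].
Proof.
move=> u0 w0; apply: (@sbounds_lift _ _ _ [:: u; w]) => e' ws'.
exact: bounds_split.
Qed.

Lemma sbounds_merge e u w ws : u != [::] -> w != [::] ->
  sbounds e [:: u, w & ws] -> sbounds (e - 1) ((u ++ w) :: ws).
Proof.
move=> u0 w0 [r0 Hr]; exists r0 => r /Hr; rewrite addrAC; exact: bounds_merge.
Qed.

(** Words that are interchangeable inside any nonempty cyclic word. *)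
Definition eqv (u v : seq letter) := forall q ws e, q != [::] ->
  sbounds e ((u ++ q) :: ws) <-> sbounds e ((v ++ q) :: ws).

Lemma eqv_refl u : eqv u u. Proof. by []. Qed.

Lemma eqv_sym u v : eqv u v -> eqv v u.
Proof. by move=> uv q ws e q0; rewrite uv. Qed.

Lemma eqv_trans v u w : eqv u v -> eqv v w -> eqv u w.
Proof. by move=> uv vw q ws e q0; rewrite uv // vw. Qed.

Lemma eqv_ctx p q u v ws e : eqv u v -> p ++ q != [::] ->
  sbounds e ((p ++ u ++ q) :: ws) <-> sbounds e ((p ++ v ++ q) :: ws).
Proof.
move=> uv pq; have qp : q ++ p != [::].
  by move: pq; rewrite -!size_eq0 !size_cat addnC.
by split=> /sbounds_rot; rewrite -catA => /(uv _ _ _ qp); rewrite catA => /sbounds_rot.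
Qed.

Lemma eqv_cat u u' v v' : eqv u u' -> eqv v v' -> eqv (u ++ v) (u' ++ v').
Proof.
move=> uu' vv' q ws e q0; have vq : v ++ q != [::].
  by case: (v) => //; rewrite cat0s.
rewrite -!catA uu' //; apply: eqv_ctx => //.
by case: (u').
Qed.

Lemma eqv_catl p u v : eqv u v -> eqv (p ++ u) (p ++ v).
Proof. by move=> uv; apply: eqv_cat => //; exact: eqv_refl. Qed.

Lemma eqv_catr p u v : eqv u v -> eqv (u ++ p) (v ++ p).
Proof. by move=> uv; apply: eqv_cat => //; exact: eqv_refl. Qed.

Lemma eqv_blank : eqv [:: blank] [::].
Proof.
move=> q ws e q0; split; last first.
  move=> /sbounds_add /(sbounds_merge (isT : [:: blank] != [::]) q0).
  by rewrite addrK.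
move=> H; apply: sbounds_del.
apply: (@sbounds_lift _ _ ([:: blank] ++ q) [:: [:: blank]; q]) H => e' ws'.
exact: bounds_drop.
Qed.

Lemma eqv_shift kd k k' j : eqv [:: (kd, k); (None, k')] [:: (kd, k + j); (None, k' - j)].
Proof.
move=> q ws e _; split; first by apply: sbounds_lift0 => e' ws' /=; exact: bounds_shift.
apply: sbounds_lift0 => e' ws' /= /(bounds_shift (- j)).
by rewrite addrK opprK subrK.
Qed.

Lemma eqv_letter kd k k' : eqv [:: (kd, k); (None, k')] [:: (kd, k + k')].
Proof.
apply: eqv_trans (eqv_shift _ _ _ k') _; rewrite subrr.
exact: (@eqv_catl [:: _] [:: blank] [::] eqv_blank).
Qed.

(** The relation of the group, as it acts on exponents. *)
Lemma eqv_commute k ep k' j :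
  eqv [:: (None, k); (Some ep, k')]
    [:: (None, k - side (~~ ep) * j); (Some ep, k' + side ep * j)].
Proof.
move=> q ws e _; split; first by apply: sbounds_lift0 => e' ws' /=; exact: bounds_commute.
apply: sbounds_lift0 => e' ws' /= /(bounds_commute (- j)).
by rewrite !mulrN opprK subrK addrK.
Qed.

Lemma eqv_cancel ep : eqv [:: (Some ep, 0); (Some (~~ ep), 0)] [::].
Proof.
apply: (@eqv_trans [:: blank; blank]); last first.
  by apply: eqv_trans eqv_blank; exact: (eqv_catl [:: blank] eqv_blank).
move=> q ws e _; split; apply: sbounds_lift0 => e' ws' /=.
  by apply: bounds_delete.
exact: bounds_insert.
Qed.

Definition letters (w : bs_word) : seq letter :=
  [seq if x.1 then (Some x.2, 0) else (None, if x.2 then -1 else 1) | x <- w].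

Lemma letters_cat u v : letters (u ++ v) = letters u ++ letters v.
Proof. exact: map_cat. Qed.

Lemma eqv_pow k : eqv (letters (a_pow k)) [:: (None, k)].
Proof.
rewrite /letters /a_pow map_nseq /=.
have H (a : int) n : eqv (nseq n (None, a)) [:: (None, a *+ n)].
  elim: n => [|n IHn]; first by apply: eqv_sym; exact: eqv_blank.
  apply: (eqv_trans (eqv_catl [:: (None, a)] IHn)).
  by rewrite mulrS; exact: eqv_letter.
apply: (eqv_trans (H _ _)); case: (ltrP k 0) => k0.
  by have -> : (-1) *+ `|k|%N = k by lia.
by have -> : 1 *+ `|k|%N = k by lia.
Qed.

Lemma eqv_pres u v : pres_eq (bs_rel m l) u v -> eqv (letters u) (letters v).
Proof.
elim=> {u v} [u|u v _|u v w _ uv _|u u' v v' _ uu' _ vv'|x ep|u v []].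
- exact: eqv_refl.
- exact: eqv_sym.
- exact: eqv_trans.
- by rewrite !letters_cat; exact: eqv_cat.
- case: x => /=; first exact: eqv_cancel.
  apply: (eqv_trans (eqv_letter _ _ _)).
  by case: ep; rewrite ?addNr ?subrr; exact: eqv_blank.
- rewrite /= letters_cat; apply: eqv_trans (eqv_sym (eqv_pow l)).
  apply: (@eqv_trans [:: (Some false, 0); (None, m); (Some true, 0)]).
    apply: (eqv_catl [:: (Some false, 0)]).
    exact: (eqv_catr [:: (Some true, 0)] (eqv_pow m)).
  apply: (eqv_trans (eqv_catr [:: (Some true, 0)] (eqv_letter _ _ _))).
  rewrite add0r; apply: (eqv_trans (eqv_catr _ (eqv_sym eqv_blank))).
  apply: (eqv_trans (eqv_catr [:: (Some true, 0)] (eqv_commute 0 false m (-1)))).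
  rewrite /= !mulrN !mulr1 sub0r opprK subrr.
  exact: (eqv_catl [:: (None, l)] (eqv_cancel false)).
Qed.

Lemma bs_evalM u v : bs_eval m l (u ++ v) = (bs_eval m l u * bs_eval m l v)%g.
Proof.
by apply/word_evalP/pres_sym; apply: pres_cat; exact: repr_word_eval.
Qed.

Lemma bs_eval1 : bs_eval m l [::] = 1%g. Proof. by []. Qed.

Lemma bs_evalV u : bs_eval m l (word_inv u) = ((bs_eval m l u)^-1)%g.
Proof.
apply/eqP; rewrite -mulg_eq1 -bs_evalM; apply/eqP.
by apply/word_evalP; exact: pres_invl.
Qed.

Lemma bs_eval_surj (g : BS m l) : exists w, bs_eval m l w = g.
Proof. by exists (generic_quotient.repr g); exact: word_eval_repr. Qed.

Lemma bs_eval_eqv u v : bs_eval m l u = bs_eval m l v -> eqv (letters u) (letters v).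
Proof. by move=> /word_evalP; exact: eqv_pres. Qed.

(** Appending a commutator amounts to cutting a boundary curve in two and joining
   the halves in another order. *)
Lemma sbounds_comm e W u v :
  sbounds e [:: blank :: letters W] ->
  sbounds (e - 2) [:: blank :: letters (W ++ (word_inv u ++ word_inv v) ++ u ++ v)].
Proof.
move=> H; pose A := blank :: letters (W ++ word_inv u ++ word_inv v).
have {H} H : sbounds e [:: A ++ (blank :: letters v) ++ letters u].
  have E1 : bs_eval m l W = bs_eval m l (W ++ (word_inv u ++ word_inv v) ++ v ++ u).
    rewrite !bs_evalM !bs_evalV; set g := bs_eval _ _ u; set h := bs_eval _ _ v.
    by rewrite !mulgA !mulgVK.
  have /(eqv_ctx (p := [:: blank]) (q := [::]) [::] e) := bs_eval_eqv E1.
  rewrite !cats0 => /(_ isT)[/(_ H) {}H _].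
  have /(eqv_ctx (p := A) (q := letters (v ++ u)) [::] e) := eqv_blank.
  move=> /(_ isT)[_]; rewrite !letters_cat => HH; apply: HH; move: H.
  by rewrite /A !letters_cat /= !catA.
have {H} := sbounds_split (isT : A != [::]) (isT : (blank :: letters v) ++ _ != [::]) H.
move=> /sbounds_swap /sbounds_rot /sbounds_swap H.
have B0 : letters u ++ blank :: letters v != [::] by case: (letters u).
have {H} := sbounds_merge (isT : A != [::]) B0 H.
rewrite -[blank :: letters v]cat1s.
have /(eqv_ctx (p := A ++ letters u) (q := letters v) [::] (e - 1 - 1)) := eqv_blank.
move=> /(_ isT)[+ _] H; rewrite -!catA => /(_ H).
by rewrite /A !letters_cat /= !catA -addrA.
Qed.

(** A product of k commutators bounds a surface of genus k with one boundary
   curve, whose Euler characteristic is 1 - 2 k. *)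
Lemma sbounds_ncomm k w : ncomm k (bs_eval m l w) ->
  sbounds (1 - 2 * k%:Z) [:: blank :: letters w].
Proof.
move=> [s sE sk].
suff [W [WE HW]] : exists W, bs_eval m l W = bs_eval m l w /\
    sbounds (1 - 2 * k%:Z) [:: blank :: letters W].
  have /(eqv_ctx (p := [:: blank]) (q := [::]) [::] (1 - 2 * k%:Z)) := bs_eval_eqv WE.
  by rewrite !cats0 => /(_ isT)[+ _]; exact.
rewrite sE -sk {sE sk}; elim/last_ind: s => [|s c [W [WE HW]]].
  exists [::]; split; first by rewrite big_nil.
  by rewrite subr0 -[X in sbounds X]add0r; apply: sbounds_add; exact: sbounds0.
have [u uE] := bs_eval_surj c.1; have [v vE] := bs_eval_surj c.2.
exists (W ++ (word_inv u ++ word_inv v) ++ u ++ v); split.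
  rewrite big_rcons /= !bs_evalM !bs_evalV WE uE vE; congr (_ * _)%g.
  by rewrite commgEl conjgE !mulgA.
rewrite size_rcons; have := sbounds_comm u v HW.
by congr sbounds; lia.
Qed.
End StableBounds.

(** * A dual solution bounds the number of discs *)

Notation turns := (seq (int * int)).

Definition altw (zz : turns) : seq letter :=
  flatten [seq [:: (Some false, c.1); (Some true, c.2)] | c <- zz].

Lemma size_altw zz : size (altw zz) = (size zz).*2.
Proof. by elim: zz => //= c zz IHz; rewrite IHz. Qed.

Lemma nth_altw zz i : (i < size zz)%N ->
  nth blank (altw zz) i.*2 = (Some false, (nth (0, 0) zz i).1) /\
  nth blank (altw zz) i.*2.+1 = (Some true, (nth (0, 0) zz i).2).
Proof.
elim: zz i => [|c zz IHz] [|i] //= /IHz[e1 e2].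
by rewrite -[X in X = _ /\ _]/(nth blank (altw zz) i.*2) e1 -e2.
Qed.

Lemma nth_flatten_nseq (T : Type) (x0 : T) n (s : seq T) i :
  (i < n * size s)%N -> nth x0 (flatten (nseq n s)) i = nth x0 s (i %% size s).
Proof.
elim: n i => [|n IHn] i /=; first by rewrite mul0n.
rewrite nth_cat mulSn => lti; case: ltnP => [lt|ge]; first by rewrite modn_small.
rewrite IHn; last by rewrite ltn_subLR.
by rewrite -{2}(subnK ge) modnDr.
Qed.

Lemma size_flatten_nseq (T : Type) n (s : seq T) : size (flatten (nseq n s)) = (n * size s)%N.
Proof. by elim: n => //= n IHn; rewrite size_cat IHn mulSn. Qed.

Lemma fcycle_nth (T : eqType) (f : T -> T) x0 X i : fcycle f X -> (i < size X)%N ->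
  f (nth x0 X i) = nth x0 X (i.+1 %% size X).
Proof.
case: X => [|x p] //= /(pathP x0) H lti; have := H i; rewrite size_rcons => /(_ lti).
rewrite -rcons_cons nth_rcons /= lti => /eqP ->.
move: lti; rewrite ltnS leq_eqVlt => /orP[/eqP ->|lti].
  by rewrite modnn nth_rcons ltnn eqxx.
by rewrite modn_small //= nth_rcons lti.
Qed.

Lemma big_orbit (T : finType) (V : nmodType) (c : {perm T}) z (F : T -> V) :
  \sum_(u in porbit c z) F u = \sum_(u <- traject c z #|porbit c z|) F u.
Proof.
rewrite (eq_bigl _ _ (fun u => porbit_traject c z u)) -big_uniq //.
exact: uniq_traject_porbit.
Qed.

Lemma traject_map (T : Type) (f : T -> T) z n : map f (traject f z n) = traject f (f z) n.
Proof. by elim: n z => //= n IHn z; rewrite IHn. Qed.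

Lemma rot_orbit (T : finType) (c : {perm T}) z :
  rot 1 (traject c z #|porbit c z|) = map c (traject c z #|porbit c z|).
Proof.
have := iter_porbit c z; have := card_porbit_neq0 c z.
case: #|_| => // n _ e; rewrite traject_map [RHS]trajectSr trajectS rot1_cons.
by rewrite -iterSr e.
Qed.

Lemma altw_step (T : finType) (s : {perm T}) (d : diagram T) zz X z :
  map (lab d) X = altw zz -> uniq X -> fcycle s X -> z \in X ->
  let i := index z X in let c := nth (0, 0) zz i./2 in
  [/\ (i < (size zz).*2)%N, s z \in X, index (s z) X = (i.+1 %% (size zz).*2)%N,
      odd (index (s z) X) = ~~ odd i
    & lab d z = (Some (odd i), if odd i then c.2 else c.1)].
Proof.
move=> LX uX sX zX i c.
have sizeX : size X = (size zz).*2 by rewrite -(size_map (lab d)) LX size_altw.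
have lti : (i < (size zz).*2)%N by rewrite -sizeX index_mem.
have lti' : (i.+1 %% (size zz).*2 < (size zz).*2)%N by rewrite ltn_mod (leq_trans _ lti).
have sE : s z = nth z X (i.+1 %% (size zz).*2).
  by rewrite -sizeX -(fcycle_nth z sX) ?sizeX // nth_index.
have isz : index (s z) X = (i.+1 %% (size zz).*2)%N.
  by rewrite sE index_uniq // sizeX.
split=> //; first by rewrite sE mem_nth // sizeX.
  rewrite isz -[RHS]/(odd i.+1) [in RHS](divn_eq i.+1 (size zz).*2).
  by rewrite oddD oddM odd_double andbF.
have [] := @nth_altw zz i./2 _; first by rewrite ltn_half_double.
rewrite -/c => e1 e2.
have -> : lab d z = nth blank (altw zz) i by rewrite -LX (nth_map z) ?sizeX // nth_index.
by rewrite -[in LHS](odd_double_half i); case: (odd i); rewrite /= ?add1n ?add0n ?e1 ?e2.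
Qed.

(** The sides of the polygon with the corners w, in cyclic order. *)
Definition arcs (T : Type) (w : seq T) : seq (T * T) := zip w (rot 1 w).

Lemma arcs_orbit (T : finType) (S : Type) (c : {perm T}) z (f : T -> S) :
  arcs [seq f u | u <- traject c z #|porbit c z|] =
  [seq (f u, f (c u)) | u <- traject c z #|porbit c z|].
Proof.
rewrite /arcs -map_rot rot_orbit -map_comp; elim: (traject _ _ _) => //= a r ->.
by [].
Qed.

Section Dual.
Variables (m l : int) (zz : turns).
Local Notation N := (size zz).

Definition xexp k : int := (nth (0, 0) zz k).1.
Definition yexp k : int := (nth (0, 0) zz k).2.
Definition discX (w : seq nat) : bool := (m %| \sum_(k <- w) xexp k)%Z.
Definition discY (w : seq nat) : bool := (l %| \sum_(k <- w) yexp k)%Z.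

Variable F : realFieldType.
Variables (p : nat -> nat -> F) (al : nat -> F).

(** The price of a polygon: al k for visiting the corner k, paid by the colour X
   alone, and p k j for the side between the corners k and j of an X-polygon,
   which the Y-polygon on the other side of the strip pays with the opposite
   sign. *)
Definition priceX (w : seq nat) : F :=
  \sum_(a <- arcs w) p a.1 a.2 + \sum_(k <- w) al k.
Definition priceY (w : seq nat) : F :=
  - \sum_(a <- arcs w) p a.2 (a.1.+1 %% N).

Definition dual_feasible := forall w, w != [::] -> all (fun k => k < N)%N w ->
  (discX w)%:R <= priceX w /\ (discY w)%:R <= priceY w.

Hypothesis N0 : (0 < N)%N.
Hypothesis dual : dual_feasible.

Lemma sum_even_iota (V : nmodType) (f : nat -> V) M :
  \sum_(i <- iota 0 M.*2 | ~~ odd i) f i./2 = \sum_(i <- iota 0 M) f i.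
Proof.
elim: M => [|M IHM]; first by rewrite !big_nil.
rewrite -[M.+1.*2]addn2 -[M.+1]addn1 !iotaD !big_cat IHM /= !big_cons !big_nil.
by rewrite !add0n /= odd_double /= addr0 doubleK !addr0.
Qed.

Lemma sum_mod_iota (V : nmodType) (f : nat -> V) n M : (0 < M)%N ->
  \sum_(i <- iota 0 (n * M)) f (i %% M)%N = (\sum_(k < M) f k) *+ n.
Proof.
move=> M0; elim: n => [|n IHn]; first by rewrite mul0n big_nil.
rewrite mulSn addnC iotaD big_cat IHn /= mulrSr; congr (_ + _).
rewrite add0n -[X in iota X]addn0 iotaDl big_map -(big_mkord xpredT f) /index_iota subn0.
rewrite [LHS]big_seq [RHS]big_seq; apply: eq_bigr => i; rewrite mem_iota /= => lti.
by rewrite modnMDl modn_small.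
Qed.

(** Summed over all regions of a diagram, the prices of the sides cancel along
   the strips and each corner is visited n times. *)
Lemma dual_bound n e : (0 < n)%N -> sbounds m l e [:: altw (flatten (nseq n zz))] ->
  (e + (n * N)%:Z)%:~R <= (\sum_(k < N) al k) *+ n :> F.
Proof.
move=> n0 [r0 /(_ r0 (leqnn _))[T [s [d [[|X xs] [[] //= [LX Lxs] uX Tall]]]]]].
move=> /andP[/andP[X0 sX] sxs] le_e.
have sizeX : size X = (n * N).*2.
  by rewrite -(size_map (lab d)) LX size_altw size_flatten_nseq.
have [z0 _] : exists z, z \in X by case: (X) X0 => // z ? _; exists z; rewrite mem_head.
pose K z := (lab d z).1; pose idx z := ((index z X)./2 %% N)%N.
have uniqX : uniq X by move: uX; rewrite cat_uniq => /and3P[].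
have nthE i : (i < n * N)%N ->
    nth (0, 0) (flatten (nseq n zz)) i = nth (0, 0) zz (i %% N) by exact: nth_flatten_nseq.
have F0 z : z \in X -> K z = Some (odd (index z X)) /\
    lab d z = (K z, if odd (index z X) then yexp (idx z) else xexp (idx z)).
  move=> /(altw_step LX uniqX sX)[]; rewrite size_flatten_nseq => lti _ _ _.
  by rewrite /K => ->; rewrite nthE // ltn_half_double.
have FN z : z \notin X -> [/\ lab d z = blank, s z = z & pairing d z = z].
  move=> zX; have := Tall z; rewrite mem_cat (negbTE zX) /= => /flattenP[w wxs zw].
  have lw : map (lab d) w = [:: blank].
    have : map (lab d) w \in nseq r0 [:: blank] by rewrite -Lxs map_f.
    by rewrite mem_nseq => /andP[_ /eqP].
  case: w wxs zw lw => [|z' [|? ?]] // wxs; rewrite inE => /eqP ez; subst z' => -[lz].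
  split=> //; last by rewrite pairing_None // lz.
  by have /andP[_] := allP sxs _ wxs; rewrite /= andbT => /eqP.
have KN z : K z = None -> z \notin X by apply: contra_eqN => /F0[-> _].
have KX z b : K z = Some b -> z \in X.
  by move=> Kz; apply/negP => /negP/FN[lz]; move: Kz; rewrite /K lz.
have Fs z b : K z = Some b -> [/\ K (s z) = Some (~~ b),
    idx (s z) = (if b then (idx z).+1 %% N else idx z)%N
    & lab d z = (Some b, if b then yexp (idx z) else xexp (idx z))].
  move=> Kz; have zX := KX z b Kz; have [] := F0 z zX; rewrite Kz => -[bE] lE.
  have [] := altw_step LX uniqX sX zX; rewrite size_flatten_nseq => lti szX isz osz _.
  split; last by rewrite lE bE.
    by have [-> _] := F0 _ szX; rewrite osz -bE.
  rewrite /idx isz; set i := index z X in bE lti *.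
  have [lt1|ge1] := ltnP i.+1 (n * N).*2.
    rewrite (modn_small lt1) bE /= uphalf_half; case: (odd i) => //=.
    by rewrite add1n -addn1 -[in RHS]addn1 modnDml.
  have {lti ge1} iE : i.+1 = (n * N).*2 by apply/eqP; rewrite eqn_leq lti ge1.
  have oi : odd i by rewrite -[odd i]negbK -[~~ odd i]/(odd i.+1) iE odd_double.
  rewrite iE modnn bE oi mod0n.
  have -> : i./2 = (n * N).-1.
    by have := congr1 half iE; rewrite doubleK /= uphalf_half oi => <-.
  rewrite -[X in _ = (X %% _)%N]addn1 modnDml addn1 prednK ?muln_gt0 ?n0 //.
  by rewrite modnMl.
pose c := (s * pairing d)%g.
have cE z : c z = pairing d (s z) by rewrite permM.
have Kc z b : K z = Some b -> K (c z) = Some b.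
  by move=> /Fs[Ks _ _]; rewrite /K cE pairing_kind -/(K _) Ks /= negbK.
have KcN z : K z = None -> c z = z by move=> /KN/FN[_ e1 e2]; rewrite cE e1 e2.
pose U z : F := if K z is Some b then
    if b then - p (idx (c z)) ((idx z).+1 %% N)%N else p (idx z) (idx (c z)) + al (idx z)
  else 1.
have idxN z : (idx z < N)%N by rewrite ltn_mod.
have orbU z : (orb_sum c (weight m l d) z == 0)%:R <= \sum_(u in porbit c z) U u.
  pose t := traject c z #|porbit c z|.
  have t0 : [seq idx u | u <- t] != [::].
    by rewrite -size_eq0 size_map size_traject card_porbit_neq0.
  have tN : all (fun k => k < N)%N [seq idx u | u <- t] by rewrite all_map; apply/allP => u _; exact: idxN.
  have [dX dY] := dual t0 tN.
  have Kt b : K z = Some b -> forall u, u \in t -> K u = Some b.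
    move=> Kz u; rewrite -porbit_traject => /porbitP[i ->].
    by elim: i => [|i IHi]; rewrite ?perm1 // expgSr permM; exact: Kc.
  have sumE b : K z = Some b -> \sum_(u in porbit c z) weight m l d u =
      \sum_(k <- [seq idx u | u <- t]) (if b then yexp k else xexp k)
      + side m l b * \sum_(u <- t) twist d u.
    move=> Kz; rewrite big_orbit -/t big_map mulr_sumr -big_split /=.
    rewrite big_seq [RHS]big_seq; apply: eq_bigr => u ut.
    by have [_ _ lu] := Fs u b (Kt b Kz u ut); rewrite /weight /wt lu.
  case Kz : (K z) => [[]|].
  - apply: le_trans (le_trans dY _).
      rewrite ler_nat /discY; case: eqP => //=; rewrite /orb_sum (sumE _ Kz) /=.
      move=> /eqP; rewrite addr_eq0 => /eqP ->.
      by rewrite rpredN dvdz_mulr.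
    rewrite /priceY arcs_orbit big_map -sumrN big_orbit -/t big_seq [X in _ <= X]big_seq.
    by apply: ler_sum => u ut; rewrite /U (Kt _ Kz u ut).
  - apply: le_trans (le_trans dX _).
      rewrite ler_nat /discX; case: eqP => //=; rewrite /orb_sum (sumE _ Kz) /=.
      move=> /eqP; rewrite addr_eq0 => /eqP ->.
      by rewrite rpredN dvdz_mulr.
    rewrite /priceX arcs_orbit !big_map -big_split big_orbit -/t big_seq [X in _ <= X]big_seq /=.
    by apply: ler_sum => u ut; rewrite /U (Kt _ Kz u ut).
  - rewrite (big_pred1 z) => [|u]; first by rewrite /U Kz (ler_nat F _ 1) leq_b1.
    rewrite -[RHS]/(u == z); apply/porbitP/eqP => [[i ->]|->]; last first.
      by exists 0%N; rewrite perm1.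
    by elim: i => [|i IHi]; rewrite ?perm1 // expgSr permM IHi KcN.
have discU : (discs m l s d)%:R <= \sum_z U z.
  rewrite /discs -/c; set Z := zero_orbits _ _.
  rewrite (partition_big (porbit c) (mem (porbits c))) /=; last first.
    by move=> z _; exact: imset_f.
  have -> : #|Z|%:R = \sum_(O in porbits c) ((O \in Z)%:R : F).
    rewrite -sum1_card natr_sum [RHS]big_mkcond [LHS]big_mkcond /=.
    by apply: eq_bigr => O _; rewrite !inE; case: (O \in porbits c); case: (_ == 0).
  apply: ler_sum => O /imsetP[z _ ->].
  have -> : \sum_(u | porbit c u == porbit c z) U u = \sum_(u in porbit c z) U u.
    by apply: eq_bigl => u; rewrite eq_porbit_mem.
  by apply: le_trans (orbU z); rewrite inE imset_f.
have sumK (f : nat -> F) : \sum_(u | K u == Some false) f (idx u) = (\sum_(k < N) f k) *+ n.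
  rewrite -(sum_mod_iota f n N0) -sum_even_iota -sizeX.
  have -> : \sum_(u | K u == Some false) f (idx u) =
      \sum_(u <- X | ~~ odd (index u X)) f (idx u).
    rewrite big_mkcond [RHS]big_mkcond /= [RHS](@big_uniq _ _ _ _ X _ uniqX) [RHS]big_mkcond /=.
    apply: eq_bigr => u _; case: ifP => [/eqP Ku|].
      have uX' := KX _ _ Ku; have [] := F0 _ uX'.
      by rewrite uX' Ku => -[<-].
    by case: ifP => // uX'; have [-> _] := F0 _ uX'; case: (odd _).
  rewrite -{1}(mkseq_nth z0 X) /mkseq big_map.
  rewrite big_seq_cond [RHS]big_seq_cond; apply: eq_big => [i|i].
    by rewrite mem_iota /= add0n; case: ltnP => //= lti; rewrite index_uniq.
  by rewrite mem_iota /= add0n => /andP[lti _]; rewrite /idx index_uniq.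
have stripsE : (strips d)%:R = (n * N)%:R :> F.
  have := sumK (fun=> 1); rewrite !sumr_const card_ord -mulrnA mulnC => <-.
  by congr (_ *+ _); apply: eq_card => z.
have sumU : \sum_z U z = r0%:R + (\sum_(k < N) al k) *+ n.
  rewrite (bigID (fun z => K z == None)) /=; congr (_ + _).
    transitivity (\sum_(z | K z == None) (1 : F)).
      by apply: eq_bigr => z /eqP Kz; rewrite /U Kz.
    rewrite sumr_const; congr _%:R.
    have : size (flatten xs) = r0.
      have := congr1 size (congr1 flatten Lxs); rewrite size_flatten_nseq muln1 => <-.
      by rewrite -map_flatten size_map.
    move=> <-; have uxs : uniq (flatten xs) by move: uX; rewrite cat_uniq => /and3P[].
    rewrite -(card_uniqP uxs); apply: eq_card => z; rewrite -[LHS]/(K z == None).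
    apply/eqP/idP => [/KN zX|zxs]; first by have := Tall z; rewrite mem_cat (negbTE zX).
    have zX : z \notin X.
      by move: uX; rewrite cat_uniq => /and3P[_ /hasPn/(_ z zxs)].
    by have [lz _ _] := FN z zX; rewrite /K lz.
  rewrite (bigID (fun z => K z == Some false)) /=.
  rewrite (eq_bigl (fun z => K z == Some false)); last first.
    by move=> z; case: (K z) => [[]|].
  rewrite [X in _ + X](eq_bigl (fun z => K z == Some true)); last first.
    by move=> z; case: (K z) => [[]|].
  have -> : \sum_(z | K z == Some false) U z =
      \sum_(z | K z == Some false) p (idx (pairing d z)) (idx z)
      + \sum_(z | K z == Some false) al (idx z).
    rewrite [X in _ = X + _](reindex_inj (@perm_inj _ c)) /=.
    rewrite [X in _ = X + _](eq_bigl (fun z => K z == Some false)); last first.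
      move=> z; case Kz: (K z) => [b|]; first by rewrite (Kc _ _ Kz).
      by rewrite KcN // Kz.
    rewrite -big_split; apply: eq_bigr => z /eqP Kz /=; rewrite /U Kz.
    by have [_ e1 _] := Fs _ _ Kz; rewrite cE pairingK e1.
  have -> : \sum_(z | K z == Some true) U z =
      - \sum_(z | K z == Some false) p (idx (pairing d z)) (idx z).
    rewrite [X in _ = - X](reindex_inj (@perm_inj _ s)) /= -sumrN.
    rewrite [RHS](eq_bigl (fun z => K z == Some true)); last first.
      move=> z; case Kz: (K z) => [b|]; first by have [-> _ _] := Fs _ _ Kz; case: b Kz.
      by have [_ -> _] := FN z (KN z Kz); rewrite Kz.
    apply: eq_bigr => z /eqP Kz; rewrite /U Kz.
    by have [_ -> _] := Fs _ _ Kz; rewrite cE.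
  by rewrite addrAC subrr add0r sumK.
have : ((e + r0%:Z + (strips d)%:Z)%:~R : F) <= (discs m l s d)%:R.
  by rewrite [X in _ <= X]pmulrn ler_int.
move/le_trans => /(_ _ discU); rewrite sumU !intrD -!pmulrn stripsE.
by rewrite addrAC [_ + r0%:R]addrC lerD2l.
Qed.
End Dual.

(** * Annuli between alternating words *)

Definition reduced (m l : int) (zz : turns) :=
  all (fun c => ~~ (m %| c.1)%Z && ~~ (l %| c.2)%Z) zz.

(** An annulus has as many discs as strips, and as the words are reduced no disc
   is a monogon; counting points shows that all regions are bigons.  Hence the
   pairing reverses the order along the boundary.  Two letters of one word can
   then not be paired: halfway between them some letter would be paired to its
   successor.  So the pairing maps the first word injectively to the second. *)
Lemma size_annulus m l (zz zz' : turns) : reduced m l zz -> reduced m l zz' ->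
  sbounds m l 0 [:: altw zz; altw zz'] -> (size zz <= size zz')%N.
Proof.
move=> red red' [r0 /(_ r0 (leqnn _))[T [s [d [[|X [|X' xs]] [[] //= [LX LX' Lxs] uX Tall]]]]]].
move=> /and3P[/andP[X0 sX] /andP[X0' sX'] sxs]; rewrite add0r => le_e.
have [uniqX uniqX'] : uniq X /\ uniq X'.
  by move: uX; rewrite !cat_uniq => /and3P[-> _ /and3P[->]].
pose K z := (lab d z).1.
have FX z : (z \in X) || (z \in X') ->
    exists b, [/\ K z = Some b, K (s z) = Some (~~ b) & ~~ (side m l b %| (lab d z).2)%Z].
  have step (Y : seq T) yy : map (lab d) Y = altw yy -> uniq Y -> fcycle s Y ->
      reduced m l yy -> z \in Y ->
      exists b, [/\ K z = Some b, K (s z) = Some (~~ b) & ~~ (side m l b %| (lab d z).2)%Z].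
    move=> LY uY sY redY zY; have [lti szY _ osz lz] := altw_step LY uY sY zY.
    exists (odd (index z Y)); split; first by rewrite /K lz.
      by have [_ _ _ _ e1] := altw_step LY uY sY szY; rewrite /K e1 osz.
    have /andP[] : ~~ (m %| (nth (0, 0) yy (index z Y)./2).1)%Z &&
        ~~ (l %| (nth (0, 0) yy (index z Y)./2).2)%Z.
      by apply: (allP redY); rewrite mem_nth // ltn_half_double.
    by rewrite lz; case: (odd _).
  by case/orP; [exact: step LX uniqX sX red|exact: step LX' uniqX' sX' red'].
have FN z : (z \in X) || (z \in X') = false -> [/\ lab d z = blank, s z = z & pairing d z = z].
  move=> zX; have := Tall z; rewrite !mem_cat orbA zX /= => /flattenP[w wxs zw].
  have lw : map (lab d) w = [:: blank].
    have : map (lab d) w \in nseq r0 [:: blank] by rewrite -Lxs map_f.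
    by rewrite mem_nseq => /andP[_ /eqP].
  case: w wxs zw lw => [|z' [|? ?]] // wxs; rewrite inE => /eqP ez; subst z' => -[lz].
  split=> //; last by rewrite pairing_None // lz.
  by have /andP[_] := allP sxs _ wxs; rewrite /= andbT => /eqP.
have KX z b : K z = Some b -> (z \in X) || (z \in X').
  move=> Kz; case E: (_ || _) => //; have [lz _ _] := FN z E.
  by move: Kz; rewrite /K lz.
have KN z : K z = None -> (z \in X) || (z \in X') = false.
  by move=> Kz; apply/negP => /FX[b []]; rewrite Kz.
pose c := (s * pairing d)%g.
have cE z : c z = pairing d (s z) by rewrite permM.
have Ks z b : K z = Some b -> K (s z) = Some (~~ b).
  by move=> Kz; have [b' []] := FX z (KX z b Kz); rewrite Kz => -[->].
have Kc z b : K z = Some b -> K (c z) = Some b.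
  by move=> /Ks e1; rewrite /K cE pairing_kind -/(K _) e1 /= negbK.
have KcN z : K z = None -> c z = z by move=> /KN/FN[_ e1 e2]; rewrite cE e1 e2.
have fixc z : c z = z -> porbit c z = [set z].
  move=> cz; apply/setP => u; rewrite inE; apply/porbitP/eqP => [[i ->]|->]; last first.
    by exists 0%N; rewrite perm1.
  by elim: i => [|i IHi]; rewrite ?perm1 // expgSr permM IHi.
(* Blank points count twice, since a blank point is a disc by itself. *)
pose U z : nat := if K z is Some _ then 1 else 2.
have orbU z : ((orb_sum c (weight m l d) z == 0).*2 <= \sum_(u in porbit c z) U u)%N.
  case Kz : (K z) => [b|]; last first.
    by rewrite (fixc z (KcN z Kz)) big_set1 /U Kz; case: (_ == 0).
  case: eqP => //= s0; rewrite (eq_bigr (fun=> 1)%N) => [|u]; last first.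
    have Ko i : K (iter i c z) = Some b by elim: i => //= i /Kc.
    by move=> /porbitP[i ->]; rewrite permX /U Ko.
  rewrite sum1_card ltn_neqAle lt0n card_porbit_neq0 andbT.
  apply: contraPneq s0 => /esym/eqP/cards1P[u ou].
  have zu : z = u by apply/set1P; rewrite -ou porbit_id.
  rewrite /orb_sum ou big_set1 -zu /weight /wt -/(K z) Kz.
  have [b' [Kz' _ nd]] := FX z (KX z b Kz).
  move: Kz'; rewrite Kz => -[eb] /eqP; rewrite addr_eq0 => /eqP e1.
  by move: nd; rewrite e1 eb rpredN dvdz_mulr.
have sumN : (\sum_z U z = (strips d).*2 + r0.*2)%N.
  have cN : #|[pred z | K z == None]| = r0.
    have : size (flatten xs) = r0.
      have := congr1 size (congr1 flatten Lxs); rewrite size_flatten_nseq muln1 => <-.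
      by rewrite -map_flatten size_map.
    move=> <-; have uxs : uniq (flatten xs) by move: uX; rewrite !cat_uniq => /and3P[_ _ /and3P[]].
    rewrite -(card_uniqP uxs); apply: eq_card => z; rewrite -[LHS]/(K z == None).
    apply/eqP/idP => [/KN zX|zxs].
      by have := Tall z; rewrite !mem_cat orbA zX.
    have zX : (z \in X) || (z \in X') = false.
      move: uX; rewrite !cat_uniq !has_cat negb_or => /and3P[_ /andP[_ h1] /and3P[_ h2 _]].
      by rewrite (negbTE (hasPn h1 z zxs)) (negbTE (hasPn h2 z zxs)).
    by have [lz _ _] := FN z zX; rewrite /K lz.
  have cT : #|[pred z | K z == Some true]| = strips d.
    rewrite /strips -!sum1_card [RHS](reindex_inj (@perm_inj _ s)) /=.
    apply: eq_bigl => z; rewrite !inE /= -/(K (s z)).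
    case Kz: (K z) => [b|]; first by rewrite (Ks _ _ Kz); case: b Kz.
    by have [_ -> _] := FN z (KN z Kz); rewrite Kz.
  rewrite (bigID (fun z => K z == None)) /= (eq_bigr (fun=> 2)%N); last by move=> z /eqP Kz; rewrite /U Kz.
  rewrite sum_nat_const cN muln2 addnC; congr addn.
  rewrite (bigID (fun z => K z == Some true)) /=.
  rewrite (eq_bigr (fun=> 1)%N); last by move=> z /andP[_ /eqP Kz]; rewrite /U Kz.
  rewrite [X in (_ + X)%N](eq_bigr (fun=> 1)%N); last first.
    by move=> z; rewrite /U; case: (K z) => [[]|].
  rewrite !sum1_card -addnn; congr addn; last first.
    by apply: eq_card => z; rewrite !inE /= -/(K z) unfold_in /=; case: (K z) => [[]|].
  by rewrite -cT; apply: eq_card => z; rewrite !inE unfold_in; case: (K z) => [[]|].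
(* The total weight of all points is at most twice the number of discs, and no
   orbit exceeds its share, so that equality holds orbit by orbit. *)
have orbE z : K z != None -> #|porbit c z| = 2.
  move=> Kz; pose D z := (\sum_(u in porbit c z) U u)%N.
  have discE : (discs m l s d = \sum_(O in porbits c) (O \in zero_orbits c (weight m l d)))%N.
    rewrite /discs -sum1_card [LHS]big_mkcond [RHS]big_mkcond.
    by apply: eq_bigr => O _; rewrite !inE; case: (O \in porbits c); case: (_ == 0).
  have le_disc : (\sum_z U z <= (discs m l s d).*2)%N by rewrite sumN -doubleD leq_double addnC -lez_nat PoszD.
  move: le_disc; rewrite (partition_big (porbit c) (mem (porbits c))) /=; last first.
    by move=> u _; exact: imset_f.
  rewrite discE -muln2 big_distrl /= (bigD1 (porbit c z)) ?imset_f //=.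
  rewrite [X in (_ <= X)%N](bigD1 (porbit c z)) ?imset_f //=.
  have sub u : (\sum_(i | porbit c i == porbit c u) U i = D u)%N.
    by apply: eq_bigl => v; rewrite eq_porbit_mem.
  have inZ u : (porbit c u \in zero_orbits c (weight m l d)) = (orb_sum c (weight m l d) u == 0).
    by rewrite inE imset_f.
  set S1 := (\sum_(i in _ | _) \sum_(_ | _) _)%N; set S2 := (\sum_(i in _ | _) _)%N.
  have le_S : (S2 <= S1)%N.
    apply: leq_sum => O /andP[/imsetP[u _ ->] _]; rewrite sub inZ muln2; exact: orbU.
  rewrite sub inZ => le1; have {le1 le_S} le1 : (D z <= (orb_sum c (weight m l d) z == 0) * 2)%N.
    by rewrite -(leq_add2r S1); apply: leq_trans le1 _; rewrite leq_add2l.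
  have Dz : D z = #|porbit c z|.
    case Kz' : (K z) Kz => [b|] // _; rewrite -sum1_card; apply: eq_bigr => u.
    have Ko i : K (iter i c z) = Some b by elim: i => //= i /Kc.
    by move=> /porbitP[i ->]; rewrite permX /U Ko.
  have := orbU z; rewrite -/(D z); move: le1; rewrite Dz.
  have := card_porbit_neq0 c z; case: (orb_sum _ _ z == 0) => /= n0 h1 h2.
    by apply/eqP; rewrite eqn_leq h1.
  by move: n0; rewrite -leqn0 h1.
have cc z : K z != None -> c (c z) = z.
  by move=> Kz; have := iter_porbit c z; rewrite orbE.
have cN z : K z != None -> c z != z.
  move=> Kz; apply/eqP => /fixc o1; have := orbE z Kz.
  by rewrite o1 cards1.
have KX' z : z \in X -> exists b, K z = Some b.
  by move=> zX; have [|b [Kz _ _]] := FX z; [rewrite zX|exists b].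
(* If z is paired with its j-th successor, then j is odd and the middle letter
   would be paired with the next one, giving a monogon. *)
have pX z : z \in X -> pairing d z \in X'.
  move=> zX; have [b Kz] := KX' z zX.
  have Kpz : K (pairing d z) = Some (~~ b) by rewrite /K pairing_kind -/(K z) Kz.
  have /orP[pzX|//] := KX _ _ Kpz; exfalso.
  have Kit i : K (iter i s z) = Some (odd i (+) b).
    by elim: i => [|i IHi] //=; rewrite (Ks _ _ IHi) addNb.
  have [j pz] : exists j, pairing d z = iter j s z.
    have : fconnect s z (pairing d z).
      by rewrite (fconnect_cycle sX zX).
    by move=> /iter_findex <-; exists (findex s z (pairing d z)).
  have oj : odd j.
    by have := Kit j; rewrite -pz Kpz => -[]; case: (odd j); case: (b).
  have sps u : K u != None -> s (pairing d (s u)) = pairing d u.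
    by move=> Ku; have := cc u Ku; rewrite !cE => /(congr1 (pairing d)); rewrite pairingK.
  have pit i : (i <= j)%N -> pairing d (iter i s z) = iter (j - i) s z.
    elim: i => [|i IHi] lti; first by rewrite subn0.
    apply: (@perm_inj _ s); rewrite [in LHS]iterS sps ?Kit // IHi ?(ltnW lti) //.
    by rewrite -iterS -subSn // subSS.
  pose y := iter j./2 s z.
  have jE : j = (j./2 + j./2.+1)%N by rewrite -{1}(odd_double_half j) oj addnS addnn.
  have py : pairing d y = s y.
    by rewrite pit; [rewrite {1}jE addKn|rewrite {2}jE leq_addr].
  have Ky : K y != None by rewrite Kit.
  by case/eqP: (cN y Ky); rewrite cE -py pairingK.
rewrite -leq_double -!size_altw -LX -LX' !size_map.
rewrite -(size_map (pairing d)); apply: uniq_leq_size.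
  by rewrite map_inj_uniq //; exact: perm_inj.
by move=> _ /mapP[z zX ->]; exact: pX.
Qed.

(** * Gluing polygons along their sides *)

Section CyclicArcs.
Variable T : eqType.
Implicit Types (x y : T) (p q u v w : seq T).

Definition steps x p := zip (x :: p) p.

Lemma arcs_cons x p : arcs (x :: p) = rcons (steps x p) (last x p, x).
Proof.
rewrite /arcs rot1_cons /steps.
suff H y : zip (y :: p) (rcons p x) = rcons (zip (y :: p) p) (last y p, x) by [].
by elim: p y => //= z p IHp y; rewrite IHp.
Qed.

Lemma steps_cat x p y q : steps x (p ++ y :: q) = steps x p ++ (last x p, y) :: steps y q.
Proof. by elim: p x => //= z p IHp x; rewrite -IHp. Qed.

Lemma arcs_cat x p y q :
  perm_eq [:: (last x p, x), (last y q, y) & arcs ((x :: p) ++ y :: q)]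
    ([:: (last x p, y); (last y q, x)] ++ (arcs (x :: p) ++ arcs (y :: q))).
Proof.
rewrite cat_cons !arcs_cons steps_cat last_cat /=.
by apply/seq.permP => a; rewrite -!cats1 /= !count_cat /=; lia.
Qed.

Lemma arcs_rot u v : perm_eq (arcs (u ++ v)) (arcs (v ++ u)).
Proof.
case: u v => [|x p] [|y q]; rewrite ?cats0 //.
have /seq.permP H := arcs_cat x p y q; have /seq.permP H' := arcs_cat y q x p.
apply/seq.permP => a; move: (H a) (H' a); rewrite /= !count_cat /=; clear; lia.
Qed.

Lemma steps_split a b x p : (a, b) \in steps x p ->
  exists p1 p2, p = p1 ++ b :: p2 /\ last x p1 = a.
Proof.
elim: p x => //= y p IHp x; rewrite /steps /= inE => /orP[/eqP[-> ->]|/IHp].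
  by exists [::], p.
by move=> [p1 [p2 [-> <-]]]; exists (y :: p1), p2.
Qed.

Lemma arc_rot a b w : (a, b) \in arcs w ->
  exists u v p, [/\ w = u ++ v, v ++ u = b :: p & last b p = a].
Proof.
case: w => [//|x p]; rewrite arcs_cons mem_rcons inE => /orP[/eqP[-> ->]|].
  by exists [::], (x :: p), p; rewrite cats0.
move=> /steps_split[p1 [p2 [-> <-]]]; exists (x :: p1), (b :: p2), (p2 ++ x :: p1).
by rewrite last_cat.
Qed.
End CyclicArcs.

Section Gluing.
Local Open Scope group_scope.
Variables (G : groupType) (K : nat) (Z H : G -> Prop).
Hypothesis ZM : forall x y, Z x -> Z y -> Z (x * y).
Hypothesis Znull : forall z, Z z -> null K z.
Hypothesis ZH : forall z h, Z z -> H h -> commute z h.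
Hypothesis H1 : H 1.
Hypothesis HM : forall x y, H x -> H y -> H (x * y).

Variable N : nat.

(** The corner (b, k) stands for the k-th power of t a t^-1 in the word if b is
   false, and for the k-th power of a otherwise.  A cyclic sequence of corners
   is a closed boundary curve; two consecutive corners of the same colour are
   separated by a side still to be glued, while at a change of colour the curve
   follows the word. *)
Notation corner := (bool * nat)%type.
Variable val : corner -> G.
Hypothesis Hval : forall v, H (val v).

Definition ev (w : seq corner) : G := \prod_(v <- w) val v.

Lemma H_ev w : H (ev w).
Proof. by rewrite /ev; apply: (big_ind H). Qed.

Lemma ev_cat u v : ev (u ++ v) = ev u * ev v.
Proof. exact: big_cat. Qed.

Definition glued (a : corner * corner) : bool :=
  if a.1.1 then ~~ a.2.1 && (a.2.2 == a.1.2.+1 %% N)%N else a.2.1 && (a.2.2 == a.1.2).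

Definition inrange (a : corner * corner) := (a.1.2 < N)%N && (a.2.2 < N)%N.

Definition redarc (a : corner * corner) := ~~ a.1.1 && ~~ a.2.1.

(** The sides still to be glued can be glued in pairs: the side of an X-polygon
   between k and i + 1 goes with the side of a Y-polygon between i and k. *)
Definition matched (A : seq (corner * corner)) :=
  [/\ all (fun a => (a.1.1 == a.2.1) || glued a) A, all inrange A &
   forall i k, (i < N)%N -> (k < N)%N ->
   count_mem ((false, k), (false, i.+1 %% N)%N) A = count_mem ((true, i), (true, k)) A].

Lemma matched_perm A B : perm_eq A B -> matched A -> matched B.
Proof.
move=> AB [okA inA cA]; split.
- by rewrite -(perm_all _ AB).
- by rewrite -(perm_all _ AB).
- by move=> i k iN kN; rewrite -!(seq.permP AB); exact: cA.
Qed.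

Lemma succ_mod_inj i i' : (i < N)%N -> (i' < N)%N ->
  (i.+1 %% N)%N = (i'.+1 %% N)%N -> i = i'.
Proof.
have E j : (j < N)%N -> (j.+1 %% N)%N = (if j.+1 == N then 0 else j.+1)%N.
  by move=> jN; case: eqP => [->|/eqP n]; rewrite ?modnn // modn_small // ltn_neqAle n.
by move=> iN i'N; rewrite !E //; case: eqP; case: eqP; lia.
Qed.

Lemma matched_glue i k A : (i < N)%N -> (k < N)%N ->
  matched [:: ((false, k), (false, i.+1 %% N)%N), ((true, i), (true, k)) & A] ->
  matched [:: ((false, k), (true, k)), ((true, i), (false, i.+1 %% N)%N) & A].
Proof.
move=> iN kN [/= okA /andP[r1 /andP[r2 inA]] cA]; split=> /=.
- by rewrite /glued /= !eqxx.
- by rewrite /inrange /= iN kN ltn_mod (leq_ltn_trans _ iN).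
move=> i' k' i'N k'N; have /= := cA i' k' i'N k'N; rewrite !xpair_eqE /=.
have -> : ((i.+1 %% N)%N == (i'.+1 %% N)%N) = (i == i').
  by apply/eqP/eqP => [/succ_mod_inj->|->].
rewrite andbC; clear; lia.
Qed.

Lemma flatten_arcs_perm (ws ws' : seq (seq corner)) : perm_eq ws ws' ->
  perm_eq (flatten (map (@arcs _) ws)) (flatten (map (@arcs _) ws')).
Proof. by move=> pws; apply: perm_flatten; exact: perm_map. Qed.

(** Gluing one pair of sides either cuts a curve in two or joins two curves. *)
Lemma glue_step ws e k j : all (fun w => w != [::]) ws ->
  matched (flatten (map (@arcs _) ws)) ->
  ((false, k), (false, j)) \in flatten (map (@arcs _) ws) ->
  surf K Z e (map ev ws) ->
  exists ws', [/\ all (fun w => w != [::]) ws', matched (flatten (map (@arcs _) ws')),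
    perm_eq (flatten ws') (flatten ws),
    count redarc (flatten (map (@arcs _) ws)) =
      (count redarc (flatten (map (@arcs _) ws'))).+1
    & surf K Z (e - 1) (map ev ws')].
Proof.
move=> ws0 mA kjA sf; have [okA inA cA] := mA.
have /andP[/= kN jN] := allP inA _ kjA.
pose i := ((j + N.-1) %% N)%N.
have N0 : (0 < N)%N by exact: leq_ltn_trans kN.
have iN : (i < N)%N by rewrite ltn_mod.
have ji : j = (i.+1 %% N)%N.
  by rewrite /i -addn1 modnDml -addnA addn1 prednK // modnDr modn_small.
have ikA : ((true, i), (true, k)) \in flatten (map (@arcs _) ws).
  rewrite -has_pred1 has_count -cA // -has_count has_pred1.
  by rewrite -ji.
(* Bring the side of the X-polygon to the end of the first curve. *)
have {kjA} [w wws kjw] : exists2 w, w \in ws & ((false, k), (false, j)) \in arcs w.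
  by have /flatten_mapP[w] := kjA; exists w.
have [rest pws] : exists rest, perm_eq ws (w :: rest).
  by exists (rem w ws); exact: perm_to_rem.
have [u [v [p [wuv vup lp]]]] := arc_rot kjw.
have {sf} sf : surf K Z e (map ev ((v ++ u) :: rest)).
  rewrite /= ev_cat; apply: (surf_rot ZH); first exact: H_ev.
  by rewrite -ev_cat -wuv -/(map ev (w :: rest)); apply: surf_perm sf; exact: perm_map.
have pA : perm_eq (flatten (map (@arcs _) ws)) (arcs (v ++ u) ++ flatten (map (@arcs _) rest)).
  apply: perm_trans (flatten_arcs_perm pws) _.
  by rewrite /= perm_cat2r wuv; exact: arcs_rot.
have pf : perm_eq (flatten ws) ((v ++ u) ++ flatten rest).
  by apply: perm_trans (perm_flatten pws) _; rewrite /= perm_cat2r wuv perm_catC.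
have rest0 : all (fun w => w != [::]) rest.
  by move: ws0; rewrite (perm_all _ pws) /= => /andP[].
have mA' := matched_perm pA mA.
rewrite (perm_mem pA) mem_cat in ikA.
rewrite vup in sf pA pf mA' ikA.
have finish (A B : seq (corner * corner)) (ws' : seq (seq corner)) : perm_eq
    [:: ((false, k), (true, k)), ((true, i), (false, j)) & A]
      ([:: ((false, k), (false, j)); ((true, i), (true, k))] ++ B) ->
    perm_eq (flatten (map (@arcs _) ws)) A ->
    perm_eq (flatten (map (@arcs _) ws')) B ->
    matched (flatten (map (@arcs _) ws')) /\ count redarc (flatten (map (@arcs _) ws)) =
      (count redarc (flatten (map (@arcs _) ws'))).+1.
  move=> AB wsA wsB; split; last first.
    by rewrite (seq.permP wsA) (seq.permP wsB); have := seq.permP AB redarc; exact.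
  apply: (@matched_perm B); first by rewrite perm_sym.
  pose B0 := rem ((true, i), (false, j)) (rem ((false, k), (true, k)) B).
  have e1 : perm_eq B [:: ((false, k), (true, k)), ((true, i), (false, j)) & B0].
    have h1 : ((false, k), (true, k)) \in B.
      by have := perm_mem AB ((false, k), (true, k)); rewrite mem_head /= !inE !xpair_eqE /= andbF.
    have h2 : ((true, i), (false, j)) \in rem ((false, k), (true, k)) B.
      have := perm_mem (perm_to_rem h1) ((true, i), (false, j)).
      have := perm_mem AB ((true, i), (false, j)).
      by rewrite /= !inE !xpair_eqE /= !eqxx !andbF /= => <- <-.
    by apply: perm_trans (perm_to_rem h1) _; rewrite perm_cons perm_to_rem.
  have e2 : perm_eq A [:: ((false, k), (false, j)), ((true, i), (true, k)) & B0].
    apply/seq.permP => a; have := seq.permP AB a; rewrite /= (seq.permP e1) /=; clear; lia.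
  apply: (@matched_perm [:: ((false, k), (true, k)), ((true, i), (false, j)) & B0]).
    by rewrite perm_sym.
  by rewrite ji; apply: matched_glue => //; rewrite -ji; apply: matched_perm e2 _; apply: matched_perm mA.
case/orP: ikA => [ikw|/flatten_mapP[w2 w2r ikw2]].
(* Both sides lie on the same curve, which is cut into two. *)
  move: ikw; rewrite arcs_cons mem_rcons inE => /orP[/eqP[]|].
    by rewrite lp.
  move=> /steps_split[p1 [p2 [pE lp1]]].
  pose ws' := [:: (false, j) :: p1, (true, k) :: p2 & rest].
  have [|m' c'] := finish _ _ ws' _ pA (perm_refl _).
    have := arcs_cat (false, j) p1 (true, k) p2.
    have -> : last (true, k) p2 = (false, k) by rewrite -lp pE last_cat.
    rewrite lp1 cat_cons -pE => h; rewrite /= catA.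
    apply/seq.permP => a; have := seq.permP h a; rewrite /= !count_cat /=; clear; lia.
  exists ws'; split=> //.
    apply: perm_trans (_ : perm_eq _ (((false, j) :: p) ++ flatten rest)) _.
      by rewrite pE /= -catA.
    by rewrite perm_sym.
  apply: (surf_split Znull ZH); first exact: H_ev.
  by rewrite -ev_cat cat_cons -pE.
(* The sides lie on two curves, which are joined. *)
have [rest2 pr] : exists rest2, perm_eq rest (w2 :: rest2).
  by exists (rem w2 rest); exact: perm_to_rem.
have [u2 [v2 [q [w2E vu2 lq]]]] := arc_rot ikw2.
pose ws' := (((false, j) :: p) ++ (true, k) :: q) :: rest2.
have pA2 : perm_eq (flatten (map (@arcs _) ws))
   ((arcs ((false, j) :: p) ++ arcs ((true, k) :: q)) ++ flatten (map (@arcs _) rest2)).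
  apply: (perm_trans pA); rewrite -catA perm_cat2l.
  apply: perm_trans (flatten_arcs_perm pr) _.
  by rewrite /= perm_cat2r w2E -vu2; exact: arcs_rot.
have [|m' c'] := finish _ _ ws' _ pA2 (perm_refl _).
  have := arcs_cat (false, j) p (true, k) q; rewrite lp lq => h.
  by apply/seq.permP => a; have := seq.permP h a; rewrite /= !count_cat /=; clear; lia.
exists ws'; split=> //.
- by move: rest0; rewrite (perm_all _ pr) /= => /andP[].
- rewrite perm_sym; apply: perm_trans pf _; rewrite /ws' /= -catA perm_cons perm_cat2l.
  by apply: perm_trans (perm_flatten pr) _; rewrite /= -cat_cons perm_cat2r w2E -vu2 perm_catC.
- rewrite -[map ev ws']/(ev (((false, j) :: p) ++ (true, k) :: q) :: map ev rest2) ev_cat.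
  apply: (surf_merge ZM Znull ZH); [exact: H_ev|exact: H_ev|].
  have {sf} sf : surf K Z e [:: ev ((false, j) :: p), ev w2 & map ev rest2].
    apply: surf_perm sf; rewrite /= perm_cons -/(map ev (w2 :: rest2)).
    exact: perm_map.
  have sw (gs : seq G) a b : perm_eq [:: a, b & gs] [:: b, a & gs].
    by rewrite -[_ :: _]/([:: a] ++ [:: b] ++ gs) perm_catCA.
  apply: (surf_perm (sw _ _ _)); rewrite -vu2 ev_cat; apply: (surf_rot ZH); first exact: H_ev.
  by rewrite -ev_cat -w2E; apply: surf_perm sf; exact: sw.
Qed.

Lemma glue ws e : all (fun w => w != [::]) ws ->
  matched (flatten (map (@arcs _) ws)) -> surf K Z e (map ev ws) ->
  exists ws', [/\ all (fun w => w != [::]) ws', perm_eq (flatten ws') (flatten ws),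
    all (fun a => glued a && inrange a) (flatten (map (@arcs _) ws'))
    & surf K Z (e - (count redarc (flatten (map (@arcs _) ws)))%:Z)%R (map ev ws')].
Proof.
move: {2}(count _ _) (erefl (count redarc (flatten (map (@arcs _) ws)))) => n.
elim: n ws e => [|n IHn] ws e cn ws0 mA sf.
  exists ws; split=> //; last by rewrite cn subr0.
  have [okA inA cA] := mA; apply/allP => -[[b1 k1] [b2 k2]] aA.
  have /andP[/= k1N k2N] := allP inA _ aA; rewrite /inrange /= k1N k2N !andbT.
  have /orP[/eqP eb|//] := allP okA _ aA; rewrite /= in eb; subst b2.
  have no a : redarc a -> a \notin flatten (map (@arcs _) ws).
    move=> ra; apply/negP => aA'; have : has redarc (flatten (map (@arcs _) ws)).
      by apply/hasP; exists a.
    by rewrite has_count cn.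
  case: b1 aA => aA; last by case/negP: (no (false, k1, (false, k2)) isT).
  have : count_mem ((true, k1), (true, k2)) (flatten (map (@arcs _) ws)) != 0%N.
    by rewrite -lt0n -has_count has_pred1.
  rewrite -cA // -lt0n -has_count has_pred1.
  by move=> h; case/negP: (no (false, k2, (false, k1.+1 %% N)%N) isT).
have : has redarc (flatten (map (@arcs _) ws)) by rewrite has_count cn.
move=> /hasP[[[[] k] [[] j]] kjA] // _.
have [ws' [ws'0 mA' pf cE sf']] := glue_step ws0 mA kjA sf.
rewrite cn in cE; case: cE => cE.
have [ws'' [h1 h2 h3 h4]] := IHn ws' (e - 1)%R (esym cE) ws'0 mA' sf'.
exists ws''; split=> //; first exact: perm_trans h2 pf.
by move: h4; rewrite cn -cE; congr surf; lia.
Qed.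

Hypothesis N0 : (0 < N)%N.

Definition next_corner (v : corner) : corner :=
  if v.1 then (false, v.2.+1 %% N)%N else (true, v.2).

Definition whole_word : seq corner := flatten [seq [:: (false, k); (true, k)] | k <- iota 0 N].

Lemma traject_next k n : (k + n <= N)%N ->
  traject next_corner (false, k) n.*2 = flatten [seq [:: (false, k); (true, k)] | k <- iota k n].
Proof.
elim: n k => //= n IHn k le; rewrite /next_corner /=; congr [:: _, _ & _].
case: n le IHn => // n le IHn; rewrite modn_small; last by lia.
by rewrite -/next_corner IHn //; lia.
Qed.

Lemma iter_next k i : (k < N)%N ->
  iter i next_corner (false, k) = (odd i, (k + i./2) %% N)%N.
Proof.
move=> kN; elim: i => [|i IHi]; first by rewrite addn0 modn_small.
rewrite /= IHi /next_corner /= uphalf_half; case: (odd i) => //=.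
by rewrite add1n addnS -addn1 modnDml addn1.
Qed.

Lemma traject_add (T : Type) (f : T -> T) x i j :
  traject f x (i + j) = traject f x i ++ traject f (iter i f x) j.
Proof. by elim: i x => //= i IHi x; rewrite IHi -iterSr. Qed.

(** When no side is left to be glued, a boundary curve is a power of the word. *)
Lemma glued_power w : w != [::] -> all (fun a => glued a && inrange a) (arcs w) ->
  exists n u v, [/\ (0 < n)%N, w = u ++ v & v ++ u = flatten (nseq n whole_word)].
Proof.
move=> w0 gw; have fcw u v : w = u ++ v -> fcycle next_corner (v ++ u).
  move=> wuv; move: gw; rewrite wuv (perm_all _ (arcs_rot u v)).
  case: (v ++ u) => // x p; rewrite arcs_cons all_rcons /= rcons_path => /andP[lx sx].
  have step a : glued a && inrange a -> next_corner a.1 = a.2.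
    case: a => [[[] i] [[] j]] //=; rewrite /glued /next_corner /=.
      by move=> /andP[/eqP ->].
    by move=> /andP[/eqP ->].
  have /= -> := step (_, _) lx; rewrite eqxx andbT; elim: p x sx {lx} => //= y p IHp x.
  by rewrite /steps /= => /andP[sy /IHp ->]; have /= -> := step (_, _) sy; rewrite eqxx.
have [v0 v0w] : exists v, v \in w by case: (w) w0 => // v ? _; exists v; rewrite mem_head.
have fcw0 : fcycle next_corner w by have := fcw [::] w erefl; rewrite cats0.
have v0N : (v0.2 < N)%N.
  have : v0 \in map fst (arcs w).
    by rewrite /arcs -/(unzip1 _) unzip1_zip // size_rot.
  by move=> /mapP[a /(allP gw)/andP[_ /andP[aN _]] ->].
have itw i : iter i next_corner v0 \in w.
  elim: i => //= i IHi; have -> : next_corner (iter i next_corner v0) = next w (iter i next_corner v0).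
    by apply/eqP; exact: (next_cycle fcw0 IHi).
  by rewrite mem_next.
have w00 : (false, 0%N) \in w.
  have : (false, v0.2) \in w \/ (false, v0.2.+1 %% N)%N \in w.
    by case: v0 {v0N} v0w itw => -[] k kw /(_ 1%N); [right|left].
  have H2 k : (k < N)%N -> (false, k) \in w -> (false, 0%N) \in w.
    move=> kN; elim: {k}(N - k)%N {-2}k (erefl (N - k)%N) kN => [k|n IHn k nE kN kw]; first by lia.
    have kw2 : (false, k.+1 %% N)%N \in w.
      have H3 v : v \in w -> next_corner v \in w.
        move=> vw; have -> : next_corner v = next w v by apply/eqP; exact: (next_cycle fcw0 vw).
        by rewrite mem_next.
      exact: (H3 _ (H3 _ kw)).
    move: kw2; have [->|kN2] := eqVneq k.+1 N; first by rewrite modnn.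
    by rewrite modn_small; [apply: IHn; lia|lia].
  by case=> h; apply: H2 h; rewrite ?ltn_mod.
have [u [v wuv]] : exists u v, w = u ++ (false, 0%N) :: v.
  by case/splitPr: w00 => u v; exists u, v.
have := fcw u _ wuv; set w' := _ ++ u => fc'.
have /fpathP[n' wE] : fpath next_corner (false, 0%N) (rcons (v ++ u) (false, 0%N)) by [].
have nE : n' = (size (v ++ u)).+1 by have := congr1 size wE; rewrite size_rcons size_traject.
have tw : w' = traject next_corner (false, 0%N) n'.
  move: wE; rewrite {1}nE trajectSr => /rcons_inj[e1 _].
  by rewrite /w' cat_cons e1 nE.
have itn : iter n' next_corner (false, 0%N) = (false, 0%N).
  move: wE; rewrite nE trajectSr => /rcons_inj[_ e2].
  by rewrite iterSr -e2.
have [q nq] : exists q, n' = (q * N).*2.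
  move: itn; rewrite iter_next // add0n => -[odn /eqP dv].
  have /dvdnP[q qE] : (N %| n'./2)%N by exact: dv.
  by exists q; rewrite -qE -[LHS]odd_double_half odn.
exists q, u, ((false, 0%N) :: v); split=> //.
  by rewrite lt0n; apply: contra_eq_neq nE => q0; rewrite nq q0.
rewrite -/w' tw nq {wE nE tw itn nq}; elim: q => //= q IHq.
have ww : whole_word = traject next_corner (false, 0%N) N.*2 by rewrite traject_next.
rewrite mulSn doubleD traject_add -ww; congr (_ ++ _).
by rewrite iter_next // odd_double doubleK add0n modnn.
Qed.
End Gluing.

(** * Linear programming duality *)

Section Farkas.
Variable F : realFieldType.

Section Cone.
Variable I : finType.
Implicit Types (a b y : I -> F) (s : seq (I -> F)).

Definition dot y b := \sum_i y i * b i.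

Lemma dotDr y b b' k : dot y (fun i => b i + k * b' i) = dot y b + k * dot y b'.
Proof. by rewrite /dot mulr_sumr -big_split; apply: eq_bigr => i _ /=; ring. Qed.

Lemma dotDl y y' b k : dot (fun i => y i + k * y' i) b = dot y b + k * dot y' b.
Proof. by rewrite /dot mulr_sumr -big_split; apply: eq_bigr => i _ /=; ring. Qed.

Lemma dotZl y b k : dot (fun i => k * y i) b = k * dot y b.
Proof. by rewrite /dot mulr_sumr; apply: eq_bigr => i _ /=; ring. Qed.

(** The cone generated by the vectors of s. *)
Fixpoint incone s b : Prop :=
  if s is a :: s' then exists2 t, 0 <= t & incone s' (fun i => b i - t * a i)
  else forall i, b i = 0.

Lemma eq_incone s b b' : b =1 b' -> incone s b -> incone s b'.
Proof. by move=> /funext ->. Qed.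

(** Unshearing a combination only adds a nonnegative multiple of the direction of
   the shear. *)
Lemma incone_shear s (f : (I -> F) -> F) a b :
  (forall k v, v = nth a s k -> (k < size s)%N -> 0 <= f v) ->
  incone [seq (fun i => v i + f v * a i) | v <- s] b ->
  exists2 k, 0 <= k & incone s (fun i => b i - k * a i).
Proof.
elim: s b => [|v s IHs] b f0 /=.
  by exists 0 => // i; rewrite mul0r subr0.
move=> [t t0 /IHs[k w vE|k k0 cs]]; first by apply: (f0 k.+1).
exists (k + t * f v); first by rewrite addr_ge0 // mulr_ge0 // (f0 0%N).
by exists t => //; apply: eq_incone cs => i; ring.
Qed.

(** Farkas' lemma, by induction on the number of generators: if a separating
   form for the first ones is negative on the last one, all other vectors are
   sheared along that one into the kernel of the form (Bartl's proof). *)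
Lemma farkas_cone s b : incone s b \/
  exists y, (forall a0 k, (k < size s)%N -> 0 <= dot y (nth a0 s k)) /\ dot y b < 0.
Proof.
move: {2}(size s) (leqnn (size s)) b => n; elim: n s => [|n IHn] [|a s] //= les b.
1,2: have [b0|/existsNP[i bi]] := pselect (forall i, b i = 0); [by left|right].
1,2: exists (fun j => if j == i then - b i else 0); split=> //.
1,2: rewrite /dot (bigD1 i) //= eqxx big1 ?addr0 => [|j /negbTE ->]; last by rewrite mul0r.
1,2: by rewrite mulNr oppr_lt0 -expr2 exprn_even_gt0 //=; apply/eqP.
have [cs|[y0 [y0s y0b]]] := IHn s les b.
  by left; exists 0 => //; apply: eq_incone cs => i; rewrite mul0r subr0.
have [ya|ya] := leP 0 (dot y0 a).
  by right; exists y0; split=> // a0 [|k] //=; exact: y0s.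
pose y i := (- dot y0 a)^-1 * y0 i.
have yE v : dot y v = (- dot y0 a)^-1 * dot y0 v by exact: dotZl.
have inv0 : 0 < (- dot y0 a)^-1 by rewrite invr_gt0 oppr_gt0.
have ya1 : dot y a = -1.
  by rewrite yE invrN mulNr mulVf // lt_eqF.
have yb : dot y b < 0 by rewrite yE pmulr_rlt0.
have ys a0 k : (k < size s)%N -> 0 <= dot y (nth a0 s k).
  by move=> /y0s ks; rewrite yE pmulr_rge0.
pose sh v i := v i + dot y v * a i.
have [|cs|[z [zs zb]]] := IHn [seq sh v | v <- s] _ (sh b); first by rewrite size_map.
  left; have [|k k0 {}cs] := incone_shear _ cs; first by move=> k v ->; exact: ys.
  exists (k - dot y b); first by rewrite subr_ge0 (le_trans (ltW yb)).
  by apply: eq_incone cs => i; rewrite /sh; ring.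
right; exists (fun i => z i + dot z a * y i); split; last first.
  by rewrite dotDl; move: zb; rewrite /sh dotDr mulrC.
move=> a0 [|k] /= kn; first by rewrite dotDl ya1 mulrN1 subrr.
have := zs (sh a0) k; rewrite size_map => /(_ kn).
by rewrite (nth_map a0) // /sh dotDr dotDl mulrC.
Qed.
End Cone.

Lemma incone_coef (I J : finType) (A : J -> I -> F) (r : seq J) b :
  uniq r -> incone [seq A j | j <- r] b ->
  exists2 x : J -> F, (forall j, 0 <= x j) & forall i, \sum_(j <- r) x j * A j i = b i.
Proof.
elim: r b => [|j r IHr] b /=; first by move=> _ b0; exists (fun=> 0) => // i; rewrite big_nil b0.
move=> /andP[jr ur] [t t0 /(IHr _ ur)[x x0 xE]].
exists (fun k => if k == j then t else x k) => [k|i]; first by case: ifP.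
rewrite big_cons eqxx big_seq (eq_bigr (fun k => x k * A k i)) => [|k kr].
  by rewrite -big_seq xE addrC subrK.
by case: eqP => // kj; rewrite -kj kr in jr.
Qed.

Lemma farkas (I J : finType) (A : J -> I -> F) (b : I -> F) :
  (exists2 x : J -> F, (forall j, 0 <= x j) & forall i, \sum_j x j * A j i = b i) \/
  (exists2 y : I -> F, (forall j, 0 <= \sum_i y i * A j i) & \sum_i y i * b i < 0).
Proof.
have [cs|[y [ys yb]]] := farkas_cone [seq A j | j <- enum J] b.
  have [x x0 xE] := incone_coef (enum_uniq J) cs; left; exists x => // i.
  by rewrite -xE big_enum.
right; exists y => // j; have := ys (A j) (index j (enum J)).
by rewrite size_map index_mem mem_enum (nth_map j) ?index_mem ?mem_enum // nth_index ?mem_enum //; exact.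
Qed.

Section Duality.
Variables (R W : finType) (A : R -> W -> F) (b : R -> F) (c : W -> F).

Definition primal_feas (x : W -> F) :=
  (forall w, 0 <= x w) /\ forall r, \sum_w A r w * x w = b r.
Definition dual_feas (y : R -> F) := forall w, c w <= \sum_r y r * A r w.

Lemma weak_duality x y : primal_feas x -> dual_feas y ->
  \sum_w c w * x w <= \sum_r y r * b r.
Proof.
move=> [x0 xE] yc; rewrite (eq_bigr (fun r => \sum_w y r * (A r w * x w))); last first.
  by move=> r _; rewrite -xE mulr_sumr.
rewrite exchange_big /=; apply: ler_sum => w _.
rewrite (eq_bigr (fun r => y r * A r w * x w)) => [|r _]; last by rewrite mulrA.
by rewrite -mulr_suml ler_wpM2r.
Qed.

(** The optimality conditions form one linear system; a certificate that it has
   no solution would, after scaling, violate weak duality. *)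
Lemma strong_duality x0 y0 : primal_feas x0 -> dual_feas y0 ->
  exists x y, [/\ primal_feas x, dual_feas y & \sum_w c w * x w = \sum_r y r * b r].
Proof.
move=> x0P y0P.
pose I : finType := (R + W + unit)%type.
pose J : finType := (W + W + (R + R + unit))%type.
pose M (j : J) (i : I) : F := match j, i with
  | inl (inl w), inl (inl r) => A r w
  | inl (inl w), inr _ => c w
  | inl (inr w), inl (inr w') => - (w == w')%:R
  | inr (inl (inl r)), inl (inr w) => A r w
  | inr (inl (inl r)), inr _ => - b r
  | inr (inl (inr r)), inl (inr w) => - A r w
  | inr (inl (inr r)), inr _ => b r
  | inr (inr _), inr _ => -1
  | _, _ => 0 end.
pose t (i : I) : F := match i with
  | inl (inl r) => b r | inl (inr w) => c w | inr _ => 0 end.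
have sumI (f : I -> F) : \sum_i f i =
    \sum_r f (inl (inl r)) + \sum_w f (inl (inr w)) + f (inr tt).
  rewrite big_sumType big_sumType /=; congr (_ + _).
  by rewrite (bigD1 tt) //= big1 ?addr0 // => -[].
have sumJ (f : J -> F) : \sum_j f j =
    \sum_w f (inl (inl w)) + \sum_w f (inl (inr w)) +
    (\sum_r f (inr (inl (inl r))) + \sum_r f (inr (inl (inr r))) + f (inr (inr tt))).
  rewrite !big_sumType /=; congr (_ + (_ + _)).
  by rewrite (bigD1 tt) //= big1 ?addr0 // => -[].
have zsum (K : finType) (f : K -> F) : \sum_k f k * 0 = 0.
  by rewrite big1 // => k _; rewrite mulr0.
have dsum (f : W -> F) w : \sum_w' f w' * - (w' == w)%:R = - f w.
  rewrite (bigD1 w) //= eqxx mulrN mulr1 big1 ?addr0 // => w' /negbTE ->.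
  by rewrite oppr0 mulr0.
have dsum' (f : W -> F) w : \sum_w' f w' * - (w == w')%:R = - f w.
  by rewrite -dsum; apply: eq_bigr => w' _; rewrite eq_sym.
have [[x xge0 xE]|[y yM yt]] := farkas M t.
  pose X w := x (inl (inl w)).
  pose Y r := x (inr (inl (inl r))) - x (inr (inl (inr r))).
  have XP : primal_feas X.
    split=> [w|r]; first exact: xge0.
    have := xE (inl (inl r)); rewrite sumJ /= !zsum mulr0 !addr0 => <-.
    by apply: eq_bigr => w _; rewrite mulrC.
  have YP : dual_feas Y.
    move=> w; have := xE (inl (inr w)); rewrite sumJ /= !zsum dsum mulr0 addr0 add0r => <-.
    rewrite -subr_ge0; have -> : \sum_r Y r * A r w =
      \sum_r x (inr (inl (inl r))) * A r w + \sum_r x (inr (inl (inr r))) * - A r w.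
      by rewrite -big_split; apply: eq_bigr => r _; rewrite /Y /=; ring.
    by rewrite opprD opprK addrCA subrr addr0.
  exists X, Y; split=> //; apply/eqP; rewrite eq_le weak_duality //=.
  have := xE (inr tt); rewrite sumJ /= !zsum addr0 => e.
  have -> : \sum_r Y r * b r =
      - (\sum_r x (inr (inl (inl r))) * - b r + \sum_r x (inr (inl (inr r))) * b r).
    by rewrite -big_split -sumrN; apply: eq_bigr => r _; rewrite /Y /=; ring.
  have -> : \sum_w c w * X w = \sum_w x (inl (inl w)) * c w.
    by apply: eq_bigr => w _; rewrite mulrC.
  have := xge0 (inr (inr tt)); lra.
exfalso; pose p r := y (inl (inl r)); pose q w := - y (inl (inr w)); pose S := - y (inr tt).
have pA w : S * c w <= \sum_r p r * A r w.
  by have := yM (inl (inl w)); rewrite sumI /= zsum addr0 /S /p; lra.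
have q0 w : 0 <= q w.
  have := yM (inl (inr w)); rewrite sumI /= zsum add0r mulr0 addr0 dsum'.
  by [].
have qA r : \sum_w A r w * q w = S * b r.
  have e : \sum_w A r w * q w = - \sum_w y (inl (inr w)) * A r w.
    by rewrite -sumrN; apply: eq_bigr => w _; rewrite /q; ring.
  have e' : \sum_w y (inl (inr w)) * - A r w = - \sum_w y (inl (inr w)) * A r w.
    by rewrite -sumrN; apply: eq_bigr => w _; ring.
  have := yM (inr (inl (inl r))); have := yM (inr (inl (inr r))).
  rewrite !sumI /= !zsum e' e /S; lra.
have S0 : 0 <= S.
  by have := yM (inr (inr tt)); rewrite sumI /= !zsum /S; lra.
have lt_pq : \sum_r p r * b r < \sum_w c w * q w.
  have e : \sum_w c w * q w = - \sum_w y (inl (inr w)) * c w.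
    by rewrite -sumrN; apply: eq_bigr => w _; rewrite /q; ring.
  by move: yt; rewrite sumI /= mulr0 addr0 e /p; lra.
have [S1|S1] := eqVneq S 0.
  have [x0ge0 x0E] := x0P.
  have h1 : 0 <= \sum_r p r * b r.
    rewrite (eq_bigr (fun r => \sum_w p r * A r w * x0 w)); last first.
      by move=> r _; rewrite -x0E mulr_sumr; apply: eq_bigr => w _; ring.
    rewrite exchange_big sumr_ge0 //= => w _; rewrite -mulr_suml mulr_ge0 //.
    by apply: le_trans (pA w); rewrite S1 mul0r.
  have h2 : \sum_w c w * q w <= 0.
    apply: (@le_trans _ _ (\sum_w (\sum_r y0 r * A r w) * q w)).
      by apply: ler_sum => w _; rewrite ler_wpM2r.
    rewrite (eq_bigr (fun w => \sum_r y0 r * (A r w * q w))); last first.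
      by move=> w _; rewrite mulr_suml; apply: eq_bigr => r _; ring.
    rewrite exchange_big big1 //= => r _; rewrite -mulr_sumr qA S1 mul0r mulr0 //.
  by have := lt_le_trans (le_lt_trans h1 lt_pq) h2; rewrite ltxx.
have S2 : 0 < S by rewrite lt_def S1.
have := @weak_duality (fun w => S^-1 * q w) (fun r => S^-1 * p r) _ _.
have scale (K : finType) (f g : K -> F) : \sum_k f k * (S^-1 * g k) = S^-1 * \sum_k f k * g k.
  by rewrite mulr_sumr; apply: eq_bigr => k _; ring.
have scale' (K : finType) (f g : K -> F) : \sum_k S^-1 * f k * g k = S^-1 * \sum_k f k * g k.
  by rewrite mulr_sumr; apply: eq_bigr => k _; ring.
have SV : 0 < S^-1 by rewrite invr_gt0.
rewrite scale scale' ler_pM2l // leNgt lt_pq => H.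
suff : false by []; apply: H.
  split=> [w|r]; first by rewrite mulr_ge0 // ltW.
  by rewrite scale qA mulKf.
by move=> w; rewrite scale' -(ler_pM2l S2) mulVKf.
Qed.
End Duality.
End Farkas.

(** * From closed walks to products of commutators *)

Section IntegerPowers.
Local Open Scope group_scope.
Variable G : groupType.
Implicit Types (g h x : G) (k : int).

Definition gz g k : G := match k with Posz n => g ^+ n | Negz n => (g ^+ n.+1)^-1 end.

Lemma gzN g k : gz g (- k)%R = (gz g k)^-1.
Proof.
case: k => [[|n]|n]; first by rewrite oppr0 /= invg1.
  by rewrite -NegzE.
by rewrite NegzE opprK /= invgK.
Qed.

Lemma gzS g k : gz g (k + 1)%R = gz g k * g.
Proof.
case: k => [n|[|n]]; first by rewrite -PoszD addn1 /= expgSr.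
  by rewrite /= mulVg.
have -> : (Negz n.+1 + 1 = Negz n)%R by rewrite !NegzE; lia.
by rewrite /= [X in _ = X^-1 * _]expgS invgM mulgVK.
Qed.

Lemma gzB1 g k : gz g (k - 1)%R = gz g k * g^-1.
Proof. by rewrite -[X in gz g X * _](subrK 1%R k) gzS mulgK. Qed.

Lemma gzD g k j : gz g (k + j)%R = gz g k * gz g j.
Proof.
elim/int_rec: j => [|n IHn|n IHn]; first by rewrite addr0 mulg1.
  by rewrite intS addrCA addrC gzS IHn [(1 + _)%R]addrC gzS mulgA.
by rewrite -addn1 PoszD opprD addrA gzB1 IHn gzB1 mulgA.
Qed.

Lemma gzX g k n : gz g k ^+ n = gz g (k * n%:Z)%R.
Proof.
elim: n => [|n IHn]; first by rewrite mulr0.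
by rewrite expgSr IHn -gzD intS mulrDr mulr1 addrC.
Qed.

Lemma gzJ g k x : gz g k ^ x = gz (g ^ x) k.
Proof. by case: k => n /=; rewrite ?conjVg conjXg. Qed.

Lemma gz_gz g k j : gz (gz g k) j = gz g (k * j)%R.
Proof.
by case: j => n; rewrite /= gzX // NegzE mulrN gzN.
Qed.

Lemma commute_gz g h k : commute g h -> commute g (gz h k).
Proof. by move=> gh; case: k => n /=; [|apply: commuteV]; apply: commuteX. Qed.

Lemma prod_gz (I : Type) (s : seq I) (f : I -> int) g :
  \prod_(i <- s) gz g (f i) = gz g (\sum_(i <- s) f i)%R.
Proof. by elim: s => [|i s IHs]; rewrite ?big_nil // !big_cons IHs gzD. Qed.
End IntegerPowers.

Lemma arcs_map (T S : Type) (f : T -> S) (w : seq T) :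
  arcs (map f w) = [seq (f a.1, f a.2) | a <- arcs w].
Proof.
rewrite /arcs -map_rot; elim: w (rot 1 w) => [|x w IHw] [|y v] //=.
by rewrite IHw.
Qed.

Lemma size_arcs (T : Type) (w : seq T) : size (arcs w) = size w.
Proof. by rewrite size1_zip // size_rot. Qed.

Lemma mem_arcs (T : eqType) (w : seq T) a : a \in arcs w -> a.1 \in w /\ a.2 \in w.
Proof.
move=> aw; have h1 := map_f fst aw; have h2 := map_f snd aw.
rewrite -/(unzip1 _) unzip1_zip ?size_rot // in h1.
by rewrite -/(unzip2 _) unzip2_zip ?size_rot // mem_rot in h2.
Qed.

Section UpperBound.
Local Open Scope group_scope.
Variables m l : int.
Hypotheses (m0 : m != 0%R) (l0 : l != 0%R).
Local Notation G := (BS m l).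

Definition gen_a : G := bs_eval m l [:: (false, false)].
Definition gen_t : G := bs_eval m l [:: let_t false].
Definition gen_b : G := gen_a ^ gen_t^-1.

Lemma bs_eval_nseq u n : bs_eval m l (nseq n u) = bs_eval m l [:: u] ^+ n.
Proof.
elim: n => [|n IHn]; first by rewrite bs_eval1.
by rewrite -[nseq n.+1 u]/([:: u] ++ nseq n u) bs_evalM IHn expgS.
Qed.

Lemma bs_eval_letV x e : bs_eval m l [:: (x, ~~ e)] = (bs_eval m l [:: (x, e)])^-1.
Proof. by rewrite -bs_evalV. Qed.

Lemma bs_eval_pow k : bs_eval m l (a_pow k) = gz gen_a k.
Proof.
rewrite /a_pow bs_eval_nseq; case: k => n //.
by rewrite (_ : (Negz n < 0)%R = ~~ false) // bs_eval_letV -/gen_a expVgn.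
Qed.

Lemma bs_relation : gz gen_b m = gz gen_a l.
Proof.
rewrite -!gzJ -bs_eval_pow conjgE invgK.
have <- : bs_eval m l (let_t false :: a_pow m ++ [:: let_t true]) = gz gen_a l.
  by rewrite -bs_eval_pow; apply/word_evalP/pres_rel.
rewrite -[let_t false :: _]cat1s !bs_evalM -/gen_t; congr (_ * (_ * _)).
by rewrite -bs_eval_letV.
Qed.

Definition bsK : nat := `|l - m|%N.

Lemma null_conj (g x : G) : null bsK g -> null bsK (g ^ x).
Proof. by move=> gn M; rewrite -conjXg; exact: ncommJ. Qed.

(** Powers of a are stably trivial: every power of a with exponent a multiple
   of l - m is a single commutator. *)
Lemma null_a k : null bsK (gz gen_a k).
Proof.
move=> M; rewrite gzX.
have [i ->] : exists i, (k * (bsK * M)%N%:Z = (l - m) * i)%R.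
  rewrite PoszM /bsK abszE; case: (ger0P (l - m)) => _.
    by exists (k * M%:Z)%R; ring.
  by exists (- (k * M%:Z))%R; ring.
have -> : ((l - m) * i = l * i + - (m * i))%R by ring.
rewrite gzD gzN -gz_gz -bs_relation gz_gz -gzJ conjgE invgK.
have -> : gen_t * (gz gen_a (m * i)%R * gen_t^-1) * (gz gen_a (m * i)%R)^-1 =
    [~ gen_t^-1, (gz gen_a (m * i)%R)^-1] by rewrite commgEl conjgE !invgK !mulgA.
exact: ncomm1.
Qed.

Lemma null_b k : null bsK (gz gen_b k).
Proof. by rewrite -gzJ; apply: null_conj; exact: null_a. Qed.

(** The subgroup generated by zeta = a^l = (t a t^-1)^m, and the centralizer of
   zeta, which contains a and t a t^-1. *)
Definition bsZ (z : G) := exists i : int, z = gz gen_a (l * i)%R.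
Definition bsH (h : G) := commute h (gz gen_a l).

Lemma bsZM x y : bsZ x -> bsZ y -> bsZ (x * y).
Proof. by move=> [i ->] [j ->]; exists (i + j)%R; rewrite -gzD mulrDr. Qed.

Lemma bsZnull z : bsZ z -> null bsK z.
Proof. by move=> [i ->]; exact: null_a. Qed.

Lemma bsZH z h : bsZ z -> bsH h -> commute z h.
Proof. by move=> [i ->] hH; apply/commute_sym; rewrite -gz_gz; exact: commute_gz. Qed.

Lemma bsH1 : bsH 1. Proof. exact/commute_sym/commute1. Qed.

Lemma bsHM x y : bsH x -> bsH y -> bsH (x * y).
Proof. by move=> xH yH; apply/commute_sym/commuteM; apply/commute_sym. Qed.

Lemma bsH_a k : bsH (gz gen_a k).
Proof. by apply/commute_gz/commute_sym/commute_gz. Qed.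

Lemma bsH_b k : bsH (gz gen_b k).
Proof. by rewrite /bsH -bs_relation; apply/commute_gz/commute_sym/commute_gz. Qed.

Variable zz : turns.
Local Notation N := (size zz).

Definition corner_val (v : bool * nat) : G :=
  if v.1 then gz gen_a (yexp zz v.2) else gz gen_b (xexp zz v.2).

Lemma bsH_corner v : bsH (corner_val v).
Proof. by rewrite /corner_val; case: ifP => _; [exact: bsH_a|exact: bsH_b]. Qed.

Definition alt_elt : G := \prod_(c <- zz) (gz gen_b c.1 * gz gen_a c.2).

Lemma ev_whole : ev corner_val (whole_word N) = alt_elt.
Proof.
rewrite /ev /whole_word big_flatten big_map /alt_elt.
rewrite -{2}(mkseq_nth (0, 0)%R zz) /mkseq big_map; apply: eq_bigr => k _.
by rewrite big_cons big_seq1.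
Qed.

(** A solution of the linear program scaled by n and written as a list of closed
   walks: the sides of the two colours match, and each corner is used n times. *)
Definition primal_ok n (PX PY : seq (seq nat)) :=
  [&& (0 < n)%N, all (fun w => (w != [::]) && all (fun k => k < N)%N w) (PX ++ PY),
    perm_eq (flatten (map (@arcs _) PX))
      [seq (a.2, a.1.+1 %% N)%N | a <- flatten (map (@arcs _) PY)]
    & all (fun k => count_mem k (flatten PX) == n) (iota 0 N)].

Definition ndiscs PX PY := (count (discX m zz) PX + count (discY l zz) PY)%N.

Lemma size_flatten_arcs (P : seq (seq nat)) : size (flatten (map (@arcs _) P)) = size (flatten P).
Proof. by elim: P => //= w P IHP; rewrite !size_cat IHP size_arcs. Qed.

Lemma size_visits n (s : seq nat) : all (fun k => k < N)%N s ->
  all (fun k => count_mem k s == n) (iota 0 N) -> size s = (n * N)%N.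
Proof.
move=> sN cs; rewrite -sum1_size.
transitivity (\sum_(i <- s) \sum_(k < N) (i == k :> nat))%N.
  rewrite big_seq [RHS]big_seq; apply: eq_bigr => i /(allP sN) iN.
  rewrite (bigD1 (Ordinal iN)) //= eqxx big1 // => k ki.
  by case: eqP => // e; case/eqP: ki; exact/val_inj.
rewrite exchange_big /= (eq_bigr (fun=> n)) => [|k _].
  by rewrite sum_nat_const card_ord mulnC.
rewrite -(eqP (allP cs k _)) ?mem_iota //=; by rewrite -sum1_count [RHS]big_mkcond.
Qed.

(** As the word is reduced, a disc has at least two corners, and the polygons of
   each colour have n N corners in all. *)
Lemma ndiscs_le n PX PY : (0 < N)%N -> reduced m l zz -> primal_ok n PX PY ->
  (ndiscs PX PY <= n * N)%N.
Proof.
move=> N0 red /and4P[n0 Pall Pperm Pn].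
have redX k : (k < N)%N -> ~~ (m %| xexp zz k)%Z && ~~ (l %| yexp zz k)%Z.
  by move=> kN; apply: (allP red); rewrite mem_nth.
have sX : size (flatten PX) = (n * N)%N.
  apply: size_visits => //; apply/allP => k /flattenP[w wP kw].
  by have /andP[_ /allP] := allP Pall w (etrans (mem_cat _ _ _) (introT orP (or_introl wP))); exact.
have sY : size (flatten PY) = (n * N)%N.
  by rewrite -size_flatten_arcs -sX -size_flatten_arcs (perm_size Pperm) size_map.
have H (d : pred (seq nat)) P : (forall w, w \in P -> w != [::]) ->
    (forall w k, w \in P -> w = [:: k] -> ~~ d w) -> ((count d P).*2 <= size (flatten P))%N.
  elim: P => //= w P IHP P0 P1; rewrite size_cat doubleD leq_add //; last first.
    apply: IHP => [v vP|v k vP]; first by apply: P0; rewrite inE vP orbT.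
    by apply: P1; rewrite inE vP orbT.
  have := P0 w (mem_head _ _); have := P1 w^~ (mem_head _ _); clear.
  case: w => [|k [|j w]] //= h; first by rewrite (negbTE (h k erefl)).
  by case: (d _).
have P0 w : w \in PX ++ PY -> w != [::] /\ forall k, w = [:: k] -> (k < N)%N.
  by move=> /(allP Pall)/andP[-> wN]; split=> // k wE; move: wN; rewrite wE /= andbT.
have hX : ((count (discX m zz) PX).*2 <= n * N)%N.
  rewrite -sX; apply: H => [w wP|w k wP wE].
    by have [] := P0 w; rewrite ?mem_cat ?wP.
  have [|_ /(_ k wE) kN] := P0 w; first by rewrite mem_cat wP.
  by rewrite wE /discX big_seq1; have /andP[] := redX k kN.
have hY : ((count (discY l zz) PY).*2 <= n * N)%N.
  rewrite -sY; apply: H => [w wP|w k wP wE].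
    by have [] := P0 w; rewrite ?mem_cat ?wP ?orbT.
  have [|_ /(_ k wE) kN] := P0 w; first by rewrite mem_cat wP orbT.
  by rewrite wE /discY big_seq1; have /andP[] := redX k kN.
by rewrite /ndiscs -leq_double doubleD -[(n * N).*2]addnn leq_add.
Qed.

(** Gluing the n N pairs of sides leaves curves that are powers of the element,
   of total exponent n.  If none of them still bounds a disc, this is a filling
   of the right Euler characteristic; otherwise a power of the element is
   conjugate into the group of zeta, and its commutator length is bounded. *)
Lemma upper_bound n PX PY : (0 < N)%N -> reduced m l zz -> primal_ok n PX PY ->
  exists n0 C, (0 < n0)%N /\ forall M, exists c, ncomm c (alt_elt ^+ (n0 * (bsK * M))) /\
    (n * c.*2 <= (n * N - ndiscs PX PY) * (n0 * (bsK * M)) + C)%N.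
Proof.
move=> N0 red Pok; have le_nd := ndiscs_le N0 red Pok.
case/and4P: Pok => n0 Pall Pperm Pn.
pose WX := [seq map (pair false) w | w <- PX]; pose WY := [seq map (pair true) w | w <- PY].
have colE b (P : seq (seq nat)) : flatten (map (@arcs _) [seq map (pair b) w | w <- P]) =
    [seq ((b, a.1), (b, a.2)) | a <- flatten (map (@arcs _) P)].
  rewrite map_flatten -!map_comp; congr flatten; apply: eq_map => w /=.
  exact: arcs_map.
have flE b (P : seq (seq nat)) : flatten [seq map (pair b) w | w <- P] = map (pair b) (flatten P).
  by rewrite map_flatten.
have PN w k : w \in PX ++ PY -> k \in w -> (k < N)%N.
  by move=> /(allP Pall)/andP[_ /allP wN] /wN.
pose ws := WX ++ WY.
have ws0 : all (fun w => w != [::]) ws.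
  apply/allP => w; rewrite mem_cat => /orP[] /mapP[v vP ->].
    by have /andP[] := allP Pall v (etrans (mem_cat _ _ _) (introT orP (or_introl vP))); case: v {vP}.
  by have /andP[] := allP Pall v (etrans (mem_cat _ _ _) (introT orP (or_intror vP))); case: v {vP}.
have arcN P a : {subset P <= PX ++ PY} -> a \in flatten (map (@arcs _) P) ->
    (a.1 < N)%N /\ (a.2 < N)%N.
  move=> PP /flatten_mapP[w wP /mem_arcs[h1 h2]].
  by split; apply: PN (PP w wP) _.
have wsA : flatten (map (@arcs _) ws) =
    [seq ((false, a.1), (false, a.2)) | a <- flatten (map (@arcs _) PX)] ++
    [seq ((true, a.1), (true, a.2)) | a <- flatten (map (@arcs _) PY)].
  by rewrite map_cat flatten_cat !colE.
have sX w : w \in PX -> w \in PX ++ PY by rewrite mem_cat => ->.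
have sY w : w \in PY -> w \in PX ++ PY by rewrite mem_cat => ->; rewrite orbT.
have ma : matched N (flatten (map (@arcs _) ws)).
  rewrite wsA; split.
  - by rewrite all_cat; apply/andP; split; apply/allP => _ /mapP[a _ ->].
  - rewrite all_cat; apply/andP; split; apply/allP => _ /mapP[a aP ->]; rewrite /inrange /=.
      by have [-> ->] := arcN PX a sX aP.
    by have [-> ->] := arcN PY a sY aP.
  - move=> i k iN kN; rewrite !count_cat !count_map.
    have c0 (T : eqType) (p : pred T) s : (forall x, p x = false) -> count p s = 0%N.
      by move=> p0; rewrite (eq_count (a2 := pred0)) ?count_pred0.
    rewrite [X in (_ + X)%N]c0 // [in RHS]c0 // addn0 add0n.
    have -> : count (preim (fun a => ((false, a.1), (false, a.2)))
        (pred1 ((false, k), (false, i.+1 %% N)%N))) (flatten (map (@arcs _) PX)) =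
        count_mem (k, i.+1 %% N)%N (flatten (map (@arcs _) PX)).
      by apply: eq_count => -[x y] /=; rewrite !xpair_eqE.
    rewrite (seq.permP Pperm) count_map; apply: eq_in_count => -[x y] aP /=.
    have [/= xN yN] := arcN PY _ sY aP; rewrite !xpair_eqE /= andbC; congr (_ && _).
    by apply/eqP/eqP => [/succ_mod_inj->|->].
have wsred : count redarc (flatten (map (@arcs _) ws)) = (n * N)%N.
  rewrite wsA count_cat !count_map (eq_count (a2 := predT)) // count_predT.
  rewrite (eq_count (a2 := pred0)) // count_pred0 addn0 size_flatten_arcs.
  apply: size_visits => //; apply/allP => k /flattenP[w wP kw]; exact: PN (sX w wP) kw.
have sf : surf bsK bsZ (ndiscs PX PY)%:Z (map (ev corner_val) ws).
  pose ts := [seq (discX m zz w, ev corner_val (map (pair false) w)) | w <- PX] ++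
    [seq (discY l zz w, ev corner_val (map (pair true) w)) | w <- PY].
  have evX w : ev corner_val (map (pair false) w) = gz gen_b (\sum_(k <- w) xexp zz k)%R.
    by rewrite /ev big_map prod_gz.
  have evY w : ev corner_val (map (pair true) w) = gz gen_a (\sum_(k <- w) yexp zz k)%R.
    by rewrite /ev big_map prod_gz.
  have -> : map (ev corner_val) ws = map snd ts.
    by rewrite !map_cat -!map_comp; congr (_ ++ _); apply: eq_map.
  have -> : ndiscs PX PY = count fst ts by rewrite count_cat !count_map.
  apply: surf_null => t; rewrite mem_cat => /orP[] /mapP[w wP ->] /=.
  - by move=> /dvdzP[i iE]; exists i; rewrite evX iE [(i * m)%R]mulrC -(gz_gz gen_b m) bs_relation gz_gz.
  - by move=> /dvdzP[i iE]; exists i; rewrite evY iE; congr gz; exact: mulrC.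
  - by rewrite evX; exact: null_b.
  - by rewrite evY; exact: null_a.
have [ws' [ws'0 ws'f ws'g sf']] :=
  glue bsZM bsZnull bsZH bsH1 bsHM bsH_corner ws0 ma sf.
have {ws'g} pow w : w \in ws' -> exists x,
    ev corner_val w = (alt_elt ^+ count_mem (false, 0%N) w) ^ x
    /\ (0 < count_mem (false, 0%N) w)%N.
  move=> ww; have gw : all (fun a => glued N a && inrange N a) (arcs w).
    by apply/allP => a aw; apply: (allP ws'g); apply/flatten_mapP; exists w.
  have [q [u [v [q0 wE vuE]]]] := glued_power N0 (allP ws'0 w ww) gw.
  have qE : count_mem (false, 0%N) w = q.
    rewrite wE count_cat addnC -count_cat vuE.
    have : count_mem (false, 0%N) (whole_word N) = 1%N.
      rewrite /whole_word; case: (N) N0 => // N' _; rewrite /=.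
      rewrite (eq_in_count (a2 := pred0)) ?count_pred0 // => c /flatten_mapP[k].
      rewrite mem_iota => /andP[k0 _]; rewrite !inE => /orP[]/eqP -> //=.
      by case: k k0.
    move=> c1; elim: {q0 vuE}q => //= q IHq; by rewrite count_cat IHq c1.
  exists (ev corner_val u)^-1; rewrite qE; split=> //.
  have evq : ev corner_val (v ++ u) = alt_elt ^+ q.
    rewrite vuE -ev_whole; elim: {q0 qE vuE}q => [|q IHq]; first by rewrite /ev big_nil.
    by rewrite /= ev_cat IHq expgS.
  by rewrite -evq !ev_cat conjgE invgK wE ev_cat !mulgA mulgK.
have nE : count_mem (false, 0%N) (flatten ws') = n.
  rewrite (seq.permP ws'f) /ws flatten_cat !flE count_cat !count_map.
  rewrite [X in (_ + X)%N](eq_count (a2 := pred0)) // count_pred0 addn0.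
  by rewrite -(eqP (allP Pn 0%N _)) ?mem_iota.
case: sf' => ts [q [tsE tsZ fl le_q]].
have [/hasP[t tts t1]|/hasPn tsF] := boolP (has fst ts).
(* A disc survives, and a power of the element is stably trivial. *)
  have : t.2 \in map (ev corner_val) ws' by rewrite -tsE map_f.
  move=> /mapP[w ww wE]; have [x [xE c0]] := pow w ww.
  exists (count_mem (false, 0%N) w), (n * 2)%N; split=> // M.
  exists 1%N; split; last exact: leq_addl.
  rewrite expgnA -(conjgK x (alt_elt ^+ _)) -xE -wE.
  by apply: null_conj; apply: bsZnull; exact: tsZ.
have {fl} [C flC] : fills bsK q (map (ev corner_val) ws').
  have -> : map (ev corner_val) ws' = [seq t.2 | t <- ts & ~~ t.1].
    by rewrite -tsE; congr map; apply/esym/all_filterP/allP => t /tsF.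
  exact: fl.
have {le_q} le_q : (q <= n * N - ndiscs PX PY)%N.
  have c0 : count fst ts = 0%N by apply/eqP; rewrite -leqn0 leqNgt -has_count; apply/hasPn.
  by move: le_q; rewrite c0 wsred; move: le_nd; clear; lia.
exists n, (n * (C + (size ws').*2))%N; split=> // M.
have [c [le_c cc]] := flC M; exists (c + size ws')%N; split; last first.
  have h : (c.*2 <= (n * N - ndiscs PX PY) * (bsK * M) + C)%N.
    by apply: leq_trans le_c _; rewrite leq_add2r leq_mul2r le_q orbT.
  rewrite mulnCA -mulnDr leq_mul2l; apply/orP; right.
  by rewrite doubleD addnA leq_add2r.
rewrite addnC; apply: near_ncommM cc; rewrite expgnA -nE.
elim: {sf ws'f tsE flC nE} ws' {ws'0} pow => [|w ws' IHw] pow.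
  by rewrite /= expg1n big_nil; exact: near_refl.
rewrite /= count_cat expgnDr big_cons; have [x [xE _]] := pow w (mem_head _ _).
rewrite expgMn; last by apply: commuteX2.
rewrite -add1n; apply: near_mul; last by apply: IHw => v vw; apply: pow; rewrite inE vw orbT.
by apply: near_sym; rewrite xE -conjXg; exact: near_conj.
Qed.
End UpperBound.

(** * The linear program on closed walks *)

Fixpoint walks (N L : nat) : seq (seq nat) :=
  if L is L'.+1 then [seq k :: w | k <- iota 0 N, w <- [::] :: walks N L'] else [::].

Lemma mem_walks N L w :
  (w \in walks N L) = [&& w != [::], (size w <= L)%N & all (fun k => k < N)%N w].
Proof.
elim: L w => [|L IHL] w; first by rewrite in_nil; case: w.
apply/allpairsP/and3P => [[[k v] [/= kN vL ->]]|].
  rewrite mem_iota add0n /= in kN; rewrite /= kN /=; split=> //.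
    by move: vL; rewrite inE IHL => /orP[/eqP->|/and3P[]].
  by move: vL; rewrite inE IHL => /orP[/eqP->|/and3P[]].
case: w => [|k v] [] //= _ sv /andP[kN vN]; exists (k, v); split=> //=.
  by rewrite mem_iota.
by rewrite inE IHL vN andbT; case: (v == [::]).
Qed.

Lemma rot_iota N : rot 1 (iota 0 N) = [seq i.+1 %% N | i <- iota 0 N]%N.
Proof.
apply: (@eq_from_nth _ 0%N) => [|i]; first by rewrite size_rot size_map.
rewrite size_rot size_iota => iN; rewrite (nth_map 0%N) ?size_iota // nth_iota // add0n.
case: N iN => // N iN; rewrite -[iota 0 N.+1]/(0%N :: iota 1 N) rot1_cons nth_rcons size_iota.
case: ltnP => iN'; first by rewrite nth_iota // modn_small.
by rewrite if_same (_ : i = N) ?modnn //; apply/eqP; rewrite eqn_leq iN' -ltnS iN.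
Qed.

Lemma arcs_same_head (T : eqType) (x : T) p q :
  perm_eq (arcs ((x :: p) ++ x :: q)) (arcs (x :: p) ++ arcs (x :: q)).
Proof. by have := arcs_cat x p x q; rewrite /= !perm_cons. Qed.

Section ShortWalks.
Variables (F : realFieldType) (N L : nat) (d : int) (e : nat -> int).
Variable price : seq nat -> F.
Hypothesis d0 : d != 0.
Hypothesis price_rot : forall u v, price (u ++ v) = price (v ++ u).
Hypothesis price_cat : forall x p q, price ((x :: p) ++ x :: q) = price (x :: p) + price (x :: q).
Hypothesis NL : (N * `|d| <= L)%N.
Let disc (w : seq nat) := (d %| \sum_(k <- w) e k)%Z.
Hypothesis short : forall w, w \in walks N L -> (disc w)%:R <= price w.

(** In a long closed walk some vertex is met twice with the same partial sum
   modulo d; cutting there leaves two shorter closed walks, one of which is a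
   disc while the other one keeps the residue of the whole. *)
Lemma price_all w : w != [::] -> all (fun k => k < N)%N w -> (disc w)%:R <= price w.
Proof.
elim: {w}(size w) {-2}w (leqnn (size w)) => [|n IHn] w; first by case: w.
move=> wn w0 wN; have [wL|wL] := leqP (size w) L.
  by apply: short; rewrite mem_walks w0 wL wN.
pose f i := (nth 0%N w i, `|(\sum_(k <- take i w) e k) %% d|%Z)%N.
have /(uniqPn (0%N, 0%N))[i [j [ij js fij]]] : ~~ uniq (map f (iota 0 (size w))).
  apply/negP => u; have sub : {subset map f (iota 0 (size w)) <= [seq (k, r) | k <- iota 0 N, r <- iota 0 `|d|]}.
    move=> x /mapP[i]; rewrite mem_iota add0n => /= iw ->.
    apply: allpairs_f; rewrite mem_iota /= add0n; first by apply: (allP wN); exact: mem_nth.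
    by rewrite -ltz_nat gez0_abs ?modz_ge0 // ltz_mod.
  have := uniq_leq_size u sub; rewrite size_map size_iota size_allpairs !size_iota.
  by rewrite leqNgt (leq_ltn_trans NL wL).
rewrite size_map size_iota in js; have isz := ltn_trans ij js.
rewrite !(nth_map 0%N) ?size_iota // !nth_iota // !add0n in fij.
case: fij => vE /(congr1 Posz); rewrite !gez0_abs ?modz_ge0 // => rE.
pose u := take i w; pose v := take (j - i) (drop i w); pose r := drop j w.
have wE : w = u ++ v ++ r.
  rewrite /u /v /r -{1}(cat_take_drop i w); congr (_ ++ _).
  by rewrite -{1}(cat_take_drop (j - i) (drop i w)) drop_drop subnK // ltnW.
have uv : take j w = u ++ v by rewrite -{1}(subnKC (ltnW ij)) takeD.
have sv : size v = (j - i)%N by rewrite size_takel // size_drop leq_sub2r // ltnW.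
have [x [p [q [vE' rE']]]] : exists x p q, v = x :: p /\ r = x :: q.
  exists (nth 0%N w i), (behead v), (behead r); split.
    have : head 0%N v = nth 0%N w i.
      by rewrite -nth0 nth_take ?subn_gt0 // nth_drop addn0.
    by case: (v) sv => [|? ?] /=; [move/esym/eqP; rewrite subn_eq0 leqNgt ij|move=> _ ->].
  have : head 0%N r = nth 0%N w i by rewrite vE -nth0 nth_drop addn0.
  have : (0 < size r)%N by rewrite size_drop subn_gt0.
  by case: (r) => //= ? ? _ ->.
have dv : disc v.
  rewrite /disc; move/eqP: rE; rewrite uv big_cat -/u /= eq_sym eqz_mod_dvd.
  by rewrite [X in X - _]addrC addrK.
have dw : disc w = disc (r ++ u).
  rewrite /disc wE !big_cat /= addrCA (rpredDl _ dv).
  by rewrite [X in _ = (d %| X)%Z]addrC.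
have -> : price w = price v + price (r ++ u).
  rewrite wE price_rot -catA vE' rE' price_cat.
  by [].
have sizes : size w = (size u + (size v + size r))%N by rewrite wE !size_cat.
have v_pos : (0 < size v)%N by rewrite vE'.
have r_pos : (0 < size r)%N by rewrite rE'.
have [vN rN] : all (fun k => k < N)%N v /\ all (fun k => k < N)%N (r ++ u).
  by move: wN; rewrite wE !all_cat => /and3P[-> -> ->].
have h1 : 1 <= price v.
  have := IHn v _ _ vN; rewrite dv; apply; last by rewrite vE'.
  by move: wn sizes v_pos r_pos; clear; lia.
have h2 : (disc w)%:R <= price (r ++ u).
  rewrite dw; apply: IHn => //; last by rewrite rE'.
  by rewrite size_cat; move: wn sizes v_pos r_pos; clear; lia.
by rewrite -[X in X <= _]add0r lerD // (le_trans ler01).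
Qed.
End ShortWalks.

Lemma rat_denominator (I : finType) (x : I -> rat) : (forall i, 0 <= x i) ->
  exists n : nat, exists2 f : I -> nat, (0 < n)%N & forall i, (f i)%:R = n%:R * x i.
Proof.
move=> x0; pose n := (\prod_i `|denq (x i)|)%N.
exists n, (fun i => (`|numq (x i)| * \prod_(j | j != i) `|denq (x j)|)%N).
  by rewrite prodn_gt0 // => i; rewrite absz_gt0 denq_neq0.
move=> i /=; rewrite /n [X in _ = X%:R * _](bigD1 i) //= !natrM [RHS]mulrAC; congr (_ * _).
by rewrite !pmulrn absz_denq gez0_abs ?numq_ge0 // numqE mulrC.
Qed.

Section Optimum.
Variables (m l : int) (zz : turns).
Hypotheses (m0 : m != 0) (l0 : l != 0).
Local Notation N := (size zz).
Hypothesis N0 : (0 < N)%N.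
Hypothesis red : reduced m l zz.

(** Beyond this length some corner is met twice with the same partial sum, modulo
   m or modulo l. *)
Definition walk_bound := (N * `|m| + N * `|l|)%N.

Definition arcsY (w : seq nat) := [seq (a.2, a.1.+1 %% N)%N | a <- arcs w].

Lemma sum_arcsY (V : nmodType) (f : nat -> nat -> V) w :
  \sum_(a <- arcsY w) f a.1 a.2 = \sum_(a <- arcs w) f a.2 (a.1.+1 %% N)%N.
Proof. by rewrite big_map. Qed.

Lemma dual_extend (F : realFieldType) (p : nat -> nat -> F) al :
  (forall w, w \in walks N walk_bound ->
    (discX m zz w)%:R <= priceX p al w /\ (discY l zz w)%:R <= priceY zz p w) ->
  dual_feasible m l zz p al.
Proof.
move=> short w w0 wN; split.
  apply: (@price_all F N walk_bound m (xexp zz) (priceX p al)) => //.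
  - by move=> u v; rewrite /priceX (perm_big _ (arcs_rot u v)) !big_cat /= [X in _ + X]addrC.
  - move=> x q r; rewrite /priceX (perm_big _ (arcs_same_head x q r)) !big_cat /=.
    by rewrite addrACA.
  - by rewrite leq_addr.
  - by move=> v /short[].
apply: (@price_all F N walk_bound l (yexp zz) (priceY zz p)) => //.
- by move=> u v; rewrite /priceY (perm_big _ (arcs_rot u v)).
- by move=> x q r; rewrite /priceY (perm_big _ (arcs_same_head x q r)) !big_cat /= opprD.
- by rewrite leq_addl.
- by move=> v /short[].
Qed.

Lemma sum_countM (T : eqType) (V : pzRingType) (J : seq T) (s : seq T) (f : T -> V) :
  uniq J -> {subset s <= J} -> \sum_(j <- J) f j * (count_mem j s)%:R = \sum_(i <- s) f i.
Proof.
move=> uJ; elim: s => [|x s IHs] sJ.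
  by rewrite big_nil big1 // => j _; rewrite mulr0.
rewrite big_cons -IHs => [|y ys]; last by apply: sJ; rewrite inE ys orbT.
rewrite (eq_bigr (fun j => f j * (x == j)%:R + f j * (count_mem j s)%:R)); last first.
  by move=> j _; rewrite /= natrD mulrDr.
rewrite big_split /=; congr (_ + _).
rewrite (bigD1_seq x) ?sJ ?mem_head //= eqxx mulr1 big1 ?addr0 // => j.
by rewrite eq_sym => /negbTE ->; rewrite mulr0.
Qed.

(** The linear program has one variable for every short closed walk of either
   colour, one equation for every kind of side, saying that it occurs equally
   often on polygons of the two colours, and one for every corner, saying that
   it is used once.  It and its dual have explicit feasible points, so that
   there are optimal solutions with the same value. *)
Lemma optimum : exists n PX PY (p : nat -> nat -> rat) (al : nat -> rat),
  [/\ primal_ok zz n PX PY, dual_feasible m l zz p al &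
      (\sum_(k < N) al k) * n%:R = (ndiscs m l zz PX PY)%:R].
Proof.
pose WL := walks N walk_bound; pose I := 'I_(size WL); pose wk (i : I) := nth [::] WL i.
pose R : finType := ('I_N * 'I_N + 'I_N)%type; pose W : finType := (I + I)%type.
pose A (r : R) (w : W) : rat := match r, w with
  | inl a, inl i => (count_mem (val a.1, val a.2) (arcs (wk i)))%:R
  | inl a, inr i => - (count_mem (val a.1, val a.2) (arcsY (wk i)))%:R
  | inr k, inl i => (count_mem (val k) (wk i))%:R
  | inr k, inr i => 0 end.
pose b (r : R) : rat := if r is inr _ then 1 else 0.
pose c (w : W) : rat := match w with
  | inl i => (discX m zz (wk i))%:R | inr i => (discY l zz (wk i))%:R end.
have wkP (i : I) : [&& wk i != [::], (size (wk i) <= walk_bound)%N & all (fun k => k < N)%N (wk i)].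
  by rewrite -mem_walks mem_nth.
have wkN i k : k \in wk i -> (k < N)%N by have /and3P[_ _ /allP] := wkP i; exact.
have sumW (f : W -> rat) : \sum_w f w = \sum_i f (inl i) + \sum_i f (inr i).
  exact: big_sumType.
have sumR (f : R -> rat) : \sum_r f r = \sum_k \sum_j f (inl (k, j)) + \sum_k f (inr k).
  by rewrite big_sumType pair_bigA /=; congr (_ + _); apply: eq_bigr => -[].
have idxP w : w \in WL -> exists i : I, wk i = w.
  by move=> wW; have h := wW; rewrite -index_mem in h; exists (Ordinal h); rewrite /wk nth_index.
have [Nb1 Nb2] : (1 <= walk_bound)%N /\ (N <= walk_bound)%N.
  have Nb : (N <= walk_bound)%N by rewrite (leq_trans _ (leq_addr _ _)) // leq_pmulr // absz_gt0.
  by split=> //; exact: leq_trans Nb.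
(* Half a unit per corner pays for a disc, which has at least two corners; out of
   the price 1 of a visit, the price - 1/2 of a side moves one half from the
   colour X to the colour Y. *)
have [y0 y0P] : exists y0, dual_feas A c y0.
  exists (fun r => if r is inr _ then 1 else - (2%:R)^-1) => w.
  have arcs_tot (s : seq (nat * nat)) : (forall a, a \in s -> (a.1 < N)%N && (a.2 < N)%N) ->
      \sum_(k < N) \sum_(j < N) (count_mem (val k, val j) s)%:R = (size s)%:R :> rat.
    move=> sN; rewrite pair_bigA /= -[size s]sum1_size natr_sum.
    rewrite -(@sum_countM _ _ [seq (val a.1, val a.2) | a : 'I_N * 'I_N]).
    - by rewrite big_map big_enum /=; apply: eq_bigr => a _; rewrite mul1r.
    - by rewrite map_inj_uniq ?enum_uniq // => -[x y] [x' y'] [/val_inj-> /val_inj->].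
    - move=> [x y] /sN/andP[/= xN yN]; apply/mapP; exists (Ordinal xN, Ordinal yN) => //.
      by rewrite mem_enum.
  have vis_tot (s : seq nat) : (forall k, k \in s -> (k < N)%N) ->
      \sum_(k < N) (count_mem (val k) s)%:R = (size s)%:R :> rat.
    move=> sN; rewrite -[size s]sum1_size natr_sum -(@sum_countM _ _ [seq val k | k : 'I_N]).
    - by rewrite big_map big_enum /=; apply: eq_bigr => a _; rewrite mul1r.
    - by rewrite map_inj_uniq ?enum_uniq //; exact: val_inj.
    - by move=> x /sN xN; apply/mapP; exists (Ordinal xN); rewrite ?mem_enum.
  have halves (D : bool) s : (D -> (2 <= s)%N) -> D%:R <= (s%:R : rat) / 2%:R.
    case: D => [/(_ isT) s2|_]; last by rewrite divr_ge0.
    by rewrite ler_pdivlMr // mul1r ler_nat.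
  have size2 (D : pred (seq nat)) i : (forall k, (k < N)%N -> ~~ D [:: k]) ->
      D (wk i) -> (2 <= size (wk i))%N.
    move=> D1; have /and3P[] := wkP i; case: (wk i) (wkN i) => [|k [|? ?]] //= kN _ _ _.
    by rewrite (negbTE (D1 k _)) // kN ?mem_head.
  have redk k : (k < N)%N -> ~~ (m %| xexp zz k)%Z && ~~ (l %| yexp zz k)%Z.
    by move=> kN; apply: (allP red); rewrite mem_nth.
  rewrite sumR; case: w => i /=.
  - have -> : \sum_(k < N) \sum_(j < N) - 2%:R^-1 * (count_mem (val k, val j) (arcs (wk i)))%:R
        = - 2%:R^-1 * (size (wk i))%:R :> rat.
      rewrite -(size_arcs (wk i)) -arcs_tot; last by move=> a /mem_arcs[/wkN-> /wkN->].
      by rewrite mulr_sumr; apply: eq_bigr => k _; rewrite mulr_sumr.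
    rewrite (eq_bigr (fun k : 'I_N => (count_mem (val k) (wk i))%:R : rat)); last first.
      by move=> k _; rewrite mul1r.
    rewrite vis_tot; last exact: wkN.
    have -> : - 2%:R^-1 * (size (wk i))%:R + (size (wk i))%:R = (size (wk i))%:R / 2%:R :> rat by field.
    apply: halves; apply: size2 => k kN; rewrite /discX big_seq1.
    by have /andP[] := redk k kN.
  - rewrite [X in _ + X]big1 ?addr0 => [|k _]; last by rewrite mulr0.
    have -> : \sum_(k < N) \sum_(j < N) - 2%:R^-1 * - (count_mem (val k, val j) (arcsY (wk i)))%:R
        = (size (wk i))%:R / 2%:R :> rat.
      rewrite -(size_arcs (wk i)) -(size_map (fun a => (a.2, a.1.+1 %% N)%N)) -/(arcsY _) -arcs_tot; last first.
        by move=> _ /mapP[a /mem_arcs[/wkN _ /wkN a2] ->] /=; rewrite a2 ltn_mod.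
      rewrite mulrC mulr_sumr; apply: eq_bigr => k _; rewrite mulr_sumr.
      by apply: eq_bigr => j _; rewrite mulrNN.
    apply: halves; apply: size2 => k kN; rewrite /discY big_seq1.
    by have /andP[] := redk k kN.
have sum_idx (s : seq (seq nat)) (f : seq nat -> rat) : {subset s <= WL} ->
    \sum_(i : I) f (wk i) * (\sum_(w <- s) (index w WL == i)%:R) = \sum_(w <- s) f w.
  move=> sW; rewrite (eq_bigr (fun i : I => \sum_(w <- s) f (wk i) * (index w WL == i)%:R)); last first.
    by move=> i _; rewrite mulr_sumr.
  rewrite exchange_big /= big_seq [RHS]big_seq; apply: eq_bigr => w /sW ww.
  have h := ww; rewrite -index_mem in h; rewrite (bigD1 (Ordinal h)) //= eqxx mulr1.
  rewrite /wk /= nth_index // big1 ?addr0 // => i ni.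
  by case: eqP => [e|_]; rewrite ?mulr0 //; case/eqP: ni; exact/val_inj.
(* Monogons for the colour X, and one polygon with all N corners for Y. *)
have [x0 x0P] : exists x0, primal_feas A b x0.
  pose PX := [seq [:: k] | k <- iota 0 N]; pose PY := [:: iota 0 N].
  have PXW : {subset PX <= WL}.
    move=> w /mapP[k]; rewrite mem_iota add0n /= => kN ->.
    by rewrite mem_walks /= kN Nb1.
  have PYW : {subset PY <= WL}.
    move=> w; rewrite inE => /eqP ->; rewrite mem_walks size_iota Nb2 -size_eq0 size_iota -lt0n N0.
    by apply/allP => k; rewrite mem_iota.
  exists (fun w : W => match w with
    | inl i => \sum_(w <- PX) (index w WL == val i)%:R
    | inr i => \sum_(w <- PY) (index w WL == val i)%:R end).
  split=> [[] i|r]; rewrite ?sumr_ge0 //.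
  rewrite sumW; case: r => [[k j]|k] /=.
  - rewrite (sum_idx PX (fun w => (count_mem (val k, val j) (arcs w))%:R)) //.
    rewrite (sum_idx PY (fun w => - (count_mem (val k, val j) (arcsY w))%:R)) //.
    rewrite big_seq1 big_map.
    have -> : arcsY (iota 0 N) = [seq (i, i) | i <- rot 1 (iota 0 N)].
      rewrite /arcsY /arcs rot_iota -map_comp; elim: (iota 0 N) => //= i s ->.
      by [].
    have -> : count_mem (val k, val j) [seq (i, i) | i <- rot 1 (iota 0 N)] =
        count_mem (val k, val j) [seq (i, i) | i <- iota 0 N].
      by apply/seq.permP; rewrite perm_map // perm_rot.
    have -> : \sum_(i <- iota 0 N) (count_mem (val k, val j) (arcs [:: i]))%:R =
        (count_mem (val k, val j) [seq (i, i) | i <- iota 0 N])%:R :> rat.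
      elim: (iota 0 N) => [|i s IHs]; first by rewrite big_nil.
      by rewrite big_cons IHs -natrD /= addn0.
    by rewrite subrr.
  - rewrite (sum_idx PX (fun w => (count_mem (val k) w)%:R)) //.
    rewrite [X in _ + X]big1 ?addr0 => [|i _]; last by rewrite mul0r.
    rewrite big_map -natr_sum /=; rewrite (eq_bigr (fun i => nat_of_bool (i == val k))); last first.
      by move=> i _; rewrite addn0.
    rewrite -big_mkcond sum1_count -/(count_mem _ _) count_uniq_mem ?iota_uniq //.
    by rewrite mem_iota add0n /= ltn_ord.
(* Clear the denominators of an optimal solution. *)
have [x [y [xP yP xy]]] := strong_duality x0P y0P; have [xge0 xE] := xP.
have [n [f n0 fE]] := rat_denominator xge0.
pose P (g : I -> nat) := flatten [seq nseq (g i) (wk i) | i <- enum I].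
have sumP (V : nmodType) (h : seq nat -> V) g : \sum_(w <- P g) h w = \sum_i h (wk i) *+ g i.
  rewrite big_flatten big_map big_enum; apply: eq_bigr => i _ /=.
  by rewrite big_nseq; elim: (g i) => //= r ->; rewrite mulrS.
have mulrn_f (a : rat) w : a *+ f w = n%:R * (a * x w).
  by rewrite -[a *+ _]mulr_natr fE; ring.
pose PX := P (fun i => f (inl i)); pose PY := P (fun i => f (inr i)).
have PP g w : w \in P g -> exists i, w = wk i.
  by move=> /flatten_mapP[i _]; rewrite mem_nseq => /andP[_ /eqP ->]; exists i.
have count_fl (T : eqType) (h : seq nat -> seq T) a s :
    (count_mem a (flatten (map h s)))%:R = \sum_(w <- s) (count_mem a (h w))%:R :> rat.
  elim: s => [|w s IHs]; first by rewrite big_nil.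
  by rewrite big_cons /= count_cat natrD IHs.
exists n, PX, PY, (fun k j => y (inl (insubd (Ordinal N0) k, insubd (Ordinal N0) j))),
  (fun k => y (inr (insubd (Ordinal N0) k))).
have insE (k : 'I_N) : insubd (Ordinal N0) (val k) = k.
  by apply: val_inj; rewrite val_insubd ltn_ord.
split.
- apply/and4P; split=> //.
  + apply/allP => w; rewrite mem_cat => /orP[] /PP[i ->]; have /and3P[-> _ ->] := wkP i; by [].
  + have flY : [seq (a.2, a.1.+1 %% N)%N | a <- flatten (map (@arcs _) PY)] = flatten (map arcsY PY).
      by rewrite map_flatten -map_comp.
    rewrite flY; apply/allP => -[k j] _ /=; apply/eqP.
    have inN (h : seq nat -> seq (nat * nat)) Q : (forall i a, a \in h (wk i) -> (a.1 < N)%N && (a.2 < N)%N) ->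
       (forall w, w \in Q -> exists i, w = wk i) ->
       ~~ ((k < N)%N && (j < N)%N) -> count_mem (k, j) (flatten (map h Q)) = 0%N.
      move=> hN QI kj; apply/count_memPn/negP => /flatten_mapP[w /QI[i ->] /hN].
      by rewrite /= (negbTE kj).
    have [/andP[kN jN]|kj] := boolP ((k < N)%N && (j < N)%N); last first.
      rewrite !inN //; try by move=> w /PP.
        by move=> i a /mapP[a' /mem_arcs[/wkN _ /wkN a2] ->] /=; rewrite a2 ltn_mod.
      by move=> i a /mem_arcs[/wkN-> /wkN->].
    apply/eqP; rewrite -(eqr_nat rat) !count_fl !sumP.
    have := xE (inl (Ordinal kN, Ordinal jN)); rewrite sumW /= => e.
    rewrite -subr_eq0 -sumrN; apply/eqP; transitivity (n%:R * 0 : rat); last by rewrite mulr0.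
    rewrite -[X in _ = n%:R * X]e mulrDr !mulr_sumr.
    congr (_ + _); apply: eq_bigr => i _; first exact: mulrn_f.
    by rewrite mulrn_f !mulNr mulrN.
  + apply/allP => k; rewrite mem_iota add0n /= => kN; rewrite -(eqr_nat rat).
    rewrite -[PX]map_id count_fl sumP; have := xE (inr (Ordinal kN)).
    rewrite sumW /= [X in _ + X]big1 ?addr0 => [e|i _]; last by rewrite mul0r.
    apply/eqP; transitivity (n%:R * 1 : rat); last by rewrite mulr1.
    rewrite -[X in _ = n%:R * X]e mulr_sumr.
    by apply: eq_bigr => i _; exact: mulrn_f.
- apply: dual_extend => w wW; have [i <-] := idxP w wW.
  have arcsum (s : seq (nat * nat)) : (forall a, a \in s -> (a.1 < N)%N && (a.2 < N)%N) ->
      \sum_(a <- s) y (inl (insubd (Ordinal N0) a.1, insubd (Ordinal N0) a.2)) =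
      \sum_k \sum_j y (inl (k, j)) * (count_mem (val k, val j) s)%:R.
    move=> sN; rewrite pair_bigA /=.
    rewrite -(@sum_countM _ _ [seq (val a.1, val a.2) | a : 'I_N * 'I_N]).
    - by rewrite big_map big_enum /=; apply: eq_bigr => -[a b'] _ /=; rewrite !insE.
    - by rewrite map_inj_uniq ?enum_uniq // => -[x1 y1] [x2 y2] [/val_inj-> /val_inj->].
    - move=> [x1 y1] /sN/andP[/= xN yN]; apply/mapP; exists (Ordinal xN, Ordinal yN) => //.
      by rewrite mem_enum.
  split.
    have := yP (inl i); rewrite sumR /= /priceX => /le_trans; apply.
    rewrite arcsum; last by move=> a /mem_arcs[/wkN-> /wkN->].
    rewrite lerD2l -(@sum_countM _ _ [seq val k | k : 'I_N]).
    + by rewrite big_map big_enum /=; apply: ler_sum => k _; rewrite insE.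
    + by rewrite map_inj_uniq ?enum_uniq //; exact: val_inj.
    + by move=> k /wkN kN; apply/mapP; exists (Ordinal kN); rewrite ?mem_enum.
  have := yP (inr i); rewrite sumR /= /priceY => /le_trans; apply.
  rewrite [X in _ + X]big1 ?addr0 => [|k _]; last by rewrite mulr0.
  rewrite -(sum_arcsY (fun k j => y (inl (insubd (Ordinal N0) k, insubd (Ordinal N0) j)))).
  rewrite arcsum; last first.
    by move=> _ /mapP[a /mem_arcs[/wkN _ /wkN a2] ->] /=; rewrite a2 ltn_mod.
  rewrite -sumrN; apply: ler_sum => k _; rewrite -sumrN; apply: ler_sum => j _.
  by rewrite mulrN.
- have countP (D : pred (seq nat)) g : (count D (P g))%:R = \sum_i ((D (wk i))%:R *+ g i : rat).
    rewrite -(sumP _ (fun w => (D w)%:R)); elim: (P g) => [|w s IHs]; first by rewrite big_nil.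
    by rewrite big_cons /= natrD IHs.
  rewrite /ndiscs natrD !countP (eq_bigr (fun k : 'I_N => y (inr k))); last first.
    by move=> k _; rewrite insE.
  have -> : \sum_(k < N) y (inr k) = \sum_r y r * b r.
    rewrite sumR [X in _ = X + _]big1 ?add0r => [|k _]; last by rewrite big1 // => j _; rewrite mulr0.
    by apply: eq_bigr => k _; rewrite mulr1.
  rewrite -xy sumW mulrC mulrDr !mulr_sumr; congr (_ + _); apply: eq_bigr => i _.
    by rewrite mulrn_f.
  by rewrite mulrn_f.
Qed.
End Optimum.

(** * Stable commutator length as a limit *)

Section SclLimit.

Lemma leastP (P : nat -> Prop) : (exists n, P n) ->
  P (least P) /\ forall k, P k -> (least P <= k)%N.
Proof.
move=> [n0 Pn0]; pose Q n := P n /\ forall k, P k -> (n <= k)%N.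
suff exQ : exists n, Q n by exact: (xgetPex 0%N exQ).
have exb : exists n, `[< P n >] by exists n0; exact/asboolP.
exists (ex_minn exb); case: ex_minnP => n /asboolP Pn nmin; split=> // k Pk.
by apply: nmin; exact/asboolP.
Qed.

Variable G : groupType.
Implicit Types g h : G.

Lemma clP g : in_derived g -> ncomm (cl g) g /\ forall n, ncomm n g -> (cl g <= n)%N.
Proof. by move=> [s gs]; apply: leastP; exists (size s), s. Qed.

Lemma ncomm_derived n g : ncomm n g -> in_derived g.
Proof. by move=> [s gs _]; exists s. Qed.

(** Linear bounds on the commutator length of powers, from below for all powers
   and from above for the multiples of one exponent, determine scl. *)
Lemma scl_linear (R : realType) g (q : rat) (n0 : nat) (C : rat) : (0 < n0)%N ->
  (forall j c, (0 < j)%N -> ncomm c (g ^+ j)%g -> q * j%:R <= c%:R) ->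
  (forall M, exists2 c, ncomm c (g ^+ (n0 * M))%g & c%:R <= q * (n0 * M)%:R + C) ->
  scl R g = (ratr q)%:E.
Proof.
move=> n00 lower upper.
have [k_ok k_min] : (0 < least (fun k => (0 < k)%N /\ in_derived (g ^+ k)%g))%N /\
    in_derived (g ^+ least (fun k => (0 < k)%N /\ in_derived (g ^+ k)%g))%g.
  have [|//] := @leastP (fun k => (0 < k)%N /\ in_derived (g ^+ k)%g) _.
  exists n0; split=> //.
  by have [c /ncomm_derived] := upper 1%N; rewrite muln1.
rewrite /scl; set k := least _ in k_ok k_min *.
rewrite (gtn_eqF k_ok); congr (_%:E); set h := (g ^+ k)%g.
have hP j : in_derived (h ^+ j)%g.
  by have [s hs] := k_min; have := ncommX j (ex_intro2 _ _ s hs erefl); exact: ncomm_derived.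
have lo j : q * (k * j)%:R <= (cl (h ^+ j)%g)%:R.
  case: j => [|j]; first by rewrite muln0 mulr0.
  apply: lower; first by rewrite muln_gt0 k_ok.
  by rewrite expgnA; exact: (clP (hP _)).1.
(* The cost of the remainder when an exponent is divided by n0. *)
pose E := (\sum_(r < n0) cl (h ^+ r)%g)%N.
pose C' : rat := C + E%:R + `|q| * (k * n0)%:R.
have up j : (cl (h ^+ j)%g)%:R <= q * (k * j)%:R + C'.
  have [c gc le_c] := upper (k * (j %/ n0))%N.
  pose r := (j %% n0)%N; have rn : (r < n0)%N by rewrite ltn_mod.
  have le1 : (cl (h ^+ j)%g <= c + cl (h ^+ r)%g)%N.
    apply: (clP (hP j)).2; rewrite {1}(divn_eq j n0) expgnDr; apply: ncommM.
      by move: gc; rewrite -expgnA mulnCA [(n0 * _)%N]mulnC.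
    exact: (clP (hP r)).1.
  have le2 : (cl (h ^+ r)%g <= E)%N.
    by rewrite /E (bigD1 (Ordinal rn)) //= leq_addr.
  have le3 : ((cl (h ^+ j)%g)%:R : rat) <= c%:R + E%:R.
    by rewrite -natrD ler_nat (leq_trans le1) // leq_add2l.
  have jE : (k * j = n0 * (k * (j %/ n0)) + k * r)%N.
    by rewrite {1}(divn_eq j n0) mulnDr mulnA mulnC.
  have le4 : - q * (k * r)%:R <= `|q| * (k * n0)%:R.
    apply: (@le_trans _ _ (`|q| * (k * r)%:R)).
      by rewrite ler_wpM2r // -normrN ler_norm.
    by rewrite ler_wpM2l // ler_nat leq_mul2l ltnW ?orbT.
  by rewrite jE natrD /C' in le_c le4 *; lra.
rewrite /scl_derived; apply: (canLR (mulfK _)); first by rewrite pnatr_eq0 -lt0n.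
apply: cvg_lim => //; apply/cvgrPdist_le => e e0.
have C'0 : 0 <= C'.
  by have := le_trans (lo 0%N) (up 0%N); have := lo 0%N; rewrite muln0 mulr0; lra.
near=> j.
have j0 : (0 < j)%N by near: j; exact: nbhs_infty_gt.
have j0R : 0 < (j%:R : R) by rewrite ltr0n.
have loR : ratr q * (k * j)%:R <= (cl (h ^+ j)%g)%:R :> R.
  by have := lo j; rewrite -(ler_rat R) rmorphM /= !ratr_nat.
have upR : (cl (h ^+ j)%g)%:R <= ratr q * (k * j)%:R + ratr C' :> R.
  by have := up j; rewrite -(ler_rat R) rmorphD rmorphM /= !ratr_nat.
have jC : ratr C' / e <= j%:R :> R by near: j; exact: nbhs_infty_ger.
have -> : ratr q * k%:R - (cl (h ^+ j)%g)%:R / j%:R =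
    (ratr q * (k * j)%:R - (cl (h ^+ j)%g)%:R) / j%:R :> R.
  by rewrite natrM mulrBl mulrA mulfK // gt_eqF.
rewrite normrM normfV (gtr0_norm j0R) ler_pdivrMr // ler_norml.
rewrite ler_pdivrMr // mulrC in jC.
by apply/andP; split; lra.
Unshelve. all: by end_near.
Qed.
End SclLimit.

(** * Elements of alternating shape *)

(** The word t a^(x_0) t^-1 a^(y_0) t a^(x_1) t^-1 a^(y_1), and so on. *)
Definition turn_word (zz : turns) : bs_word :=
  flatten [seq (let_t false :: a_pow c.1) ++ let_t true :: a_pow c.2 | c <- zz].

Section Alternating.
Variables m l : int.
Hypotheses (m0 : m != 0) (l0 : l != 0).
Implicit Types zz : turns.

Lemma bs_eval_turn c : bs_eval m l ((let_t false :: a_pow c.1) ++ let_t true :: a_pow c.2) =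
  (gz (gen_b m l) c.1 * gz (gen_a m l) c.2)%g.
Proof.
rewrite -[let_t false :: _]cat1s -[let_t true :: _]cat1s !bs_evalM !bs_eval_pow.
by rewrite -[let_t true]/(true, ~~ false) bs_eval_letV -gzJ conjgE invgK !mulgA.
Qed.

Lemma bs_eval_turns zz : bs_eval m l (turn_word zz) = alt_elt m l zz.
Proof.
rewrite /alt_elt /turn_word; elim: zz => [|c zz IHzz]; first by rewrite big_nil bs_eval1.
by rewrite big_cons -IHzz -bs_eval_turn -bs_evalM.
Qed.

Lemma eqv_turns zz : eqv m l (letters (turn_word zz)) (altw zz).
Proof.
elim: zz => [|c zz IHzz]; first exact: eqv_refl.
have -> : turn_word (c :: zz) =
    ((let_t false :: a_pow c.1) ++ let_t true :: a_pow c.2) ++ turn_word zz by [].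
rewrite letters_cat -[altw _]/([:: (Some false, c.1); (Some true, c.2)] ++ altw zz).
apply: eqv_cat IHzz; rewrite letters_cat.
have H (e : bool) k : eqv m l (letters (let_t e :: a_pow k)) [:: (Some e, k)].
  apply: (eqv_trans (eqv_catl [:: (Some e, 0)] (eqv_pow m0 l0 k))).
  by have := eqv_letter m l (Some e) 0 k; rewrite add0r.
exact: (eqv_cat (H false c.1) (H true c.2)).
Qed.

Lemma eqv_alone e u v ws : eqv m l u v -> u != [::] -> v != [::] ->
  sbounds m l e (u :: ws) -> sbounds m l e (v :: ws).
Proof.
move=> uv u0 v0 /(eqv_blank m l ws e u0).2 /= H.
apply/(eqv_blank m l ws e v0).1; rewrite /=.
have /(_ isT)[+ _] := @eqv_ctx m l [:: blank] [::] u v ws e uv.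
by rewrite !cats0; apply.
Qed.

Lemma altw_neq0 zz : (0 < size zz)%N -> altw zz != [::].
Proof. by case: zz. Qed.

(** If the j-th power is a product of c commutators, it bounds a surface of Euler
   characteristic 1 - 2 c, which the dual solution bounds by j (theta - N). *)
Lemma ncomm_lower zz (p : nat -> nat -> rat) al j c : (0 < size zz)%N ->
  dual_feasible m l zz p al -> (0 < j)%N -> ncomm c (alt_elt m l zz ^+ j)%g ->
  ((size zz)%:R - \sum_(k < size zz) al k) / 2%:R * j%:R <= c%:R.
Proof.
move=> z0 dual j0; rewrite -bs_eval_turns.
have -> : (bs_eval m l (turn_word zz) ^+ j)%g = bs_eval m l (turn_word (flatten (nseq j zz))).
  elim: j {j0} => [|j IHj]; first by rewrite bs_eval1.
  rewrite expgS IHj -bs_evalM; congr bs_eval.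
  by rewrite [nseq _ _]/= [flatten _]/= /turn_word map_cat flatten_cat.
move=> /(sbounds_ncomm m0 l0) H.
have zj0 : (0 < size (flatten (nseq j zz)))%N by rewrite size_flatten_nseq muln_gt0 j0.
have {}H : sbounds m l (1 - 2 * c%:Z) [:: altw (flatten (nseq j zz))].
  apply: eqv_alone H => //; last exact: altw_neq0.
  apply: (eqv_trans (eqv_catr _ (eqv_blank m l))); exact: eqv_turns.
have := dual_bound z0 dual j0 H.
set S := \sum_(_ < _) _; rewrite -[S *+ j]mulr_natr intrD intrB intrM -!pmulrn natrM.
move: S (size zz)%:R j%:R c%:R => S a b d H1.
have {}H1 : 1 - 2%:R * d + b * a <= S * b by exact: H1.
lra.
Qed.

Lemma ncomm_conj (G : groupType) c (g x : G) j : ncomm c ((g ^ x) ^+ j)%g <-> ncomm c (g ^+ j)%g.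
Proof.
rewrite -conjXg; split; last exact: ncommJ.
by move=> /(ncommJ x^-1%g); rewrite conjgK.
Qed.

(** The primal solution bounds the commutator length of powers from above and the
   dual one from below; equality of their values closes the gap. *)
Lemma scl_alternating (R : realType) (g : BS m l) zz n PX PY (p : nat -> nat -> rat) al :
  m != l -> Defs.conjugate g (alt_elt m l zz) -> (0 < size zz)%N -> reduced m l zz ->
  primal_ok zz n PX PY -> dual_feasible m l zz p al ->
  (\sum_(k < size zz) al k) * n%:R = (ndiscs m l zz PX PY)%:R ->
  scl R g = (ratr (((size zz)%:R - (ndiscs m l zz PX PY)%:R / n%:R) / 2%:R))%:E.
Proof.
move=> ml [x gx] z0 red Pok dual opt; have n_gt0 : (0 < n)%N by case/and4P: Pok.
have nR : (n%:R : rat) != 0 by rewrite pnatr_eq0 -lt0n.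
have -> : (ndiscs m l zz PX PY)%:R / n%:R = \sum_(k < size zz) al k.
  by rewrite -opt mulfK.
have [n0 [C [n00 up]]] := upper_bound z0 red Pok.
apply: (@scl_linear _ _ _ _ (n0 * bsK m l)%N C%:R).
- by rewrite muln_gt0 n00 /bsK absz_gt0 subr_eq0 eq_sym.
- move=> j c j0 gc; apply: (ncomm_lower z0 dual j0).
  by rewrite gx; apply/ncomm_conj.
- move=> M; have [c [gc le_c]] := up M; exists c.
    by rewrite -mulnA; apply/(ncomm_conj _ _ x); rewrite -gx.
  have le_nd := ndiscs_le z0 red Pok.
  move: le_c; rewrite -(ler_nat rat) -mul2n !(natrD, natrM) natrB // natrM -opt.
  set S := \sum_(_ < _) _; set a : rat := n0%:R; set b : rat := (bsK m l)%:R; set d : rat := M%:R.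
  have nR1 : 1 <= n%:R :> rat by rewrite ler1n.
  have C0 : 0 <= C%:R :> rat by [].
  move=> h; have n_pos : 0 < n%:R :> rat by rewrite ltr0n.
  rewrite -(ler_pM2l n_pos); apply: (@le_trans _ _ ((n%:R * (size zz)%:R - S * n%:R) * (a * (b * d)) / 2%:R + C%:R / 2%:R)).
    by rewrite -mulrDl ler_pdivlMr // -mulrA [c%:R * _]mulrC.
  have -> : n%:R * (((size zz)%:R - S) / 2%:R * (a * b * d) + C%:R) =
     (n%:R * (size zz)%:R - S * n%:R) * (a * (b * d)) / 2%:R + n%:R * C%:R by field.
  by rewrite lerD2l; nra.
Qed.

(** The inverse of a product of turns begins with a power of a and ends with a
   power of t a t^-1; moving a power of a from one end to the other turns it
   into a reduced product of turns again. *)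
Lemma alt_inverse zz : (0 < size zz)%N -> reduced m l zz ->
  exists2 k, ~~ (l %| k)%Z & forall j, ~~ (l %| j)%Z -> exists zz',
    [/\ reduced m l zz', size zz' = size zz &
      ((alt_elt m l zz)^-1 * gz (gen_a m l) j = gz (gen_a m l) k * alt_elt m l zz')%g].
Proof.
case: zz => // c zz _; elim: zz c => [|c' zz IHzz] c /= /andP[/andP[mc lc] red].
  exists (- c.2); first by rewrite rpredN.
  move=> j lj; exists [:: (- c.1, j)]; split=> //=; first by rewrite rpredN mc lj.
  by rewrite /alt_elt !big_seq1 invgM !gzN !mulgA.
have [k lk H] := IHzz c' red; exists k => // j lj.
have [|zz' [red' sz' E]] := H (- c.2); first by rewrite rpredN.
exists (rcons zz' (- c.1, j)); split; last 2 first.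
- by rewrite size_rcons sz'.
- rewrite {1}/alt_elt big_cons invgM invgM -gzN -gzN !mulgA E.
  by rewrite /alt_elt big_rcons /= !mulgA.
- by rewrite /reduced all_rcons /= rpredN mc lj.
Qed.

(** Two such words for the same conjugacy class are, after inverting one of
   them, the two boundaries of an annulus. *)
Lemma alt_size_le zz zz0 (g : BS m l) : (0 < size zz)%N -> (0 < size zz0)%N ->
  reduced m l zz -> reduced m l zz0 -> Defs.conjugate g (alt_elt m l zz) ->
  Defs.conjugate g (alt_elt m l zz0) -> (size zz <= size zz0)%N.
Proof.
move=> z0 z00 red red0 [x gx] [x0 gx0].
have [k lk /(_ k lk)[zz' [red' sz' E]]] := alt_inverse z00 red0.
rewrite -sz'; apply: (@size_annulus m l _ _ red red').
have z0' : (0 < size zz')%N by rewrite sz'.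
have [u uE] : exists u, (alt_elt m l zz * alt_elt m l zz' ^ u = 1)%g.
  exists ((gz (gen_a m l) k)^-1 * (x0^-1 * x))%g.
  have -> : alt_elt m l zz' = ((g ^ x0)^-1 ^ gz (gen_a m l) k)%g.
    by rewrite -gx0 conjgE E mulKg.
  by rewrite -conjgM mulVKg -conjVg -conjgM mulVKg gx conjVg mulgV.
have [v vE] := bs_eval_surj u.
pose w := turn_word zz ++ word_inv v ++ turn_word zz' ++ v.
have w1 : bs_eval m l [::] = bs_eval m l w.
  by rewrite /w !bs_evalM bs_evalV vE !bs_eval_turns bs_eval1 -uE conjgE.
have H : sbounds m l 1 [:: blank :: letters w].
  have H0 : sbounds m l 1 [:: [:: blank]].
    by have := sbounds_add (sbounds0 m l); rewrite add0r.
  have /(_ isT)[+ _] := @eqv_ctx m l [:: blank] [::] _ _ [::] 1 (bs_eval_eqv m0 l0 w1).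
  by rewrite !cats0; apply.
have tw0 yy : (0 < size yy)%N -> letters (turn_word yy) != [::] by case: yy.
have n0 : letters (word_inv v ++ turn_word zz' ++ v) != [::].
  rewrite !letters_cat -size_eq0 !size_cat; have := tw0 zz' z0'.
  by rewrite -size_eq0 -!lt0n; lia.
have {}H : sbounds m l 0 [:: blank :: letters (turn_word zz); letters (word_inv v ++ turn_word zz' ++ v)].
  apply: (@sbounds_split m l 1) => //; move: H.
  by rewrite /w letters_cat cat_cons.
have {}H : sbounds m l 0 [:: altw zz; letters (word_inv v ++ turn_word zz' ++ v)].
  apply: eqv_alone H => //; last exact: altw_neq0.
  apply: (eqv_trans (eqv_catr _ (eqv_blank m l))); exact: eqv_turns.
apply: sbounds_swap; move: H => /sbounds_swap.
rewrite !letters_cat catA => /sbounds_rot; rewrite catA -letters_cat.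
have /(bs_eval_eqv m0 l0) cv : bs_eval m l (v ++ word_inv v) = bs_eval m l [::].
  by rewrite bs_evalM bs_evalV mulgV bs_eval1.
move=> /(cv _ _ _ (tw0 _ z0')).1; apply: eqv_alone.
- exact: eqv_turns.
- exact: tw0.
- exact: altw_neq0.
Qed.

Lemma alternating_turns (g : BS m l) : alternating_t_shape g ->
  exists zz, [/\ (0 < size zz)%N, reduced m l zz, Defs.conjugate g (alt_elt m l zz)
    & t_length g = (size zz).*2].
Proof.
move=> [s [[gs s1 s2 tl tc] even_s s_ge2 sE]].
pose zz := mkseq (fun i => (syl_exp s i.*2, syl_exp s i.*2.+1)) (size s)./2.
have szz : (size zz).*2 = size s by rewrite size_mkseq even_halfK.
have s0 : (0 < size s)%N by apply: leq_trans s_ge2.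
have lt1 i : (i < size zz)%N -> (i.*2.+1 < size s)%N.
  by move=> iz; rewrite -szz; lia.
exists zz; split.
- by rewrite -(ltn_double 0) szz.
- apply/allP => _ /(nthP (0, 0))[i iz <-]; rewrite nth_mkseq; last by rewrite size_mkseq in iz.
  have i1 := lt1 i iz; have i0 := ltnW i1; apply/andP; split=> /=.
    by apply: s1 => //; rewrite sE //= odd_double.
  apply: s2 => //; first by rewrite sE //= odd_double.
  have [lt|ge] := ltnP i.*2.+2 (size s); first by rewrite sE //= negbK odd_double.
  have e : i.*2.+2 = size s by apply/eqP; rewrite eqn_leq ge i1.
  by rewrite /syl_neg e modnn -[X in nth _ _ X](modn_small s0) -/(syl_neg s 0) sE.
- move: gs; congr Defs.conjugate; rewrite -bs_eval_turns; congr bs_eval.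
  rewrite /syllable_word /turn_word -[in LHS](mkseq_nth (false, 0) s) -szz.
  have H n : (n <= size zz)%N -> flatten [seq let_t x.1 :: a_pow x.2 | x <- mkseq (nth (false, 0) s) n.*2] =
     flatten [seq (let_t false :: a_pow c.1) ++ let_t true :: a_pow c.2 | c <-
        mkseq (fun i => (syl_exp s i.*2, syl_exp s i.*2.+1)) n].
    elim: n => // n IHn nz; have i1 := lt1 n nz; have i0 := ltnW i1.
    rewrite /mkseq -[n.+1]addn1 doubleD !iotaD !map_cat !flatten_cat.
    rewrite -/(mkseq _ n.*2) -/(mkseq _ n) IHn ?(ltnW nz) // add0n /= !cats0.
    have := sE _ i0; have := sE _ i1; rewrite /= odd_double /= /syl_neg /syl_exp.
    by rewrite !modn_small // => -> ->; rewrite -?catA.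
  by rewrite H // size_mkseq.
- by rewrite tl tc -szz.
Qed.

Lemma alternating_size (g : BS m l) zz : alternating_t_shape g ->
  (0 < size zz)%N -> reduced m l zz -> Defs.conjugate g (alt_elt m l zz) ->
  t_length g = (size zz).*2.
Proof.
move=> /alternating_turns[zz0 [z00 red0 gz0 ->]] z0 red gz.
by congr double; apply/eqP; rewrite eqn_leq !(alt_size_le (g := g)).
Qed.
End Alternating.

(** * Computable functions between data types *)

(** The codes of the standard data types are the ones in which the input and the
   output of an algorithm are written; only the functions on trees that respect
   them matter, so that no program ever has to decode an arbitrary tree. *)
Class coded (T : Type) := encode : T -> tree.
Instance coded_unit : coded unit := fun=> Leaf.
Instance coded_bool : coded bool := enc_bool.
Instance coded_nat : coded nat := enc_nat.
Instance coded_int : coded int := enc_int.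
Instance coded_pair (S T : Type) {cS : coded S} {cT : coded T} : coded (S * T) :=
  enc_pair encode encode.
Instance coded_seq (T : Type) {cT : coded T} : coded (seq T) := enc_seq encode.

Definition cmp (S T : Type) {cS : coded S} {cT : coded T} (f : S -> T) : Prop :=
  exists p, forall x, runs p (encode x) (encode (f x)).

(** Computability is proved by following the syntax of a function.  All closure
   lemmas are stated for expressions that depend on a parameter x, so that they
   apply under binders: an expression with a further bound variable is one that
   depends on a pair. *)
Create HintDb cmp discriminated.
#[global] Hint Constants Opaque : cmp.
#[global] Hint Variables Opaque : cmp.

Ltac cmp := by eauto 60 with cmp nocore.

Section Combinators.
Context {S T U V : Type} {cS : coded S} {cT : coded T} {cU : coded U} {cV : coded V}.

Lemma cmp_id : cmp (fun x : S => x).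
Proof. by exists PId => x; constructor. Qed.

Lemma cmp_comp (g : T -> U) (f : S -> T) : cmp g -> cmp f -> cmp (fun x => g (f x)).
Proof. by move=> [q Hq] [p Hp]; exists (PSeq p q) => x; econstructor; eauto. Qed.

Lemma cmp_eq (f g : S -> T) : f =1 g -> cmp f -> cmp g.
Proof. by move=> fg [p Hp]; exists p => x; rewrite -fg. Qed.

Lemma cmp_cst (c : T) : cmp (fun _ : S => c).
Proof.
have [p Hp] : exists p, forall x, runs p x (encode c); last by exists p.
elim: (encode c) => [|t [p Hp] u [q Hq]]; first by exists PLeaf => x; constructor.
by exists (PNode p q) => x; constructor.
Qed.

Lemma cmp_pair (f : S -> T) (g : S -> U) : cmp f -> cmp g -> cmp (fun x => (f x, g x)).
Proof. by move=> [p Hp] [q Hq]; exists (PNode p q) => x; constructor. Qed.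

Lemma cmp_fst (f : S -> T * U) : cmp f -> cmp (fun x => (f x).1).
Proof.
move=> [p Hp]; exists (PSeq p PLeft) => x; econstructor; first exact: Hp.
by case: (f x) => a b; constructor.
Qed.

Lemma cmp_snd (f : S -> T * U) : cmp f -> cmp (fun x => (f x).2).
Proof.
move=> [p Hp]; exists (PSeq p PRight) => x; econstructor; first exact: Hp.
by case: (f x) => a b; constructor.
Qed.

Lemma cmp_if (b : S -> bool) (f g : S -> T) :
  cmp b -> cmp f -> cmp g -> cmp (fun x => if b x then f x else g x).
Proof.
move=> [p Hp] [q Hq] [r Hr]; exists (PIf p q r) => x; have := Hp x.
by case: (b x) => H; [apply: (@RunIfT _ _ _ _ Leaf Leaf _ H) | apply: RunIfF H _].
Qed.

Lemma cmp_cons (f : S -> T) (g : S -> seq T) : cmp f -> cmp g -> cmp (fun x => f x :: g x).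
Proof. by move=> [p Hp] [q Hq]; exists (PNode p q) => x; constructor. Qed.

Lemma cmp_case (l : S -> seq T) (g : S -> U) (h : S -> T -> seq T -> U) :
  cmp l -> cmp g -> cmp (fun q => h q.1.1 q.1.2 q.2) ->
  cmp (fun x => if l x is y :: r then h x y r else g x).
Proof.
move=> [p Hp] [q Hq] [r Hr].
exists (PIf p (PSeq (PNode (PNode PId (PSeq p PLeft)) (PSeq p PRight)) r) q) => x.
have := Hp x; case: (l x) => [|y s] Hx; first by apply: RunIfF Hx (Hq x).
apply: (@RunIfT _ _ _ _ (encode y) (encode s) _ Hx); apply: RunSeq (Hr (x, y, s)).
constructor; last exact: RunSeq Hx (RunRight _ _).
by constructor; [constructor | exact: RunSeq Hx (RunLeft _ _)].
Qed.

(** The loop runs on the triple of the parameter, the accumulator and the list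
   still to be read; all other bounded loops are special cases of this one. *)
Lemma cmp_foldl (f : S -> U -> T -> U) (a : S -> U) (l : S -> seq T) :
  cmp (fun q => f q.1.1 q.1.2 q.2) -> cmp a -> cmp l ->
  cmp (fun x => foldl (f x) (a x) (l x)).
Proof.
move=> [p Hp] [q Hq] [r Hr].
pose body := PNode (PNode (PSeq PLeft PLeft)
  (PSeq (PNode PLeft (PSeq PRight PLeft)) p)) (PSeq PRight PRight).
exists (PSeq (PNode (PNode PId q) r)
  (PSeq (PWhile PRight body) (PSeq PLeft PRight))) => x.
have {Hq Hr} Hinit : runs (PNode (PNode PId q) r) (encode x) (encode (x, a x, l x)).
  by constructor; [constructor; [constructor|]|].
apply: (RunSeq Hinit); apply: (@RunSeq _ _ _ (encode (x, foldl (f x) (a x) (l x), [::] : seq T))).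
  elim: (l x) (a x) => [|y s IHs] b; first exact/RunWhileF/RunRight.
  apply: RunWhileT (IHs _); first exact: RunRight.
  constructor; last by econstructor; constructor.
  constructor; first by econstructor; constructor.
  apply: RunSeq (Hp (x, b, y)); constructor; first by constructor.
  by econstructor; constructor.
by econstructor; constructor.
Qed.

End Combinators.

Hint Resolve cmp_id cmp_cst cmp_pair cmp_fst cmp_snd cmp_if cmp_cons : cmp.
Hint Extern 0 (cmp _) => progress cbv beta : cmp.
(* A function that is known to be computable may be applied to computable
   arguments; the number of arguments decides how its domain is read as a
   product. *)
Hint Extern 1 (cmp _) =>
  match goal with
  | H : cmp ?g |- cmp (fun q => ?g (@?a q)) => refine (cmp_comp (f := a) H _)
  | H : cmp (fun q => ?g q.1 q.2) |- cmp (fun q => ?g (@?a q) (@?b q)) =>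
    refine (cmp_comp (f := fun q => (a q, b q)) H _)
  | H : cmp (fun q => ?g q.1.1 q.1.2 q.2) |- cmp (fun q => ?g (@?a q) (@?b q) (@?c q)) =>
    refine (cmp_comp (f := fun q => (a q, b q, c q)) H _)
  end : cmp.

Section Booleans.
Context {S T U : Type} {cS : coded S} {cT : coded T} {cU : coded U}.
Implicit Types b : S -> bool.

Lemma cmp_andb b b' : cmp b -> cmp b' -> cmp (fun x => b x && b' x).
Proof. by move=> Hb Hb'; apply: cmp_if => //; apply: cmp_cst. Qed.

Lemma cmp_orb b b' : cmp b -> cmp b' -> cmp (fun x => b x || b' x).
Proof. by move=> Hb Hb'; apply: cmp_if => //; apply: cmp_cst. Qed.

Lemma cmp_negb b : cmp b -> cmp (fun x => ~~ b x).
Proof. by move=> Hb; apply: cmp_if => //; apply: cmp_cst. Qed.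

Lemma cmp_eqb b b' : cmp b -> cmp b' -> cmp (fun x => b x == b' x).
Proof.
move=> Hb Hb'; apply: (@cmp_eq _ _ _ _ (fun x => if b x then b' x else ~~ b' x)).
  by move=> x; case: (b x) (b' x) => [] [].
by apply: cmp_if => //; apply: cmp_negb.
Qed.
End Booleans.

Hint Resolve cmp_andb cmp_orb cmp_negb cmp_eqb : cmp.

Section Sequences.
Context {S T U : Type} {cS : coded S} {cT : coded T} {cU : coded U}.
Implicit Types (f : S -> T -> U) (l : S -> seq T).

Lemma cmp_behead l : cmp l -> cmp (fun x => behead (l x)).
Proof.
move=> Hl; apply: (@cmp_eq _ _ _ _ (fun x => if l x is y :: r then r else [::])).
  by move=> x; case: (l x).
by apply: (cmp_case (h := fun _ _ r => r)); cmp.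
Qed.

Lemma cmp_head (d : S -> T) l : cmp d -> cmp l -> cmp (fun x => head (d x) (l x)).
Proof.
move=> Hd Hl; apply: (@cmp_eq _ _ _ _ (fun x => if l x is y :: r then y else d x)).
  by move=> x; case: (l x).
by apply: (cmp_case (h := fun _ y _ => y)); cmp.
Qed.

Lemma cmp_rev l : cmp l -> cmp (fun x => rev (l x)).
Proof.
move=> Hl; apply: (@cmp_eq _ _ _ _ (fun x => foldl (fun r y => y :: r) [::] (l x))).
  by move=> x; rewrite /rev; elim: (l x) [::] => //= y r IHr a; rewrite IHr.
by apply: (cmp_foldl (f := fun _ r y => y :: r)); cmp.
Qed.

Lemma cmp_foldr (f : S -> T -> U -> U) (a : S -> U) l :
  cmp (fun q => f q.1.1 q.1.2 q.2) -> cmp a -> cmp l ->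
  cmp (fun x => foldr (f x) (a x) (l x)).
Proof.
move=> Hf Ha Hl; apply: (@cmp_eq _ _ _ _ (fun x => foldl (fun u y => f x y u) (a x) (rev (l x)))).
  by move=> x; rewrite foldl_rev.
apply: (cmp_foldl (f := fun x u y => f x y u)) => //; last exact: cmp_rev.
by cmp.
Qed.
End Sequences.

Hint Resolve cmp_behead cmp_head cmp_rev : cmp.

Section MoreSequences.
Context {S T U : Type} {cS : coded S} {cT : coded T} {cU : coded U}.
Implicit Types (f : S -> T -> U) (l : S -> seq T) (P : S -> T -> bool).

Lemma cmp_map f l : cmp (fun q => f q.1 q.2) -> cmp l ->
  cmp (fun x => [seq f x y | y <- l x]).
Proof.
move=> Hf Hl; apply: (@cmp_eq _ _ _ _ (fun x => foldr (fun y r => f x y :: r) [::] (l x))) => //.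
by apply: (cmp_foldr (f := fun x y r => f x y :: r)); cmp.
Qed.

Lemma cmp_filter P l : cmp (fun q => P q.1 q.2) -> cmp l ->
  cmp (fun x => [seq y <- l x | P x y]).
Proof.
move=> HP Hl; apply: (@cmp_eq _ _ _ _
  (fun x => foldr (fun y r => if P x y then y :: r else r) [::] (l x))) => //.
by apply: (cmp_foldr (f := fun x y r => if P x y then y :: r else r)); cmp.
Qed.

Lemma cmp_all P l : cmp (fun q => P q.1 q.2) -> cmp l -> cmp (fun x => all (P x) (l x)).
Proof.
move=> HP Hl; apply: (@cmp_eq _ _ _ _ (fun x => foldr (fun y r => P x y && r) true (l x))) => //.
by apply: (cmp_foldr (f := fun x y r => P x y && r)); cmp.
Qed.

Lemma cmp_has P l : cmp (fun q => P q.1 q.2) -> cmp l -> cmp (fun x => has (P x) (l x)).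
Proof.
move=> HP Hl; apply: (@cmp_eq _ _ _ _ (fun x => foldr (fun y r => P x y || r) false (l x))) => //.
by apply: (cmp_foldr (f := fun x y r => P x y || r)); cmp.
Qed.

Lemma cmp_cat l l' : cmp l -> cmp l' -> cmp (fun x => l x ++ l' x).
Proof.
move=> Hl Hl'; apply: (@cmp_eq _ _ _ _ (fun x => foldr (fun y r => y :: r) (l' x) (l x))).
  by move=> x; elim: (l x) => //= y r ->.
by apply: (cmp_foldr (f := fun _ y r => y :: r)); cmp.
Qed.
End MoreSequences.

Hint Resolve cmp_cat : cmp.
Hint Extern 2 (cmp (fun x => map (@?f x) _)) => apply: (cmp_map (f := f)) : cmp.
Hint Extern 2 (cmp (fun x => filter (@?f x) _)) => apply: (cmp_filter (P := f)) : cmp.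
Hint Extern 2 (cmp (fun x => all (@?f x) _)) => apply: (cmp_all (P := f)) : cmp.
Hint Extern 2 (cmp (fun x => has (@?f x) _)) => apply: (cmp_has (P := f)) : cmp.

Lemma cmp_flatten S T {cS : coded S} {cT : coded T} (l : S -> seq (seq T)) :
  cmp l -> cmp (fun x => flatten (l x)).
Proof. by move=> Hl; apply: (cmp_foldr (f := fun _ y r => y ++ r)); cmp. Qed.
Hint Resolve cmp_flatten : cmp.

Lemma cmp_allpairs S T U V {cS : coded S} {cT : coded T} {cU : coded U} {cV : coded V}
  (f : S -> T -> U -> V) (l : S -> seq T) (l' : S -> seq U) :
  cmp (fun q => f q.1.1 q.1.2 q.2) -> cmp l -> cmp l' ->
  cmp (fun x => [seq f x y z | y <- l x, z <- l' x]).
Proof.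
move=> Hf Hl Hl'; by apply: cmp_flatten; cmp.
Qed.

Section Naturals.
Context {S T U : Type} {cS : coded S} {cT : coded T} {cU : coded U}.
Implicit Types m n : S -> nat.

(** A number and a list of that length whose items carry no information have
   the same encode, so that iteration is a special case of folding. *)
Lemma cmp_units n : cmp n -> cmp (fun x => nseq (n x) tt).
Proof.
move=> [p Hp]; exists p => x; have := Hp x.
by congr runs; elim: (n x) => // k IHk; exact: (congr1 (Node Leaf) IHk).
Qed.

Lemma cmp_size (l : S -> seq T) : cmp l -> cmp (fun x => size (l x)).
Proof.
move=> Hl; have [p Hp] : cmp (fun x => [seq tt | _ <- l x]).
  by apply: (cmp_map (f := fun _ _ => tt)); cmp.
exists p => x; have := Hp x.
by congr runs; elim: (l x) => //= y r IHr; exact: (congr1 (Node Leaf) IHr).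
Qed.

Lemma cmp_iter n (f : S -> U -> U) (a : S -> U) : cmp n -> cmp (fun q => f q.1 q.2) ->
  cmp a -> cmp (fun x => iter (n x) (f x) (a x)).
Proof.
move=> Hn Hf Ha; apply: (@cmp_eq _ _ _ _ (fun x => foldr (fun _ u => f x u) (a x) (nseq (n x) tt))).
  by move=> x; elim: (n x) => //= k ->.
have Hu := cmp_units Hn.
by apply: (cmp_foldr (f := fun x _ u => f x u)); cmp.
Qed.

Lemma cmp_S n : cmp n -> cmp (fun x => (n x).+1).
Proof. by move=> [p Hp]; exists (PNode PLeaf p) => x; constructor=> //; constructor. Qed.

Lemma cmp_pred n : cmp n -> cmp (fun x => (n x).-1).
Proof.
move=> [p Hp]; exists (PSeq p PRight) => x; econstructor; first exact: Hp.
by case: (n x) => [|k]; constructor.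
Qed.

Lemma cmp_eqn0 n : cmp n -> cmp (fun x => n x == 0)%N.
Proof.
move=> [p Hp]; exists (PIf p PLeaf (PNode PLeaf PLeaf)) => x; have := Hp x.
case: (n x) => [|k] Hx; first exact: (@RunIfF _ _ _ _ _ Hx (RunNode (RunLeaf _) (RunLeaf _))).
exact: (@RunIfT _ _ _ _ Leaf (encode k) _ Hx (RunLeaf _)).
Qed.
End Naturals.

Hint Resolve cmp_units cmp_size cmp_S cmp_pred cmp_eqn0 : cmp.
Hint Extern 2 (cmp (fun x => iter _ (@?f x) _)) => apply: (cmp_iter (f := f)) : cmp.

Section Arithmetic.
Context {S T U : Type} {cS : coded S} {cT : coded T} {cU : coded U}.
Implicit Types m n : S -> nat.

Lemma cmp_addn m n : cmp m -> cmp n -> cmp (fun x => m x + n x)%N.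
Proof.
move=> Hm Hn; apply: (@cmp_eq _ _ _ _ (fun x => iter (m x) succn (n x))).
  by move=> x; rewrite iter_succn addnC.
by apply: (cmp_iter (f := fun _ => succn)); cmp.
Qed.

Lemma cmp_subn m n : cmp m -> cmp n -> cmp (fun x => m x - n x)%N.
Proof.
move=> Hm Hn; apply: (@cmp_eq _ _ _ _ (fun x => iter (n x) predn (m x))).
  by move=> x; rewrite iter_predn.
by apply: (cmp_iter (f := fun _ => predn)); cmp.
Qed.

Lemma cmp_leq m n : cmp m -> cmp n -> cmp (fun x => m x <= n x)%N.
Proof. by move=> Hm Hn; apply: cmp_eqn0; apply: cmp_subn. Qed.

Lemma cmp_eqn m n : cmp m -> cmp n -> cmp (fun x => m x == n x).
Proof.
move=> Hm Hn; apply: (@cmp_eq _ _ _ _ (fun x => (m x <= n x) && (n x <= m x))%N).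
  by move=> x; rewrite eqn_leq.
by apply: cmp_andb; apply: cmp_leq.
Qed.

End Arithmetic.

Hint Resolve cmp_addn cmp_subn cmp_leq cmp_eqn : cmp.

Section MoreArithmetic.
Context {S T U : Type} {cS : coded S} {cT : coded T} {cU : coded U}.
Implicit Types m n : S -> nat.

Lemma cmp_iota m n : cmp m -> cmp n -> cmp (fun x => iota (m x) (n x)).
Proof.
move=> Hm Hn; apply: (@cmp_eq _ _ _ _
  (fun x => [seq (m x + i)%N | i <- iter (n x) (fun s => s ++ [:: size s]) [::]])).
  move=> x; rewrite -[m x in RHS]addn0 iotaDl; congr map.
  by elim: (n x) => // k IHk; rewrite iterS IHk size_iota -addn1 iotaD.
by cmp.
Qed.

Lemma cmp_nseq n (a : S -> T) : cmp n -> cmp a -> cmp (fun x => nseq (n x) (a x)).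
Proof.
move=> Hn Ha; apply: (@cmp_eq _ _ _ _ (fun x => iter (n x) (cons (a x)) [::])) => //.
by apply: (cmp_iter (f := fun x => cons (a x))); cmp.
Qed.

Lemma cmp_nth (d : S -> T) (l : S -> seq T) n : cmp d -> cmp l -> cmp n ->
  cmp (fun x => nth (d x) (l x) (n x)).
Proof.
move=> Hd Hl Hn; apply: (@cmp_eq _ _ _ _ (fun x => head (d x) (iter (n x) behead (l x)))).
  move=> x; rewrite -nth0 -[n x in RHS]addn0 -nth_drop; congr nth.
  by elim: (n x) (l x) => [|k IHk] s; rewrite ?drop0 // iterSr IHk; case: s.
apply: cmp_head => //; apply: (cmp_iter (f := fun _ => behead)); cmp.
Qed.

Lemma cmp_modn m n : cmp m -> cmp n -> cmp (fun x => m x %% n x)%N.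
Proof.
move=> Hm Hn; apply: (@cmp_eq _ _ _ _
  (fun x => iter (m x) (fun r => if r.+1 == n x then 0 else r.+1)%N 0%N)).
  move=> x; elim: (m x) => [|k IHk]; first by rewrite mod0n.
  rewrite iterS IHk; move: (n x) => [|d]; first by rewrite !modn0.
  have := ltn_pmod k (ltn0Sn d); rewrite -[k.+1]addn1 -modnDml addn1 leq_eqVlt.
  case/orP => [/eqP->|lt]; first by rewrite eqxx modnn.
  by rewrite (modn_small lt) (ltn_eqF lt).
by cmp.
Qed.

Lemma cmp_muln m n : cmp m -> cmp n -> cmp (fun x => m x * n x)%N.
Proof.
move=> Hm Hn; apply: (@cmp_eq _ _ _ _ (fun x => iter (m x) (addn (n x)) 0)%N).
  by move=> x; rewrite iter_addn_0 mulnC.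
by apply: (cmp_iter (f := fun x => addn (n x))); cmp.
Qed.
End MoreArithmetic.

Hint Resolve cmp_iota cmp_nseq cmp_nth cmp_modn cmp_muln : cmp.

Section Integers.
Context {S : Type} {cS : coded S}.
Implicit Types (m n : S -> nat) (f g : S -> int).

Lemma cmp_ltz0 f : cmp f -> cmp (fun x => f x < 0).
Proof. by move=> [p Hp]; exists (PSeq p PLeft) => x; apply: RunSeq (Hp x) (RunLeft _ _). Qed.

Lemma cmp_absz f : cmp f -> cmp (fun x => `|f x|%N).
Proof. by move=> [p Hp]; exists (PSeq p PRight) => x; apply: RunSeq (Hp x) (RunRight _ _). Qed.

(** One of the two truncated differences is zero and the other one is the
   absolute value. *)
Lemma cmp_subz m n : cmp m -> cmp n -> cmp (fun x => (m x)%:Z - (n x)%:Z).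
Proof.
move=> Hm Hn.
have [p Hp] : cmp (fun x => (m x < n x, m x - n x + (n x - m x)))%N by cmp.
exists p => x; have := Hp x; congr runs; rewrite /encode /= /coded_pair /enc_pair /=.
by congr (Node (enc_bool _) (enc_nat _)); lia.
Qed.
End Integers.

Hint Resolve cmp_ltz0 cmp_absz cmp_subz : cmp.

Section IntegerRing.
Context {S T : Type} {cS : coded S} {cT : coded T}.
Implicit Types (m n : S -> nat) (f g : S -> int).

Let pos (x : int) : nat := if x < 0 then 0%N else `|x|%N.
Let neg (x : int) : nat := if x < 0 then `|x|%N else 0%N.

Let posB x : x = (pos x)%:Z - (neg x)%:Z.
Proof. by rewrite /pos /neg; case: ifP; lia. Qed.

Lemma cmp_Posz m : cmp m -> cmp (fun x => (m x)%:Z).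
Proof.
move=> Hm; apply: (@cmp_eq _ _ _ _ (fun x => (m x)%:Z - 0%N%:Z)); last by cmp.
by move=> x; rewrite subr0.
Qed.

Lemma cmp_addz f g : cmp f -> cmp g -> cmp (fun x => f x + g x).
Proof.
move=> Hf Hg; apply: (@cmp_eq _ _ _ _
  (fun x => (pos (f x) + pos (g x))%N%:Z - (neg (f x) + neg (g x))%N%:Z)).
  by move=> x; rewrite [in RHS](posB (f x)) [in RHS](posB (g x)) !PoszD; ring.
by rewrite /pos /neg; cmp.
Qed.

Lemma cmp_oppz f : cmp f -> cmp (fun x => - f x).
Proof.
move=> Hf; apply: (@cmp_eq _ _ _ _ (fun x => (neg (f x))%:Z - (pos (f x))%:Z)).
  by move=> x; rewrite [in RHS](posB (f x)) opprB.
by rewrite /pos /neg; cmp.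
Qed.

Lemma cmp_mulz f g : cmp f -> cmp g -> cmp (fun x => f x * g x).
Proof.
move=> Hf Hg; apply: (@cmp_eq _ _ _ _
  (fun x => (pos (f x) * pos (g x) + neg (f x) * neg (g x))%N%:Z -
            (pos (f x) * neg (g x) + neg (f x) * pos (g x))%N%:Z)).
  by move=> x; rewrite [in RHS](posB (f x)) [in RHS](posB (g x)) !PoszD !PoszM; ring.
by rewrite /pos /neg; cmp.
Qed.

Lemma cmp_lez f g : cmp f -> cmp g -> cmp (fun x => f x <= g x).
Proof.
move=> Hf Hg; apply: (@cmp_eq _ _ _ _
  (fun x => (pos (f x) + neg (g x) <= pos (g x) + neg (f x))%N)).
  by move=> x; have := posB (f x); have := posB (g x); lia.
by rewrite /pos /neg; cmp.
Qed.

Lemma cmp_eqz f g : cmp f -> cmp g -> cmp (fun x => f x == g x).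
Proof.
move=> Hf Hg; apply: (@cmp_eq _ _ _ _
  (fun x => (pos (f x) + neg (g x) == pos (g x) + neg (f x))%N)).
  by move=> x; have := posB (f x); have := posB (g x); lia.
by rewrite /pos /neg; cmp.
Qed.

Lemma cmp_dvdz f g : cmp f -> cmp g -> cmp (fun x => (f x %| g x)%Z).
Proof.
move=> Hf Hg; apply: (@cmp_eq _ _ _ _ (fun x => `|g x| %% `|f x| == 0)%N); last by cmp.
by move=> x; rewrite dvdzE.
Qed.
End IntegerRing.

Hint Resolve cmp_Posz cmp_addz cmp_oppz cmp_mulz cmp_lez cmp_eqz cmp_dvdz : cmp.

Lemma cmp_sumz S T {cS : coded S} {cT : coded T} (F : S -> T -> int) (l : S -> seq T) :
  cmp (fun q => F q.1 q.2) -> cmp l -> cmp (fun x => \sum_(i <- l x) F x i).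
Proof.
move=> HF Hl; apply: (@cmp_eq _ _ _ _ (fun x => foldr (fun i z => F x i + z) 0 (l x))).
  by move=> x; elim: (l x) => [|i r IHr]; rewrite ?big_nil // big_cons -IHr.
by apply: (cmp_foldr (f := fun x i z => F x i + z)); cmp.
Qed.

Lemma cmp_nat_of_bool S {cS : coded S} (b : S -> bool) :
  cmp b -> cmp (fun x => nat_of_bool (b x)).
Proof.
move=> Hb; apply: (@cmp_eq _ _ _ _ (fun x => if b x then 1 else 0)%N); last by cmp.
by move=> x; case: (b x).
Qed.
Hint Resolve cmp_nat_of_bool : cmp.
Hint Extern 2 (cmp (fun x => \sum_(i <- _) @?F x i)) => apply: (cmp_sumz (F := F)) : cmp.

Lemma cmp_count S T {cS : coded S} {cT : coded T} (P : S -> T -> bool) (l : S -> seq T) :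
  cmp (fun q => P q.1 q.2) -> cmp l -> cmp (fun x => count (P x) (l x)).
Proof. by move=> HP Hl; apply: (cmp_foldr (f := fun x y k => (P x y + k)%N)); cmp. Qed.
Hint Extern 2 (cmp (fun x => count (@?P x) _)) => apply: (cmp_count (P := P)) : cmp.

Definition cmp_eqop (T : eqType) {cT : coded T} := cmp (fun q : T * T => q.1 == q.2).
Arguments cmp_eqop T {cT}.

Lemma cmp_eqT S (T : eqType) {cS : coded S} {cT : coded T} (f g : S -> T) :
  cmp_eqop T -> cmp f -> cmp g -> cmp (fun x => f x == g x).
Proof. by move=> HT Hf Hg; apply: (cmp_comp (f := fun x => (f x, g x)) HT); cmp. Qed.

Lemma cmp_eqop_nat : cmp_eqop nat. Proof. by rewrite /cmp_eqop; cmp. Qed.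
Lemma cmp_eqop_bool : cmp_eqop bool. Proof. by rewrite /cmp_eqop; cmp. Qed.

Lemma cmp_eqop_pair (T U : eqType) {cT : coded T} {cU : coded U} :
  cmp_eqop T -> cmp_eqop U -> cmp_eqop (T * U)%type.
Proof.
move=> HT HU; apply: (@cmp_eq _ _ _ _
  (fun q : T * U * (T * U) => (q.1.1 == q.2.1) && (q.1.2 == q.2.2))).
  by move=> [[a b] [c d]].
by apply: cmp_andb; apply: cmp_eqT; cmp.
Qed.

Lemma cmp_eqop_seq (T : eqType) {cT : coded T} : cmp_eqop T -> cmp_eqop (seq T).
Proof.
move=> HT; pose step (q : seq T * seq T) (a : bool * seq T) (y : T) :=
  if a.2 is z :: r then (a.1 && (y == z), r) else (false, [::]).
apply: (@cmp_eq _ _ _ _ (fun q => let a := foldl (step q) (true, q.2) q.1 in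
  a.1 && (size a.2 == 0%N))).
  move=> [s t] /=; rewrite -[RHS]andTb; elim: s t true => [|y s IHs] t b /=.
    by case: t.
  case: t => [|z t] /=; last by rewrite /step /= IHs eqseq_cons andbA.
  by rewrite andbF; elim: s {IHs} => //=; rewrite andbF.
have H : cmp (fun q : seq T * seq T => foldl (step q) (true, q.2) q.1).
  apply: (cmp_foldl (f := step)); try cmp.
  apply: (cmp_case (l := fun q => q.1.2.2) (g := fun _ => (false, [::]))
    (h := fun q z r => (q.1.2.1 && (q.2 == z), r))); try cmp.
  by apply: cmp_pair; last cmp; apply: cmp_andb; [cmp | apply: cmp_eqT; cmp].
by apply: cmp_andb; cmp.
Qed.
Hint Resolve cmp_eqop_nat cmp_eqop_bool cmp_eqop_pair cmp_eqop_seq cmp_eqT : cmp.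

Lemma cmp_perm_eq S (T : eqType) {cS : coded S} {cT : coded T} (f g : S -> seq T) :
  cmp_eqop T -> cmp f -> cmp g -> cmp (fun x => perm_eq (f x) (g x)).
Proof.
move=> HT Hf Hg; apply: (cmp_all (P := fun x y => count (fun z => z == y) (f x) ==
  count (fun z => z == y) (g x))); by cmp.
Qed.
Hint Resolve cmp_perm_eq : cmp.

(** * Unbounded search *)

(** Asking for all late stages of the enumeration, and not only for one, makes the
   components of a pair, which may appear at different stages, appear together. *)
Definition listable (T : Type) {cT : coded T} : Prop :=
  exists2 e : nat -> seq T, cmp e &
    forall x, exists k, forall n (P : pred T), (k <= n)%N -> P x -> has P (e n).
Arguments listable T {cT}.

Lemma listable_nat : listable nat.
Proof.
exists (fun n => iota 0 n); first by cmp.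
by move=> x; exists x.+1 => n P lt Px; apply/hasP; exists x; rewrite ?mem_iota.
Qed.

Lemma listable_bool : listable bool.
Proof.
by exists (fun=> [:: true; false]); [cmp | exists 0%N => n P _; case: x => /= ->; rewrite ?orbT].
Qed.

Lemma has_pairs (S T U : Type) (P : pred U) (f : S -> T -> U) s t :
  has P [seq f x y | x <- s, y <- t] = has (fun x => has (fun y => P (f x y)) t) s.
Proof. by elim: s => //= x s IHs; rewrite has_cat has_map IHs. Qed.

Section Listable.
Context {T U : Type} {cT : coded T} {cU : coded U}.

Lemma listable_map (f : T -> U) :
  listable T -> cmp f -> (forall y, exists x, f x = y) -> listable U.
Proof.
move=> [e He eP] Hf surj; exists (fun n => [seq f x | x <- e n]); first by cmp.
move=> y; have [x <-] := surj y; have [k kP] := eP x; exists k => n P kn Px.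
by rewrite has_map; apply: kP.
Qed.

Lemma listable_pair : listable T -> listable U -> listable (T * U)%type.
Proof.
move=> [e He eP] [e' He' eP']; exists (fun n => [seq (x, y) | x <- e n, y <- e' n]).
  by apply: (cmp_allpairs (f := fun _ x y => (x, y))); cmp.
move=> [x y]; have [k kP] := eP x; have [k' kP'] := eP' y; exists (k + k')%N => n P kn Pxy.
rewrite has_pairs; apply: (kP _ _ (leq_trans (leq_addr _ _) kn)).
exact: (kP' _ _ (leq_trans (leq_addl _ _) kn)).
Qed.

Lemma listable_seq : listable T -> listable (seq T).
Proof.
move=> [e He eP].
pose step (n : nat) (ws : seq (seq T)) := [::] :: [seq x :: w | x <- e n, w <- ws].
exists (fun n => iter n (step n) [::]).
  apply: (cmp_iter (f := step)); try cmp.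
  apply: cmp_cons; first by cmp.
  by apply: (cmp_allpairs (f := fun _ x w => x :: w)); cmp.
suff main s : exists k, forall n j (P : pred (seq T)), (k <= n)%N -> (size s < j)%N -> P s ->
    has P (iter j (step n) [::]).
  move=> s; have [k kP] := main s; exists (k + (size s).+1)%N => n P kn.
  by apply: kP; apply: leq_trans kn; rewrite (leq_addr, leq_addl).
elim: s => [|x s [k kP]]; first by exists 0%N => n [|j] // P _ _ /= ->.
have [k' kP'] := eP x; exists (k + k')%N => n [|j] // P kn sj Pxs.
rewrite iterS /=; apply/orP; right; rewrite has_pairs.
apply: (kP' _ _ (leq_trans (leq_addl _ _) kn)).
exact: (kP _ _ _ (leq_trans (leq_addr _ _) kn)).
Qed.
End Listable.
Lemma listable_int : listable int.
Proof.
apply: (@listable_map _ _ _ _ (fun q : nat * nat => q.1%:Z - q.2%:Z)).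
- by apply: listable_pair; apply: listable_nat.
- by cmp.
by case=> k; [exists (k, 0%N) | exists (0%N, k.+1)]; rewrite /=; lia.
Qed.

(** The program runs through the lists until one of them contains an element that
   passes the check. *)
Lemma computable_search (S T : Type) {cS : coded S} {cT : coded T}
    (D : S -> Prop) (check : S -> T -> bool) :
  listable T -> T -> cmp (fun q => check q.1 q.2) -> (forall x, D x -> exists c, check x c) ->
  exists2 f : S -> T, forall x, D x -> check x (f x) & computable_on encode encode D f.
Proof.
move=> [e He eP] c0 Hcheck total.
pose found x n := has (check x) (e n); pose stop x := least (fun n => found x n).
have stopP x : D x -> found x (stop x) /\ forall n, (n < stop x)%N -> ~~ found x n.
  move=> /total[c xc]; have [k kP] := eP c.
  have [|fnd lst] := @leastP (fun n => found x n).
    by exists k; apply: kP.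
  by split=> // n; rewrite ltnNge; apply: contra => /lst.
pose f x := head c0 [seq c <- e (stop x) | check x c].
exists f => [x /stopP[+ _]|].
  by rewrite /f /found; elim: (e _) => //= c s IHs; case: (boolP (check x c)).
have [test Htest] : cmp (fun q => ~~ found q.1 q.2) by rewrite /found; cmp.
have [next Hnext] : cmp (fun q : S * nat => (q.1, q.2.+1)) by cmp.
have [out Hout] : cmp (fun q : S * nat => head c0 [seq c <- e q.2 | check q.1 c]) by cmp.
exists (PSeq (PNode PId PLeaf) (PSeq (PWhile test next) out)) => x /stopP[fnd nfnd].
apply: (@RunSeq _ _ _ (encode (x, 0%N))); first by constructor; constructor.
apply: (RunSeq _ (Hout (x, stop x))).
have H k : forall n, (n + k)%N = stop x -> runs (PWhile test next) (encode (x, n)) (encode (x, stop x)).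
  elim: k => [|k IHk] n; first rewrite addn0 => ->.
    by apply: RunWhileF; have := Htest (x, stop x); rewrite /= fnd.
  move=> nk; apply: (@RunWhileT _ _ _ Leaf Leaf (encode (x, n.+1))).
  - by have := Htest (x, n); rewrite /= nfnd // -nk addnS ltnS leq_addr.
  - exact: Hnext (x, n).
  by apply: IHk; rewrite addSnnS.
by apply: (H (stop x)).
Qed.

(** A fraction is reduced by searching for its numerator and denominator, together
   with coefficients that prove them coprime. *)
Lemma runs_fraction : exists p, forall a b : nat, (0 < b)%N ->
  runs p (encode (a, b)) (enc_rat (a%:R / b%:R)).
Proof.
pose check (x : nat * nat) (c : nat * nat * (nat * nat)) :=
  [&& (0 < c.1.2)%N, (c.1.1 * x.2 == x.1 * c.1.2)%N & (c.2.1 * c.1.2 - c.2.2 * c.1.1 == 1)%N].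
have [||||f fP [p Hp]] := @computable_search _ _ _ _ (fun x => (0 < x.2)%N) check.
- by do !apply: listable_pair; apply: listable_nat.
- exact: (0, 0, (0, 0))%N.
- by rewrite /check; cmp.
- move=> [a b] /= b0; have g0 : (0 < gcdn a b)%N by rewrite gcdn_gt0 b0 orbT.
  have da := dvdn_gcdl a b; have db := dvdn_gcdr a b.
  have den0 : (0 < b %/ gcdn a b)%N by rewrite divn_gt0 // dvdn_leq.
  have /(coprimeP _ den0)[[u v] uv] : coprime (b %/ gcdn a b) (a %/ gcdn a b).
    rewrite /coprime -(eqn_pmul2r g0) muln_gcdl !divnK // gcdnC mul1n.
    by rewrite eqxx.
  exists ((a %/ gcdn a b, b %/ gcdn a b), (u, v))%N; apply/and3P; split=> //=.
    by rewrite muln_divA // mulnC muln_divA // mulnC.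
  exact/eqP.
have [q Hq] : cmp (fun c : nat * nat * (nat * nat) => (c.1.1%:Z, c.1.2%:Z)) by cmp.
exists (PSeq p q) => a b b0; apply: (RunSeq (Hp (a, b) b0)).
have := Hq (f (a, b)); congr runs; have := fP (a, b) b0.
case: (f _) => [[num den] [u v]] /and3P[/= den0 /eqP eq /eqP uv].
have cop : coprime den num by apply/(coprimeP _ den0); exists (u, v).
have -> : (a%:R / b%:R : rat) = num%:~R / den%:~R.
  apply/eqP; rewrite -!pmulrn eqr_div ?pnatr_eq0 -?lt0n // -!natrM eqr_nat.
  by rewrite eq.
have cop' : coprime `|num%:Z| `|den%:Z| by rewrite coprime_sym.
have den1 : 0 < den%:Z by [].
rewrite /enc_rat coprimeq_num // coprimeq_den // gtr0_sg // mul1r gtr0_norm //.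
by case: eqP => [E|//]; rewrite E in den1.
Qed.

(** * Checking certificates *)

#[global] Hint Transparent bs_word word : cmp.

Lemma arcs_nth (T : Type) (d : T) w :
  arcs w = [seq (nth d w i, nth d w (i.+1 %% size w)) | i <- iota 0 (size w)].
Proof.
apply: (@eq_from_nth _ (d, d)); first by rewrite size_map size_iota size_zip size_rot minnn.
rewrite size_zip size_rot minnn => i iw; rewrite nth_zip ?size_rot //.
rewrite (nth_map 0%N) ?size_iota // nth_iota // add0n; congr pair.
case: w iw => // a r; rewrite rot1_cons nth_rcons /= ltnS leq_eqVlt => /orP[/eqP->|ir].
  by rewrite ltnn eqxx modnn.
by rewrite ir modn_small.
Qed.

Section Checks.
Context {S : Type} {cS : coded S}.
Implicit Types (w u v : S -> bs_word) (zz : S -> turns) (m l : S -> int).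

Lemma cmp_arcs (w : S -> seq nat) : cmp w -> cmp (fun x => arcs (w x)).
Proof.
move=> Hw; apply: (@cmp_eq _ _ _ _ (fun x =>
  [seq (nth 0 (w x) i, nth 0 (w x) (i.+1 %% size (w x))) | i <- iota 0 (size (w x))])%N).
  by move=> x; rewrite (arcs_nth 0%N).
by cmp.
Qed.

Lemma cmp_a_pow m : cmp m -> cmp (fun x => a_pow (m x)).
Proof. by move=> Hm; rewrite /a_pow; cmp. Qed.
End Checks.

Hint Resolve cmp_arcs cmp_a_pow : cmp.

Section CmpEqualities.
Context {S : Type} {cS : coded S}.

Let cmp_eqop_word : cmp_eqop (seq (bool * bool)).
Proof. by apply/cmp_eqop_seq/cmp_eqop_pair; apply: cmp_eqop_bool. Qed.

Lemma cmp_eq_words (f g : S -> seq (seq (bool * bool))) :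
  cmp f -> cmp g -> cmp (fun x => f x == g x).
Proof.
have E : cmp_eqop (seq (seq (bool * bool))) by apply: cmp_eqop_seq.
by move=> Hf Hg; exact: (cmp_comp (f := fun x => (f x, g x)) E (cmp_pair Hf Hg)).
Qed.

Lemma cmp_eq_rule (f g : S -> seq (bool * bool) * seq (bool * bool)) :
  cmp f -> cmp g -> cmp (fun x => f x == g x).
Proof.
have E : cmp_eqop (seq (bool * bool) * seq (bool * bool))%type by apply: cmp_eqop_pair.
by move=> Hf Hg; exact: (cmp_comp (f := fun x => (f x, g x)) E (cmp_pair Hf Hg)).
Qed.
End CmpEqualities.

Definition bs_rules (m l : int) : seq (bs_word * bs_word) :=
  let rules := (let_t false :: a_pow m ++ [:: let_t true], a_pow l) ::
    [seq ([:: (x.1, x.2); (x.1, ~~ x.2)], [::]) |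
       x <- [:: (true, true); (true, false); (false, true); (false, false)]] in
  rules ++ [seq (r.2, r.1) | r <- rules].

(** The step (p, (u, v), q) rewrites the word p u q to p v q. *)
Definition rewriting := (bs_word * (bs_word * bs_word) * bs_word)%type.
Definition rw_src (s : rewriting) : bs_word := s.1.1 ++ s.1.2.1 ++ s.2.
Definition rw_dst (s : rewriting) : bs_word := s.1.1 ++ s.1.2.2 ++ s.2.

(** The words that the steps of a derivation start from, followed by v, agree
   with u followed by the words that the steps lead to. *)
Definition derives m l (u : bs_word) (st : seq rewriting) v : bool :=
  (u :: [seq rw_dst s | s <- st] == [seq rw_src s | s <- st] ++ [:: v]) &&
  all (fun s => has (fun r => r == s.1.2) (bs_rules m l)) st.

Lemma derives_nil m l u v : derives m l u [::] v = (u == v).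
Proof. by rewrite /derives /= andbT eqseq_cons andbT. Qed.

Lemma derives_cons m l u s st v : derives m l u (s :: st) v =
  [&& u == rw_src s, has (fun r => r == s.1.2) (bs_rules m l) & derives m l (rw_dst s) st v].
Proof. by rewrite /derives /= eqseq_cons -!andbA; congr andb; rewrite andbCA. Qed.

Lemma derives_sound m l u st v : derives m l u st v -> pres_eq (bs_rel m l) u v.
Proof.
have rule r : r \in bs_rules m l -> pres_eq (bs_rel m l) r.1 r.2.
  have base r' : r' \in take 5 (bs_rules m l) -> pres_eq (bs_rel m l) r'.1 r'.2.
    rewrite /= !inE => /or4P[/eqP->|/eqP->|/eqP->|/orP[/eqP->|/eqP->]] /=;
      by [apply: pres_rel; constructor | apply: pres_cancel].
  rewrite mem_cat => /orP[|/mapP[r' r'R ->]]; first exact: base.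
  by apply/pres_sym/base.
elim: st u => [|s st IHst] u; first by rewrite derives_nil => /eqP->; apply: pres_refl.
rewrite derives_cons => /and3P[/eqP-> /hasP[r /rule rE /eqP E] /IHst].
rewrite /rw_src /rw_dst -E; apply: pres_trans.
by apply/pres_cat/pres_cat; [apply: pres_refl | exact: rE | apply: pres_refl].
Qed.

Lemma derives_complete m l u v : pres_eq (bs_rel m l) u v -> exists st, derives m l u st v.
Proof.
have trans u1 u2 u3 : (exists st, derives m l u1 st u2) -> (exists st, derives m l u2 st u3) ->
    exists st, derives m l u1 st u3.
  move=> [st D1] [st' D2]; exists (st ++ st').
  elim: st u1 D1 => [|s st IHst] u1 /=; first by rewrite derives_nil => /eqP->.
  by rewrite !derives_cons => /and3P[-> -> /IHst].
have step p q r : r \in bs_rules m l -> exists st, derives m l (p ++ r.1 ++ q) st (p ++ r.2 ++ q).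
  move=> rR; exists [:: (p, r, q)]; rewrite derives_cons derives_nil.
  by apply/and3P; split=> //; apply/hasP; exists r.
have rulesC r : r \in bs_rules m l -> (r.2, r.1) \in bs_rules m l.
  rewrite !mem_cat => /orP[rR|/mapP[r' r'R ->]]; apply/orP; [right|left].
    by apply/mapP; exists r.
  by case: r' r'R.
have rule u' v' : (u', v') \in bs_rules m l -> exists st, derives m l u' st v'.
  by move=> /(step [::] [::]); rewrite /= !cats0.
elim=> {u v} [u|u v _ [st D]|u v w _ uv _ vw|u u' v v' _ [st D] _ [st' D']|x e|u v []].
- by exists [::]; rewrite derives_nil.
- elim: st u D => [|s st IHst] u; first by rewrite derives_nil => /eqP->; exists [::]; rewrite derives_nil.
  rewrite derives_cons => /and3P[/eqP-> /hasP[r /rulesC rR /eqP sE] /IHst D].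
  by apply: trans D _; have := step s.1.1 s.2 _ rR; rewrite sE.
- exact: trans uv vw.
- apply: (@trans _ (u' ++ v)).
    exists [seq (s.1.1, s.1.2, s.2 ++ v) | s <- st].
    elim: st u D => [|s st IHst] u; first by rewrite derives_nil => /eqP->; rewrite derives_nil.
    rewrite derives_cons => /and3P[/eqP-> rR /IHst]; rewrite derives_cons rR /=.
    by rewrite /rw_src /rw_dst /= -!catA eqxx.
  exists [seq (u' ++ s.1.1, s.1.2, s.2) | s <- st'].
  elim: st' v D' => [|s st' IHst] v; first by rewrite derives_nil => /eqP->; rewrite derives_nil.
  rewrite derives_cons => /and3P[/eqP-> rR /IHst]; rewrite derives_cons rR /=.
  by rewrite /rw_src /rw_dst /= -!catA eqxx.
- by apply: rule; case: x; case: e; rewrite !inE /= ?eqxx ?orbT.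
- by apply: rule; rewrite !inE eqxx.
Qed.

Lemma cmp_bs_rules S {cS : coded S} (m l : S -> int) : cmp m -> cmp l -> cmp (fun x => bs_rules (m x) (l x)).
Proof.
move=> Hm Hl; rewrite /bs_rules /let_t.
have H : cmp (fun x => (((true, false) : bool * bool) :: a_pow (m x) ++ [:: (true, true)], a_pow (l x)) ::
    [seq ([:: (x.1, x.2); (x.1, ~~ x.2)], [::]) |
       x <- [:: (true, true); (true, false); (false, true); (false, false)]]).
  by cmp.
by cmp.
Qed.
Hint Resolve cmp_bs_rules : cmp.

Lemma cmp_derives S {cS : coded S} (m l : S -> int) (u v : S -> bs_word) (st : S -> seq rewriting) :
  cmp m -> cmp l -> cmp u -> cmp v -> cmp st ->
  cmp (fun x => derives (m x) (l x) (u x) (st x) (v x)).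
Proof.
move=> Hm Hl Hu Hv Hst; rewrite /derives /rw_src /rw_dst.
apply: cmp_andb; first by apply: cmp_eq_words; cmp.
apply: (cmp_all (P := fun x s => has (fun r => r == s.1.2) (bs_rules (m x) (l x)))); try cmp.
apply: (cmp_has (P := fun q r => r == q.2.1.2)); try cmp.
  by apply: cmp_eq_rule; cmp.
by apply: cmp_bs_rules; cmp.
Qed.
Hint Resolve cmp_derives : cmp.

Section CmpPrimal.
Context {S : Type} {cS : coded S}.
Variables (m l : S -> int) (zz : S -> turns) (n : S -> nat) (PX PY : S -> seq (seq nat)).
Hypotheses (Hm : cmp m) (Hl : cmp l) (Hzz : cmp zz) (Hn : cmp n)
  (HX : cmp PX) (HY : cmp PY).

Lemma cmp_turn_word : cmp (fun x => turn_word (zz x)).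
Proof. by rewrite /turn_word /let_t; cmp. Qed.

Lemma cmp_reduced : cmp (fun x => reduced (m x) (l x) (zz x)).
Proof.
by apply: (cmp_all (P := fun x c => ~~ (m x %| c.1)%Z && ~~ (l x %| c.2)%Z)); cmp.
Qed.

Lemma cmp_discX (w : S -> seq nat) : cmp w -> cmp (fun x => discX (m x) (zz x) (w x)).
Proof. by move=> Hw; rewrite /discX /xexp; cmp. Qed.

Lemma cmp_discY (w : S -> seq nat) : cmp w -> cmp (fun x => discY (l x) (zz x) (w x)).
Proof. by move=> Hw; rewrite /discY /yexp; cmp. Qed.

Lemma cmp_primal_ok : cmp (fun x => primal_ok (zz x) (n x) (PX x) (PY x)).
Proof.
apply: (@cmp_eq _ _ _ _ (fun x => [&& (0 < n x)%N,
    all (fun w => (size w != 0)%N && all (fun k => k < size (zz x))%N w) (PX x ++ PY x),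
    perm_eq (flatten [seq arcs w | w <- PX x])
      [seq (a.2, a.1.+1 %% size (zz x))%N | a <- flatten [seq arcs w | w <- PY x]]
    & all (fun k => count (fun i => i == k) (flatten (PX x)) == n x) (iota 0 (size (zz x)))])).
  move=> x; rewrite /primal_ok; congr [&& _, _, _ & _].
  by apply: eq_all => w; rewrite size_eq0.
apply: cmp_andb; first by cmp.
apply: cmp_andb; first by cmp.
apply: cmp_andb; last first.
  by apply: (cmp_all (P := fun x (k : nat) => count (fun i => i == k) (flatten (PX x)) == n x)); cmp.
have E : cmp_eqop (nat * nat)%type by apply: cmp_eqop_pair; apply: cmp_eqop_nat.
have HaX : cmp (fun x => flatten [seq arcs w | w <- PX x]) by cmp.
have HaY : cmp (fun x => [seq (a.2, a.1.+1 %% size (zz x))%N |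
  a <- flatten [seq arcs w | w <- PY x]]) by cmp.
exact: (cmp_perm_eq E HaX HaY).
Qed.
End CmpPrimal.
Hint Resolve cmp_turn_word cmp_reduced cmp_discX cmp_discY cmp_primal_ok : cmp.

Lemma cmp_ndiscs S {cS : coded S} (m l : S -> int) (zz : S -> turns) (PX PY : S -> seq (seq nat)) :
  cmp m -> cmp l -> cmp zz -> cmp PX -> cmp PY ->
  cmp (fun x => ndiscs (m x) (l x) (zz x) (PX x) (PY x)).
Proof.
move=> Hm Hl Hzz HX HY; rewrite /ndiscs; apply: cmp_addn.
  by apply: (cmp_count (P := fun x w => discX (m x) (zz x) w)); cmp.
by apply: (cmp_count (P := fun x w => discY (l x) (zz x) w)); cmp.
Qed.
Hint Resolve cmp_ndiscs : cmp.

Lemma cmp_walks S {cS : coded S} (N L : S -> nat) :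
  cmp N -> cmp L -> cmp (fun x => walks (N x) (L x)).
Proof.
move=> HN HL; pose step x (ws : seq (seq nat)) := [seq k :: w | k <- iota 0 (N x), w <- [::] :: ws].
apply: (@cmp_eq _ _ _ _ (fun x => iter (L x) (step x) [::])).
  by move=> x; elim: (L x) => //= j ->.
apply: (cmp_iter (f := step)); try cmp.
by apply: (cmp_allpairs (f := fun _ k w => k :: w)); cmp.
Qed.
Hint Resolve cmp_walks : cmp.

(** A matrix of prices, given by its rows. *)
Definition tab (P : seq (seq int)) i j : int := nth 0 (nth [::] P i) j.

(** The tables P and al hold the prices multiplied by their common denominator B;
   only the short walks have to be tested, by [dual_extend]. *)
Definition dual_ok m l (zz : turns) (B : nat) P (al : seq int) : bool :=
  (0 < B)%N && all (fun w =>
    ((discX m zz w * B)%N%:Z <= \sum_(a <- arcs w) tab P a.1 a.2 + \sum_(k <- w) nth 0 al k) &&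
    ((discY l zz w * B)%N%:Z <= - \sum_(a <- arcs w) tab P a.2 (a.1.+1 %% size zz)%N))
  (walks (size zz) (walk_bound m l zz)).

Lemma cmp_dual_ok S {cS : coded S} (m l : S -> int) (zz : S -> turns) (B : S -> nat)
    (P : S -> seq (seq int)) (al : S -> seq int) :
  cmp m -> cmp l -> cmp zz -> cmp B -> cmp P -> cmp al ->
  cmp (fun x => dual_ok (m x) (l x) (zz x) (B x) (P x) (al x)).
Proof.
move=> Hm Hl Hzz HB HP Hal; rewrite /dual_ok /tab /walk_bound.
have HX : cmp (fun q : S * seq nat => \sum_(a <- arcs q.2) nth 0 (nth [::] (P q.1) a.1) a.2).
  by apply: (cmp_sumz (F := fun q a => nth 0 (nth [::] (P q.1) a.1) a.2)); cmp.
have Ha : cmp (fun q : S * seq nat => \sum_(k <- q.2) nth 0 (al q.1) k).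
  by apply: (cmp_sumz (F := fun q k => nth 0 (al q.1) k)); cmp.
have HY : cmp (fun q : S * seq nat =>
    \sum_(a <- arcs q.2) nth 0 (nth [::] (P q.1) a.2) (a.1.+1 %% size (zz q.1))%N).
  by apply: (cmp_sumz (F := fun q a => nth 0 (nth [::] (P q.1) a.2) (a.1.+1 %% size (zz q.1))%N)); cmp.
apply: cmp_andb; first by cmp.
apply: (cmp_all (P := fun x w =>
    ((discX (m x) (zz x) w * B x)%N%:Z <= \sum_(a <- arcs w) nth 0 (nth [::] (P x) a.1) a.2 + \sum_(k <- w) nth 0 (al x) k) &&
    ((discY (l x) (zz x) w * B x)%N%:Z <= - \sum_(a <- arcs w) nth 0 (nth [::] (P x) a.2) (a.1.+1 %% size (zz x))%N))).
  apply: cmp_andb; apply: cmp_lez; [by cmp | exact: cmp_addz HX Ha | by cmp | exact: cmp_oppz HY].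
by cmp.
Qed.
Hint Resolve cmp_dual_ok : cmp.

Lemma common_denominator (s : seq rat) :
  exists2 B, (0 < B)%N & forall r, r \in s -> exists z : int, r * B%:R = z%:~R.
Proof.
elim: s => [|q s [B B0 IHs]]; first by exists 1%N.
exists (`|denq q| * B)%N => [|r]; first by rewrite muln_gt0 B0 absz_gt0 denq_neq0.
have dq : (`|denq q|%N%:R : rat) = (denq q)%:~R.
  by rewrite pmulrn gez0_abs // ltW // denq_gt0.
rewrite in_cons natrM dq => /orP[/eqP->|/IHs[z rz]].
  by exists (numq q * B%:Z); rewrite intrM numqE -pmulrn mulrA.
by exists (denq q * z); rewrite mulrCA rz intrM.
Qed.

Lemma big_iota (V : nmodType) (f : nat -> V) N :
  \sum_(k <- iota 0 N) f k = \sum_(k < N) f k.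
Proof. by rewrite -(big_mkord xpredT) /index_iota subn0. Qed.

Section DualTables.
Variables (m l : int) (zz : turns).
Hypotheses (m0 : m != 0) (l0 : l != 0).
Local Notation N := (size zz).

Lemma dual_ok_sound B P al : dual_ok m l zz B P al ->
  dual_feasible m l zz (fun i j => (tab P i j)%:~R / B%:R : rat)
    (fun k => (nth 0 al k)%:~R / B%:R).
Proof.
move=> /andP[B0 /allP ok]; have BR : 0 < B%:R :> rat by rewrite ltr0n.
apply: dual_extend => // w /ok/andP[]; rewrite -!(ler_int rat) -!pmulrn !natrM.
rewrite rmorphD rmorphN !rmorph_sum /= /priceX /priceY -!mulr_suml -mulrDl -mulNr.
by rewrite !ler_pdivlMr.
Qed.

Lemma dual_ok_complete (p : nat -> nat -> rat) a : dual_feasible m l zz p a ->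
  exists B P al, dual_ok m l zz B P al /\
    forall k, (k < N)%N -> (nth 0 al k)%:~R = a k * B%:R.
Proof.
move=> dual.
have [B B0 BP] := common_denominator
  ([seq p i j | i <- iota 0 N, j <- iota 0 N] ++ [seq a k | k <- iota 0 N]).
have num r z : r * B%:R = z%:~R -> (numq (r * B%:R))%:~R = r * B%:R by move=> ->; rewrite numq_int.
pose P := mkseq (fun i => mkseq (fun j => numq (p i j * B%:R)) N) N.
pose al := mkseq (fun k => numq (a k * B%:R)) N.
have PE i j : (i < N)%N -> (j < N)%N -> (tab P i j)%:~R = p i j * B%:R.
  move=> iN jN; rewrite /tab !nth_mkseq //; have [|z] := BP (p i j); last exact: num.
  by rewrite mem_cat allpairs_f ?mem_iota.
have aE k : (k < N)%N -> (nth 0 al k)%:~R = a k * B%:R.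
  move=> kN; rewrite nth_mkseq //; have [|z] := BP (a k); last exact: num.
  by rewrite mem_cat (map_f a) ?orbT ?mem_iota.
exists B, P, al; split=> //; rewrite /dual_ok B0; apply/allP => w.
rewrite mem_walks => /and3P[w0 _ wN]; have [leX leY] := dual w w0 wN.
have BR : 0 < B%:R :> rat by rewrite ltr0n.
have arcN x : x \in arcs w -> (x.1 < N)%N && (x.2 < N)%N.
  move=> xw; have N0 : (0 < N)%N by case: (w) w0 wN => //= k r _ /andP[/(leq_ltn_trans _)->].
  have mem1 := map_f fst xw; have mem2 := map_f snd xw.
  rewrite !(allP wN) //.
    by move: mem2; rewrite [X in _ \in X]unzip2_zip ?size_rot // mem_rot.
  by move: mem1; rewrite [X in _ \in X]unzip1_zip ?size_rot.
rewrite -!(ler_int rat) -!pmulrn !natrM rmorphD rmorphN !rmorph_sum /=.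
have -> : \sum_(x <- arcs w) (tab P x.1 x.2)%:~R = (\sum_(x <- arcs w) p x.1 x.2) * B%:R.
  by rewrite mulr_suml; apply: eq_big_seq => x /arcN/andP[x1 x2]; apply: PE.
have -> : \sum_(x <- arcs w) (tab P x.2 (x.1.+1 %% N))%:~R =
    (\sum_(x <- arcs w) p x.2 (x.1.+1 %% N)%N) * B%:R.
  rewrite mulr_suml; apply: eq_big_seq => x /arcN/andP[x1 x2]; apply: PE => //.
  by rewrite ltn_pmod // (leq_ltn_trans _ x1).
have -> : \sum_(k <- w) (nth 0 al k)%:~R = (\sum_(k <- w) a k) * B%:R.
  by rewrite mulr_suml; apply: eq_big_seq => k /(allP wN); apply: aE.
by rewrite -mulrDl -mulNr !ler_pM2r // leX leY.
Qed.
End DualTables.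

Definition certificate :=
  (turns * (bs_word * seq rewriting) * (nat * seq (seq nat) * seq (seq nat)) *
   (nat * seq (seq int) * seq int))%type.

Section Certificates.
Variable c : certificate.
Definition c_turns : turns := c.1.1.1.
Definition c_conj : bs_word := c.1.1.2.1.
Definition c_steps : seq rewriting := c.1.1.2.2.
Definition c_copies : nat := c.1.2.1.1.
Definition c_X : seq (seq nat) := c.1.2.1.2.
Definition c_Y : seq (seq nat) := c.1.2.2.
Definition c_denom : nat := c.2.1.1.
Definition c_price : seq (seq int) := c.2.1.2.
Definition c_visit : seq int := c.2.2.

(** The last condition says that the primal and the dual solution have the same
   value; the first ones say that the conjugate of the input by the word c_conj
   is the product of the turns. *)
Definition certified (x : bs_input) : bool := let m := x.1.1 in let l := x.1.2 in
  [&& (0 < size c_turns)%N,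
      derives m l (x.2 ++ c_conj) c_steps (c_conj ++ turn_word c_turns),
      reduced m l c_turns, primal_ok c_turns c_copies c_X c_Y,
      dual_ok m l c_turns c_denom c_price c_visit &
      (\sum_(k <- iota 0 (size c_turns)) nth 0 c_visit k) * c_copies%:Z ==
        (ndiscs m l c_turns c_X c_Y * c_denom)%N%:Z].

Definition c_discs (x : bs_input) : nat := ndiscs x.1.1 x.1.2 c_turns c_X c_Y.
End Certificates.

Lemma cmp_certified : cmp (fun q : bs_input * certificate => certified q.2 q.1).
Proof.
rewrite /certified /c_turns /c_conj /c_steps /c_copies /c_X /c_Y /c_denom /c_price /c_visit.
have Hs : cmp (fun q : bs_input * certificate =>
    \sum_(k <- iota 0 (size q.2.1.1.1)) nth 0 q.2.2.2 k).
  by apply: (cmp_sumz (F := fun q k => nth 0 q.2.2.2 k)); cmp.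
apply: cmp_andb; first by cmp.
apply: cmp_andb; first by apply: cmp_derives; cmp.
apply: cmp_andb; first by cmp.
apply: cmp_andb; first by cmp.
apply: cmp_andb; first by cmp.
by apply: cmp_eqz; [apply: cmp_mulz; [exact: Hs | cmp] | cmp].
Qed.

Lemma listable_certificate : listable certificate.
Proof.
have W : listable bs_word by apply/listable_seq/listable_pair; apply: listable_bool.
have N := listable_nat; have Z := listable_int.
by repeat first [exact: W | exact: N | exact: Z | apply: listable_pair | apply: listable_seq].
Qed.

Section CertificateMeaning.
Variables (m l : int) (w : bs_word).
Hypotheses (m0 : m != 0) (l0 : l != 0) (ml : m != l).
Local Notation g := (bs_eval m l w).

Lemma certified_conj c : certified c (m, l, w) -> Defs.conjugate g (alt_elt m l (c_turns c)).
Proof.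
move=> /and5P[_ /derives_sound D _ _ _]; exists (bs_eval m l (c_conj c)).
have /word_evalP E := D; rewrite -bs_eval_turns // conjgE.
by rewrite -[word_eval _ _]/(bs_eval _ _ _) -[in RHS]/(bs_eval _ _ _) !bs_evalM in E; rewrite E mulKg.
Qed.

Lemma certified_scl (R : realType) c : certified c (m, l, w) ->
  scl R g = (ratr (((size (c_turns c))%:R -
    (c_discs c (m, l, w))%:R / (c_copies c)%:R) / 2%:R))%:E.
Proof.
move=> cP; have gc := certified_conj cP; case/and5P: cP => z0 _ red Pok /andP[dual /eqP opt].
have dfeas := dual_ok_sound m0 l0 dual.
apply: (scl_alternating m0 l0 R ml gc z0 red Pok dfeas).
have BR : (c_denom c)%:R != 0 :> rat by case/andP: dual => B0 _; rewrite pnatr_eq0 -lt0n.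
have := congr1 (fun z : int => z%:~R : rat) opt.
rewrite /= intrM rmorph_sum /= -!pmulrn natrM => E.
apply: (mulIf BR); apply: etrans E; rewrite -mulr_suml mulrAC mulfVK //; congr (_ * _).
by rewrite big_iota.
Qed.

Lemma certified_t_length c : alternating_t_shape g -> certified c (m, l, w) ->
  t_length g = (size (c_turns c)).*2.
Proof.
move=> alt cP; have gc := certified_conj cP; case/and5P: cP => z0 _ red _ _.
exact: (alternating_size m0 l0 alt z0 red gc).
Qed.

Lemma certified_discs_le c : certified c (m, l, w) -> (0 < c_copies c)%N /\
  (c_discs c (m, l, w) <= c_copies c * size (c_turns c))%N.
Proof.
by case/and5P => z0 _ red Pok _; split; [case/and4P: Pok | exact: (ndiscs_le z0 red Pok)].
Qed.

Lemma certificate_exists : alternating_t_shape g -> exists c, certified c (m, l, w).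
Proof.
move=> /(alternating_turns m0 l0)[zz [z0 red [x gx] _]].
have [n [PX [PY [p [a [Pok dual opt]]]]]] := optimum m0 l0 z0 red.
have [B [P [al [ok aE]]]] := dual_ok_complete dual.
have [z zE] := bs_eval_surj x.
have [st D] : exists st, derives m l (w ++ z) st (z ++ turn_word zz).
  apply/derives_complete/word_evalP.
  rewrite -[LHS]/(bs_eval m l _) -[RHS]/(bs_eval m l _) !bs_evalM bs_eval_turns // gx -zE.
  by rewrite conjgE mulKVg.
exists (zz, (z, st), (n, PX, PY), (B, P, al)).
apply/and5P; split=> //; apply/andP; split=> //=; apply/eqP.
apply: (@intr_inj rat); rewrite intrM rmorph_sum /= -!pmulrn natrM -opt [RHS]mulrAC; congr (_ * _).
rewrite mulr_suml big_iota.
by apply: eq_bigr => k _; apply: aE.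
Qed.
End CertificateMeaning.

(** * The algorithm *)

Lemma computable_fraction (S : Type) {cS : coded S} (D : S -> Prop) (a b : S -> nat) :
  computable_on encode encode D (fun x => (a x, b x)) -> (forall x, D x -> (0 < b x)%N) ->
  computable_on encode enc_rat D (fun x => (a x)%:R / (b x)%:R : rat).
Proof.
move=> [p Hp] b0; have [q Hq] := runs_fraction.
by exists (PSeq p q) => x Dx; apply: RunSeq (Hp x Dx) (Hq _ _ (b0 x Dx)).
Qed.

(** Maximize x subject to x = q. *)
Definition point_LP (q : rat) : ratLP :=
  @RatLP 1 (const_mx 1) [:: (const_mx 1, q)] [::].

Lemma point_LP_maximum (R : realType) q : lp_maximum (point_LP q) (ratr q : R).
Proof.
have form (x : 'rV[R]_1) : lp_form (const_mx 1) x = x ord0 ord0.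
  by rewrite /lp_form big_ord1 mxE rmorph1 mul1r.
split; last by move=> y [/(_ (const_mx 1, q) (mem_head _ _)) /= -> _].
by exists (const_mx (ratr q)); [split=> c; rewrite // inE => /eqP -> |]; rewrite form mxE.
Qed.

Lemma computable_point_LP (S : Type) {cS : coded S} (D : S -> Prop) (q : S -> rat) :
  computable_on encode enc_rat D q -> computable_on encode enc_ratLP D (fun x => point_LP (q x)).
Proof.
move=> [p Hp]; have cst t : exists r, forall u, runs r u t.
  by have [r Hr] := @cmp_cst tree tree id id t; exists r.
have [r1 H1] := cst (Node (enc_nat 1) (enc_row (const_mx 1 : 'rV[rat]_1))).
have [r2 H2] := cst (enc_row (const_mx 1 : 'rV[rat]_1)).
exists (PNode r1 (PNode (PNode (PNode r2 p) PLeaf) PLeaf)) => x Dx.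
by do !constructor => //; exact: Hp.
Qed.

Theorem theorem1p1 (R : realType) :
  (exists LP : bs_input -> ratLP,
     computable_on enc_bs_input enc_ratLP alternating_input LP /\
     forall (m l : int) (w : bs_word),
       m != 0 -> l != 0 -> m != l ->
       alternating_t_shape (bs_eval m l w) ->
       exists theta : R,
         lp_maximum (LP (m, l, w)) theta /\
         scl R (bs_eval m l w) =
           ((t_length (bs_eval m l w))%:R / 4 - theta / 2)%:E) /\
  (exists sclQ : bs_input -> rat,
     computable_on enc_bs_input enc_rat alternating_input sclQ /\
     forall (m l : int) (w : bs_word),
       m != 0 -> l != 0 -> m != l ->
       alternating_t_shape (bs_eval m l w) ->
       scl R (bs_eval m l w) = (ratr (sclQ (m, l, w)))%:E) /\
  (forall (m l : int) (g : BS m l),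
     m != 0 -> l != 0 -> m != l -> alternating_t_shape g ->
     exists q : rat, scl R g = (ratr q)%:E).
Proof.
have c0 : certificate := (([::], ([::], [::]), (0%N, [::], [::])), (0%N, [::], [::])).
have [|f fP [p Hp]] := @computable_search _ _ _ _ alternating_input
    (fun x c => certified c x) listable_certificate c0 cmp_certified.
  by move=> [[m l] w] [m0 l0 ml alt]; apply: (certificate_exists m0 l0 alt).
have compute (num den : bs_input * certificate -> nat) : cmp num -> cmp den ->
    (forall x, alternating_input x -> (0 < den (x, f x))%N) ->
    computable_on enc_bs_input enc_rat alternating_input
      (fun x => (num (x, f x))%:R / (den (x, f x))%:R).
  move=> Hnum Hden den0; apply: computable_fraction den0.
  have [q Hq] := cmp_pair Hnum Hden; exists (PSeq (PNode PId p) q) => x Dx.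
  by apply: (@RunSeq _ _ _ _ _ _ (Hq (x, f x))); constructor; [constructor | apply: Hp].
pose num (q : bs_input * certificate) := c_discs q.2 q.1.
pose den (q : bs_input * certificate) := c_copies q.2.
have Hnum : cmp num by rewrite /num /c_discs /c_turns /c_X /c_Y; cmp.
have Hden : cmp den by rewrite /den /c_copies; cmp.
have Hsize : cmp (fun q : bs_input * certificate => size (c_turns q.2)).
  by rewrite /c_turns; cmp.
have bounds x : alternating_input x -> (0 < den (x, f x))%N /\
    (num (x, f x) <= den (x, f x) * size (c_turns (f x)))%N.
  by case: x => [[m l] w] Dx; have := certified_discs_le (fP _ Dx).
pose theta x : rat := (num (x, f x))%:R / (den (x, f x))%:R.
pose sclQ x : rat := ((size (c_turns (f x)))%:R - theta x) / 2%:R.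
have sclE m l w : m != 0 -> l != 0 -> m != l -> alternating_t_shape (bs_eval m l w) ->
    scl R (bs_eval m l w) = (ratr (sclQ (m, l, w)))%:E.
  by move=> m0 l0 ml alt; apply: (certified_scl m0 l0 ml R (fP (m, l, w) _)).
split; [|split].
- exists (fun x => point_LP (theta x)); split.
    apply: computable_point_LP; apply: compute Hnum Hden _.
    by move=> x /bounds[].
  move=> m l w m0 l0 ml alt; exists (ratr (theta (m, l, w))); split; first exact: point_LP_maximum.
  rewrite sclE // (certified_t_length m0 l0 alt (fP (m, l, w) _)) //; congr EFin.
  rewrite rmorphM rmorphB /= fmorphV !ratr_nat -muln2 natrM.
  by field.
- exists sclQ; split=> //.
  have [|||q Hq] := compute (fun q => den q * size (c_turns q.2) - num q)%N (fun q => den q * 2)%N.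
  - by apply: cmp_subn => //; apply: cmp_muln.
  - by apply: cmp_muln => //; apply: cmp_cst.
  - by move=> x /bounds[? _]; rewrite muln_gt0 andbT.
  exists q => x Dx; have := Hq x Dx; congr (runs _ _ (enc_rat _)).
  have [d0 le] := bounds x Dx; rewrite natrB // !natrM /sclQ /theta.
  have dR : (den (x, f x))%:R != 0 :> rat by rewrite pnatr_eq0 -lt0n.
  by field.
- move=> m l g m0 l0 ml alt; have [w wE] := bs_eval_surj g.
  by exists (sclQ (m, l, w)); rewrite -wE; apply: sclE => //; rewrite wE.
Qed.
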